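(* Let $\pi_0\in\mathcal M(X)$ be fixed and, for each $n$, let $y\sim \mathrm{Mn}(n,\pi_0)$ be multinomial with sample size $n$ and probability vector $\pi_0$. Let $\tilde\pi$, $\hat\pi$, $\hat\alpha$, $\hat\gamma$, $\sigma^2_{\hat\alpha}$, $\sigma^2_{\hat\gamma}$ be as defined in the context. Then, as $n\to\infty$: (1) $\hat\alpha$ and $\hat\gamma$ are asymptotically normal, $\hat\alpha\sim N(0,\sigma^2_{\hat\alpha})$ and $\hat\gamma\sim N(1,\sigma^2_{\hat\gamma})$, i.e. $\hat\alpha/\sigma_{\hat\alpha}$ and $(\hat\gamma-1)/\sigma_{\hat\gamma}$ both converge in distribution to $N(0,1)$; (2) the likelihood ratio statistic $D_M=2y'[\log\tilde\pi-\log\hat\pi]$ converges in distribution to $\chi^2_1$; (3) the statistics $L=\hat\alpha^2/\sigma^2_{\hat\alpha}$ and $G=(\hat\gamma-1)^2/\sigma^2_{\hat\gamma}$ are asymptotically equivalent to $D_M$.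
   Context: A prime denotes transposition; $\log$ and $\exp$ of vectors are componentwise; $\mathbf 1$ is the vector of ones. $X$ is an $r\times k$ matrix with entries in $\{0,1\}$, of full column rank, such that $\mathbf 1_r$ is not in the column space of $X$ and every row of $X$ contains at least one $1$. $\mathcal P=\{\pi\in\mathbb R^r:\pi_j>0\text{ for all }j,\ \mathbf 1'\pi=1\}$ and the multiplicative model is $\mathcal M(X)=\{\pi\in\mathcal P:\log\pi=X\theta\text{ for some }\theta\in\mathbb R^k\}$. It is the submodel of the log-linear model $$\log\pi=X\theta-\mathbf 1\log(\mathbf 1'\exp(X\theta)),\qquad \theta\in\mathbb R^k,$$ obtained by imposing the single constraint $\log(\mathbf 1'\exp(X\theta))=0$. Let $p=y/n$. $\tilde\pi$ is the maximum likelihood estimate of $\pi$ under the log-linear model, and $\hat\pi$ is the maximum likelihood estimate under $\mathcal M(X)$ (both exist with probability tending to $1$). $\hat\alpha$ is the Lagrange multiplier at the constrained maximum in the scaled Lagrangian $$p'X\theta-\log(\mathbf 1'\exp(X\theta))-\alpha\log(\mathbf 1'\exp(X\theta)),$$ so that $X'p=(1+\hat\alpha)X'\hat\pi$, and $\hat\gamma=1/(1+\hat\alpha)$ is the adjustment factor, so that $\hat\gamma X'p=X'\hat\pi$. Put $\hat F=X'[\operatorname{diag}(\hat\pi)-\hat\pi\hat\pi']X$ and $$\sigma^2_{\hat\alpha}=\left[n\,\hat\pi'X\hat F^{-1}X'\hat\pi\right]^{-1},\qquad \sigma^2_{\hat\gamma}=\sigma^2_{\hat\alpha}/\hat\gamma^4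 .$$ Two sequences of statistics are called asymptotically equivalent if their difference converges to $0$ in probability. *)

(* Defs.v *)
From HB Require Import structures.
From mathcomp Require Import all_boot all_order all_algebra.
From mathcomp Require Import all_classical all_reals all_analysis.
From mathcomp Require Import measurable_realfun.

Set Implicit Arguments.
Unset Strict Implicit.
Unset Printing Implicit Defensive.

Import Order.TTheory GRing.Theory Num.Theory.
Import numFieldNormedType.Exports.

Local Open Scope classical_set_scope.
Local Open Scope ring_scope.

Section Convergence.
Context {R : realType} {d : nat -> measure_display}
  {T : forall n, measurableType (d n)}.

(* The n-th random variable lives on its own probability space. *)
Definition cvg_in_distribution (P : forall n, probability (T n) R)
    (Z : forall n, T n -> R) (mu : probability (measurableTypeR R) R) : Prop :=
  (forall n, measurable_fun setT (Z n)) /\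
  (forall x : R, {for x, continuous (fun t : R => mu `]-oo, t]%classic)} ->
     (fun n => P n [set w | Z n w <= x]) @ \oo --> mu `]-oo, x]%classic).

Definition asymptotically_equivalent (P : forall n, probability (T n) R)
    (Z W : forall n, T n -> R) : Prop :=
  (forall n, measurable_fun setT (Z n)) /\
  (forall n, measurable_fun setT (W n)) /\
  (forall e : R, 0 < e ->
     (fun n => P n [set w | e <= `|Z n w - W n w|]) @ \oo --> 0%E).

End Convergence.

Section ChiSquare.
Variable R : realType.

Definition square (x : measurableTypeR R) : measurableTypeR R := (x : R) ^+ 2.

Lemma measurable_square : measurable_fun setT square.
Proof. exact: (@exprn_measurable R). Qed.

HB.instance Definition _ :=
  isMeasurableFun.Build _ _ _ _ square measurable_square.

Definition std_normal : probability (measurableTypeR R) R := normal_prob 0 1.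

(* chi-square with one degree of freedom: the law of the square of a
   standard normal variable *)
Definition chi_square1 : probability (measurableTypeR R) R :=
  distribution std_normal square.

End ChiSquare.

Section Multinomial.
Variables (R : realType) (r : nat).

Definition multinomial_pmf (n : nat) (pi : 'cV[R]_r) (c : 'cV[nat]_r) : R :=
  if (\sum_j c j ord0 == n)%N then
    (n`!)%:R / (\prod_j (c j ord0)`!)%N%:R * \prod_j pi j ord0 ^+ c j ord0
  else 0.

(* As 'cV[nat]_r is countable, measurability of the fibres is measurability
   for the discrete sigma-algebra. *)
Definition has_multinomial_law d (T : measurableType d) (P : probability T R)
    (y : T -> 'cV[nat]_r) (n : nat) (pi : 'cV[R]_r) : Prop :=
  forall c : 'cV[nat]_r,
    measurable (y @^-1` [set c]) /\
    P (y @^-1` [set c]) = (multinomial_pmf n pi c)%:E.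

End Multinomial.

Section Model.
Variables (R : realType) (r k : nat).
Implicit Types (X : 'M[R]_(r, k)) (pi : 'cV[R]_r) (th : 'cV[R]_k)
  (c : 'cV[nat]_r).

Definition ones : 'cV[R]_r := const_mx 1.
Definition log m (v : 'cV[R]_m) : 'cV[R]_m := map_mx (@ln R) v.
Definition exp m (v : 'cV[R]_m) : 'cV[R]_m := map_mx (@expR R) v.
Definition inner m (u v : 'cV[R]_m) : R := (u^T *m v) 0 0.

Definition design_matrix X : Prop :=
  [/\ forall i j, X i j = 0 \/ X i j = 1,
      \rank X = k,
      ~ (exists th : 'cV[R]_k, X *m th = ones) &
      forall i, exists j, X i j = 1].

Definition simplex : set 'cV[R]_r :=
  [set pi : 'cV[R]_r | (forall j, 0 < pi j 0) /\ inner ones pi = 1].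

Definition multiplicative_model X : set 'cV[R]_r :=
  [set pi : 'cV[R]_r | simplex pi /\ exists th, log pi = X *m th].

(* log (1' exp (X th)) *)
Definition log_total X th : R := ln (inner ones (exp (X *m th))).

Definition loglinear_model X : set 'cV[R]_r :=
  [set pi : 'cV[R]_r | simplex pi /\
            exists th, log pi = X *m th - log_total X th *: ones].

Definition is_mle (M : set 'cV[R]_r) (n : nat) c pi : Prop :=
  M pi /\
  forall rho, M rho -> multinomial_pmf n rho c <= multinomial_pmf n pi c.

Definition counts c : 'cV[R]_r := map_mx (fun m : nat => m%:R) c.
Definition proportions (n : nat) c : 'cV[R]_r := n%:R^-1 *: counts c.

Definition lagrangian X (p : 'cV[R]_r) (a : R) th : R :=
  inner p (X *m th) - log_total X th - a * log_total X th.

(* Multiplier at a point pi of the multiplicative model, whose parameter th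
   then satisfies the constraint log_total X th = 0. *)
Definition is_multiplier X (p : 'cV[R]_r) pi (a : R) : Prop :=
  exists th, log pi = X *m th /\
    forall v : 'cV[R]_k, is_derive th v (lagrangian X p a) 0.

(* An estimator is a function of the sample size and of the observed counts;
   its value is unconstrained on samples for which no MLE exists. *)
Definition mle_estimator (M : set 'cV[R]_r)
    (est : nat -> 'cV[nat]_r -> 'cV[R]_r) : Prop :=
  forall n c, (exists pi, is_mle M n c pi) -> is_mle M n c (est n c).

Definition multiplier_estimator X
    (pihat : nat -> 'cV[nat]_r -> 'cV[R]_r)
    (alphahat : nat -> 'cV[nat]_r -> R) : Prop :=
  forall n c, is_mle (multiplicative_model X) n c (pihat n c) ->
    (exists a, is_multiplier X (proportions n c) (pihat n c) a) ->
    is_multiplier X (proportions n c) (pihat n c) (alphahat n c).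

Definition adjustment (a : R) : R := 1 / (1 + a).

Definition Fmx X pi : 'M[R]_k :=
  X^T *m (diag_mx pi^T - pi *m pi^T) *m X.

Definition sigma2_alpha X (n : nat) pi : R :=
  (n%:R * (pi^T *m X *m invmx (Fmx X pi) *m X^T *m pi) 0 0)^-1.

Definition sigma2_gamma X (n : nat) pi (a : R) : R :=
  sigma2_alpha X n pi / adjustment a ^+ 4.

Definition D_stat c (pit pih : 'cV[R]_r) : R :=
  2 * inner (counts c) (log pit - log pih).

Definition L_stat X (n : nat) pi (a : R) : R := a ^+ 2 / sigma2_alpha X n pi.

Definition G_stat X (n : nat) pi (a : R) : R :=
  (adjustment a - 1) ^+ 2 / sigma2_gamma X n pi a.

End Model.

(* Main.v *)
Require Import Defs.
From HB Require Import structures.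
From mathcomp Require Import all_boot all_order all_algebra.
From mathcomp Require Import all_classical all_reals all_analysis.
From mathcomp Require Import measurable_realfun ring lra.

Set Implicit Arguments.
Unset Strict Implicit.
Unset Printing Implicit Defensive.

Import Order.TTheory GRing.Theory Num.Theory.
Import numFieldNormedType.Exports.

Local Open Scope classical_set_scope.
Local Open Scope ring_scope.

(** Let [pi] be the true distribution, [p] the observed proportions, [F] the Fisher
    information [Fmx X pi], [x = X^T *m pi], [b = F^-1 x] and [s2] the inner product
    of [x] and [b]. The proof has a deterministic and a probabilistic half.

    Deterministic half. Parameters are written as offsets [v] from the true one. Both
    estimates maximize the same concave function [loglik p v]: the log-linear one over
    all [v], the multiplicative one over the [v] with [lse (X *m v) = 0]. Concavity
    confines every [v] at least as likely as the truth to a ball of radius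
    proportional to the distance [eps] from [p] to [pi] ([loglik_localization]), so
    near [pi] both maxima exist and Taylor expansions are available. The constraint
    makes the change of total mass vanish to first order; contracting the Lagrange
    equation [X^T p = (1 + a) X^T pihat] with [b] therefore gives [s2 * a = b^T X^T (p - pi)]
    up to order two in [eps]. Completing the square in the quadratic approximation
    of [loglik] shows that the constraint costs [s2 * a ^+ 2 / 2] up to order three.
    Hence, with [z] the root of [n] times [b^T X^T (p - pi)] over the root of [s2], the
    standardized multiplier is [z], the standardized adjustment factor is [- z], and
    the deviance and both Wald statistics are [z ^+ 2], up to errors bounded by
    a multiple of [(1 + tau) ^+ 2] over the root of [n], where [tau] is [n] times
    [eps ^+ 2] ([mle_expansions], [remainders]). As [tau] has mean at most 1, these
    errors tend to 0 in probability ([pr_remainder]).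

    Probabilistic half. The statistic [z] is a sum over the observations of centered
    terms, normalized to variance 1. A multinomial mean is computed by
    conditioning on one observation, so the mean of [f z] is an [n]-fold iterate of a
    one-step average ([multinomial_mean_iter]), which Lindeberg's argument compares with the
    Gaussian smoothing semigroup for spline test functions that squeeze the indicator
    of a half-line ([lindeberg], [clt]). [slutsky] carries the limit over to the
    statistics, and the chi-square law arises as the law of the square of the limit
    of [z]. *)

(** * Gaussian density and Gaussian moments *)

Section GaussianDensity.
Variable R : realType.
Implicit Types (a s t w y z : R).

Lemma normal_pdf_gt0E m s z : 0 < s ->
  normal_pdf m s z = (s * Num.sqrt (pi *+ 2))^-1 * expR (- (z - m) ^+ 2 / (s ^+ 2 *+ 2)).
Proof.
move=> s0; rewrite normal_pdfE ?gt_eqF// /normal_peak /normal_fun.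
by rewrite -mulrnAr sqrtrM ?sqr_ge0// sqrtr_sqr gtr0_norm.
Qed.

(** Quadratic tilting stays in the normal family; integrating it gives the
    exponential moment of [z ^+ 2] with no computation. *)
Lemma normal_pdf_tilt s z : 0 < s ->
  expR ((1 - s ^- 2) / 2 * z ^+ 2) * normal_pdf 0 1 z = s * normal_pdf 0 s z.
Proof.
move=> s0; rewrite !normal_pdf_gt0E//.
have p0 : Num.sqrt (@pi R *+ 2) != 0.
  by rewrite gt_eqF// sqrtr_gt0 pmulrn_lgt0// pi_gt0.
rewrite mulrCA -expRD [RHS]mulrA; congr (_ * expR _).
  by field; rewrite p0 gt_eqF.
by field; rewrite gt_eqF.
Qed.

Lemma normal_pdf_shift a z :
  expR (a * z - a ^+ 2 / 2) * normal_pdf 0 1 z = normal_pdf a 1 z.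
Proof.
rewrite !normal_pdf_gt0E// mulrCA -expRD.
by congr (_ * expR _); field.
Qed.

(** Completing the square in [y] isolates a factor free of [y], so that
    integrating [y] out yields the density of a sum of independent normals. *)
Lemma normal_pdf_conv s t w y : 0 < s ->
  normal_pdf (t * y) s w * normal_pdf 0 1 y =
  normal_pdf 0 (Num.sqrt (s ^+ 2 + t ^+ 2)) w *
  normal_pdf (t * w / (s ^+ 2 + t ^+ 2)) (s / Num.sqrt (s ^+ 2 + t ^+ 2)) y.
Proof.
move=> s0.
have q0 : 0 < s ^+ 2 + t ^+ 2 by rewrite ltr_wpDr ?sqr_ge0// exprn_gt0.
set q := Num.sqrt _.
have qp : 0 < q by rewrite sqrtr_gt0.
have qE : q ^+ 2 = s ^+ 2 + t ^+ 2 by rewrite sqr_sqrtr// ltW.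
rewrite !normal_pdf_gt0E ?divr_gt0// mulrACA [RHS]mulrACA -!expRD.
congr (_ * expR _).
  have p0 : Num.sqrt (@pi R *+ 2) != 0.
    by rewrite gt_eqF// sqrtr_gt0 pmulrn_lgt0// pi_gt0.
  by field; rewrite p0 !gt_eqF.
rewrite exprMn exprVn qE; field.
by rewrite !gt_eqF.
Qed.

End GaussianDensity.

Section GaussianExpectation.
Variable R : realType.
Local Notation mu := (@lebesgue_measure R).
Local Notation phi := (normal_pdf (0 : R) 1).
Implicit Types f g : R -> R.

(** Means under the standard normal law are written as Lebesgue integrals against
    its density, the form in which substitution and Tonelli apply. *)
Definition gauss_integrable f := mu.-integrable setT (fun z => (f z * phi z)%:E).
Definition gauss_mean f : R := \int[mu]_z (f z * phi z).

Let mphi : measurable_fun setT phi. Proof. exact: measurable_normal_pdf. Qed.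
Let phi0 z : 0 <= phi z. Proof. exact: normal_pdf_ge0. Qed.

Lemma gauss_integrable_le f g : measurable_fun setT f -> (forall z, `|f z| <= g z) ->
  gauss_integrable g -> gauss_integrable f.
Proof.
move=> mf fg; apply: le_integrable => //.
  by apply/measurable_EFinP; exact: measurable_funM.
move=> z _ /=; rewrite lee_fin !normrM ler_wpM2r//.
by rewrite (le_trans (fg z))// ler_norm.
Qed.

Lemma gauss_integrable_cst c : gauss_integrable (fun=> c).
Proof.
rewrite /gauss_integrable; under eq_fun do rewrite EFinM.
by apply: integrableZl => //; exact: integrable_normal_pdf.
Qed.

Lemma gauss_integrable_bounded f M : measurable_fun setT f -> (forall z, `|f z| <= M) ->
  gauss_integrable f.
Proof. by move=> mf fM; exact: (gauss_integrable_le mf fM (gauss_integrable_cst M)). Qed.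

Lemma gauss_mean_cst c : gauss_mean (fun=> c) = c.
Proof.
rewrite /gauss_mean RintegralZl//=; last exact: integrable_normal_pdf.
by rewrite /Rintegral integral_normal_pdf mulr1.
Qed.

Lemma gauss_integrableD f g : gauss_integrable f -> gauss_integrable g ->
  gauss_integrable (fun z => f z + g z).
Proof.
move=> fi gi; rewrite /gauss_integrable; under eq_fun do rewrite mulrDl EFinD.
exact: integrableD.
Qed.

Lemma gauss_integrableZ c f : gauss_integrable f -> gauss_integrable (fun z => c * f z).
Proof.
move=> fi; rewrite /gauss_integrable; under eq_fun do rewrite -mulrA EFinM.
exact: integrableZl.
Qed.

Lemma gauss_meanD f g : gauss_integrable f -> gauss_integrable g ->
  gauss_mean (fun z => f z + g z) = gauss_mean f + gauss_mean g.
Proof. by move=> fi gi; rewrite -RintegralD//; apply: eq_Rintegral => z _; rewrite mulrDl. Qed.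

Lemma gauss_meanZ c f : gauss_integrable f -> gauss_mean (fun z => c * f z) = c * gauss_mean f.
Proof. by move=> fi; rewrite -RintegralZl//; apply: eq_Rintegral => z _; rewrite mulrA. Qed.

Lemma gauss_mean_le f g : gauss_integrable f -> gauss_integrable g -> (forall z, f z <=
  g z) -> gauss_mean f <= gauss_mean g.
Proof. by move=> fi gi fg; apply: le_Rintegral => // z _; rewrite ler_wpM2r. Qed.

Lemma gauss_mean_norm f g : gauss_integrable f -> gauss_integrable g -> (forall z, `|f z| <=
  g z) -> `|gauss_mean f| <= gauss_mean g.
Proof.
move=> fi gi fg; apply: (le_trans (le_normr_Rintegral _ fi)) => //.
apply: le_Rintegral => //; first exact: integrable_norm.
by move=> z _; rewrite normrM (ger0_norm (phi0 z)) ler_wpM2r.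
Qed.

Lemma EFin_gE f : gauss_integrable f -> (gauss_mean f)%:E = (\int[mu]_z (f z * phi z)%:E)%E.
Proof. by move=> fi; rewrite /gauss_mean /Rintegral fineK//; exact: integrable_fin_num. Qed.

Lemma gauss_integrable_tilt s : 0 < s ->
  gauss_integrable (fun z => expR ((1 - s ^- 2) / 2 * z ^+ 2)).
Proof.
move=> s0; rewrite /gauss_integrable; under eq_fun do rewrite normal_pdf_tilt// EFinM.
by apply: integrableZl => //; exact: integrable_normal_pdf.
Qed.

Lemma gauss_mean_tilt s : 0 < s -> gauss_mean (fun z => expR ((1 - s ^- 2) / 2 * z ^+ 2)) = s.
Proof.
move=> s0; rewrite /gauss_mean; under eq_Rintegral do rewrite normal_pdf_tilt//.
rewrite RintegralZl//; last exact: integrable_normal_pdf.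
by rewrite /Rintegral integral_normal_pdf mulr1.
Qed.

Lemma gauss_integrable_shift a : gauss_integrable (fun z => expR (a * z - a ^+ 2 / 2)).
Proof.
rewrite /gauss_integrable; under eq_fun do rewrite normal_pdf_shift.
exact: integrable_normal_pdf.
Qed.

Lemma gauss_mean_shift a : gauss_mean (fun z => expR (a * z - a ^+ 2 / 2)) = 1.
Proof.
rewrite /gauss_mean; under eq_Rintegral do rewrite normal_pdf_shift//.
by rewrite /Rintegral integral_normal_pdf.
Qed.

Let expR_quad (u : R) : 0 <= u -> u ^+ 2 / 2 <= expR u.
Proof.
move=> u0; apply: le_trans (expR_ge1Dxn 1 u0).
by rewrite -[2`!]/2%N lerDr.
Qed.

(** Polynomial growth is absorbed by [expR (z ^+ 2 / 4)], which still leaves a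
    normal density, of variance two. *)
Lemma gauss_integrable_pow4 : gauss_integrable (fun z => 1 + z ^+ 4).
Proof.
have s0 : 0 < Num.sqrt 2 :> R by rewrite sqrtr_gt0.
apply: (@gauss_integrable_le _ (fun z => 1 + 32 * expR ((1 - Num.sqrt 2 ^- 2) / 2 * z ^+ 2))).
- by apply: measurable_funD => //; exact: measurable_funX.
- move=> z; rewrite ger0_norm ?addr_ge0// ?exprn_even_ge0// lerD2l.
  rewrite sqr_sqrtr//; have -> : (1 - 2^-1) / 2 * z ^+ 2 = z ^+ 2 / 4 :> R by field.
  have := @expR_quad (z ^+ 2 / 4); rewrite divr_ge0 ?sqr_ge0// => /(_ isT).
  by move: (expR _) => e; rewrite exprMn -exprM; lra.
- by apply: gauss_integrableD; [exact: gauss_integrable_cst | apply: gauss_integrableZ;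
  exact: gauss_integrable_tilt].
Qed.

Lemma gauss_integrable_id : gauss_integrable id.
Proof.
apply: (gauss_integrable_le _ _ gauss_integrable_pow4) => // z.
have -> : z ^+ 4 = `|z| ^+ 4 by rewrite -normrX ger0_norm// exprn_even_ge0.
have := sqr_ge0 (`|z| ^+ 2 - 2^-1); have := sqr_ge0 (`|z| - 2^-1).
by move: `|z| => u; nra.
Qed.

Lemma gauss_integrable_sqr : gauss_integrable (fun z => z ^+ 2).
Proof.
apply: (gauss_integrable_le _ _ gauss_integrable_pow4) => [|z]; first exact: measurable_funX.
rewrite ger0_norm ?sqr_ge0// (exprM z 2 2).
by have := sqr_ge0 (z ^+ 2 - 2^-1); move: (z ^+ 2) => u; nra.
Qed.

Lemma gauss_integrable_cube : gauss_integrable (fun z => `|z| ^+ 3).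
Proof.
apply: (gauss_integrable_le _ _ gauss_integrable_pow4) => [|z].
  by apply: measurable_funX; exact: normr_measurable.
rewrite ger0_norm ?exprn_ge0//.
have -> : z ^+ 4 = `|z| ^+ 4 by rewrite -normrX ger0_norm// exprn_even_ge0.
have [u1|/ltW u1] := leP `|z| 1.
  by rewrite (@le_trans _ _ 1) ?exprn_ile1// lerDl exprn_ge0.
by rewrite ler_wpDl// [_ ^+ 4]exprSr ler_peMr// exprn_ge0.
Qed.

(** Integrating [1 + u <= expR u] with [u = a * z - a ^+ 2 / 2] bounds [a] times
    the mean by [a ^+ 2 / 2]; taking [a] equal to the mean forces it to vanish. *)
Lemma gauss_mean_id : gauss_mean id = 0.
Proof.
have H a : a * gauss_mean id - a ^+ 2 / 2 <= 0.
  have i1 := gauss_integrableD (gauss_integrableZ a gauss_integrable_id)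
    (gauss_integrable_cst (- (a ^+ 2 / 2))).
  have := gauss_mean_le (gauss_integrableD (gauss_integrable_cst 1) i1)
    (gauss_integrable_shift a) (fun z => expR_ge1Dx _).
  rewrite gauss_mean_shift (gauss_meanD (gauss_integrable_cst 1) i1)
    (gauss_meanD (gauss_integrableZ a gauss_integrable_id)) ?gauss_integrable_cst//.
  by rewrite (gauss_meanZ _ gauss_integrable_id) !gauss_mean_cst gerDl.
by have := H (gauss_mean id); move: (gauss_mean id) => m; nra.
Qed.

(** The same tangent inequality with [u = (1 - s ^- 2) / 2 * z ^+ 2] bounds the
    second moment from above for [s] slightly larger than 1 and from below for [s]
    slightly smaller than 1. *)
Lemma gauss_mean_sqr : gauss_mean (fun z => z ^+ 2) = 1.
Proof.
have H s : 0 < s -> (s ^+ 2 - 1) * gauss_mean (fun z => z ^+ 2) <= 2 * s ^+ 2 * (s - 1).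
  move=> s0; have : 1 + (1 - s ^- 2) / 2 * gauss_mean (fun z => z ^+ 2) <= s.
    have i1 := gauss_integrableZ ((1 - s ^- 2) / 2) gauss_integrable_sqr.
    have := gauss_mean_le (gauss_integrableD (gauss_integrable_cst 1) i1)
      (gauss_integrable_tilt s0) (fun z => expR_ge1Dx _).
    by rewrite (gauss_mean_tilt s0) (gauss_meanD (gauss_integrable_cst 1) i1)
      (gauss_meanZ _ gauss_integrable_sqr) gauss_mean_cst.
  move: (gauss_mean _) => v h; have s2 : 0 < 2 * s ^+ 2 by rewrite mulr_gt0// exprn_gt0.
  rewrite -lerBrDl -(ler_pM2l s2) in h; apply: le_trans h.
  by rewrite le_eqVlt; apply/orP; left; apply/eqP; field; rewrite gt_eqF.
move: (gauss_mean _) H => v H.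
have {}H h : -1 < h -> h * ((2 + h) * v - 2 * (1 + h) ^+ 2) <= 0.
  by move=> h1; have := H (1 + h); rewrite -ltrBlDl sub0r h1 => /(_ isT); lra.
apply/eqP; rewrite eq_le; apply/andP; split; apply/ler_addgt0Pr => e e0.
- have := H (e / 2); rewrite pmulr_rle0 ?divr_gt0//.
  by rewrite (lt_trans (ltrN10 _)) ?divr_gt0// => /(_ isT); nra.
- have [e1|e1] := leP 1 e; first by have := H (- (1 / 2)); lra.
  have := H (- (e / 2)); rewrite nmulr_rle0 ?oppr_lt0 ?divr_gt0//.
  have -> : -1 < - (e / 2) by lra.
  by move=> /(_ isT); nra.
Qed.

End GaussianExpectation.

(** * The Gaussian smoothing semigroup *)

Section Smoothing.
Variable R : realType.
Local Notation mu := (@lebesgue_measure R).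
Local Notation phi := (normal_pdf (0 : R) 1).
Implicit Types (f u : R -> R) (s t x h K M : R).

Definition smoothing s f x : R := gauss_mean (fun z => f (x + s * z)).

(** A third-order Taylor bound, uniform in the base point. In this form the
    regularity of [f] survives averaging without differentiation under the
    integral sign. *)
Definition taylor3 K f f1 f2 :=
  forall x h, `|f (x + h) - f x - f1 x * h - f2 x * (h ^+ 2 / 2)| <= K * `|h| ^+ 3.

Let mphi : measurable_fun setT phi. Proof. exact: measurable_normal_pdf. Qed.

Let mshift f x s : measurable_fun setT f -> measurable_fun setT (fun z : R => f (x + s * z)).
Proof.
by move=> mf; apply: measurableT_comp => //; apply: measurable_funD => //;
  exact: measurable_funM.
Qed.

Lemma gauss_integrable_smoothing s f x M : measurable_fun setT f -> (forall y, `|f y| <= M) ->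
  gauss_integrable (fun z => f (x + s * z)).
Proof. by move=> mf fM; apply: (@gauss_integrable_bounded _ _ M) => //; exact: mshift. Qed.

Lemma smoothing0 f : smoothing 0 f = f.
Proof.
apply/funext => x; rewrite /smoothing.
by under eq_fun do rewrite mul0r addr0; rewrite gauss_mean_cst.
Qed.

Lemma smoothing_taylor3 K s f f1 f2 M :
  measurable_fun setT f -> measurable_fun setT f1 -> measurable_fun setT f2 ->
  (forall x, `|f x| <= M) -> (forall x, `|f1 x| <= M) -> (forall x, `|f2 x| <= M) ->
  taylor3 K f f1 f2 -> taylor3 K (smoothing s f) (smoothing s f1) (smoothing s f2).
Proof.
move=> mf mf1 mf2 fM f1M f2M T x h.
have I0 := gauss_integrable_smoothing s (x + h) mf fM.
have I1 := gauss_integrableZ (-1) (gauss_integrable_smoothing s x mf fM).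
have I2 := gauss_integrableZ (- h) (gauss_integrable_smoothing s x mf1 f1M).
have I3 := gauss_integrableZ (- (h ^+ 2 / 2)) (gauss_integrable_smoothing s x mf2 f2M).
have -> : smoothing s f (x + h) - smoothing s f x - smoothing s f1 x * h -
    smoothing s f2 x * (h ^+ 2 / 2) = gauss_mean (fun z => f (x + h + s * z) +
      (-1 * f (x + s * z) + (- h * f1 (x + s * z) + - (h ^+ 2 / 2) * f2 (x + s * z)))).
  rewrite (gauss_meanD I0 (gauss_integrableD I1 (gauss_integrableD I2 I3)))
    (gauss_meanD I1 (gauss_integrableD I2 I3)) (gauss_meanD I2 I3).
  rewrite !gauss_meanZ ?(gauss_integrable_smoothing _ _ mf fM) ?(gauss_integrable_smoothing _ _ mf1 f1M) ?(gauss_integrable_smoothing _ _ mf2 f2M)//.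
  by rewrite /smoothing; ring.
rewrite -(gauss_mean_cst (K * `|h| ^+ 3)); apply: gauss_mean_norm.
- exact: gauss_integrableD I0 (gauss_integrableD I1 (gauss_integrableD I2 I3)).
- exact: gauss_integrable_cst.
- move=> z; apply: le_trans (T (x + s * z) h).
  by rewrite le_eqVlt; apply/orP; left; apply/eqP; congr `|_|; rewrite (addrAC x h); ring.
Qed.

Lemma taylor3_continuous K f f1 f2 : taylor3 K f f1 f2 -> continuous f.
Proof.
move=> T x; apply/cvgrPdist_le => e e0.
pose B := `|f1 x| + `|f2 x| + `|K|.
have B0 : 0 < B + 1 by rewrite ltr_wpDl// !addr_ge0.
near=> y.
have yx : `|y - x| <= Num.min 1 (e / (B + 1)).
  by near: y; apply: cvgr_distC_le => //; rewrite lt_min ltr01 divr_gt0.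
move: yx; rewrite le_min => /andP[y1 ye].
have := T x (y - x); rewrite subrKC; set d := y - x in y1 ye * => Td.
have d0 := normr_ge0 d.
rewrite distrC; apply: (@le_trans _ _ ((B + 1) * `|d|)); last by rewrite mulrC -ler_pdivlMr.
have -> : f y - f x = (f y - f x - f1 x * d - f2 x * (d ^+ 2 / 2)) + f1 x * d +
  f2 x * (d ^+ 2 / 2) by ring.
rewrite (le_trans (ler_normD _ _))// (le_trans (lerD (ler_normD _ _) (lexx _)))//.
rewrite (le_trans (lerD (lerD Td (lexx _)) (lexx _)))// !normrM.
rewrite (ger0_norm (_ : 0 <= 2^-1)) ?invr_ge0// -?expr2.
have d2 : `|d| ^+ 2 <= `|d| by rewrite expr2 ler_piMr.
have d3 : `|d| ^+ 3 <= `|d| by rewrite exprS ler_piMr// exprn_ile1.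
have k1 : K * `|d| ^+ 3 <= `|K| * `|d|.
  by rewrite (le_trans (ler_wpM2r _ (ler_norm K))) ?exprn_ge0// ler_wpM2l.
have k2 : `|f2 x| * (`|d| ^+ 2 / 2) <= `|f2 x| * `|d|.
  by rewrite ler_wpM2l//; lra.
rewrite /B; lra.
Unshelve. all: by end_near.
Qed.

(** Symmetric first and second differences with step 1 isolate the coefficients. *)
Lemma taylor3_bounded K f f1 f2 M : taylor3 K f f1 f2 -> (forall x, `|f x| <= M) ->
  (forall x, `|f1 x| <= M + K) /\ (forall x, `|f2 x| <= 4 * M + 2 * K).
Proof.
move=> T fM.
have H x : [/\ `|f1 x| <= M + K & `|f2 x| <= 4 * M + 2 * K].
  have := T x 1; have := T x (-1); have := fM x; have := fM (x + 1); have := fM (x - 1).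
  rewrite normrN normr1 expr1n mulr1 sqrrN expr1n mulr1 mulrN1.
  by rewrite !ler_norml => /andP[? ?] /andP[? ?] /andP[? ?] /andP[? ?] /andP[? ?]; split; lra.
by split=> x; case: (H x).
Qed.

Let subst_affine f a s : continuous f -> (forall x, 0 <= f x) -> 0 < s ->
  (\int[mu]_w (f w * normal_pdf a s w)%:E = \int[mu]_z (f (a + s * z) * phi z)%:E)%E.
Proof.
move=> cf f0 s0; pose F z : R := a + s * z.
have dF z : derivable F z 1 by [].
have F'E : F^`()%classic = cst s.
  by apply/funext => z;
    rewrite derive1E deriveD// derive_cst deriveZ ?derive_id ?add0r/= /GRing.scale/= ?mulr1.
rewrite (@increasing_ge0_integration_by_substitutionT _ F).
- apply: eq_integral => z _; congr (_%:E); rewrite F'E /= !fctE -mulrA; congr (_ * _).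
  rewrite !normal_pdf_gt0E// /F.
  have p0 : Num.sqrt (@pi R *+ 2) != 0 by rewrite gt_eqF// sqrtr_gt0 pmulrn_lgt0// pi_gt0.
  rewrite mulrAC; congr (_ * expR _); first by field; rewrite p0 gt_eqF.
  by field; rewrite gt_eqF.
- by move=> x y xy; rewrite ltrD2l ltr_pM2l.
- by rewrite F'E => ?; exact: cvg_cst.
- by rewrite F'E; exact: is_cvg_cst.
- by rewrite F'E; exact: is_cvg_cst.
- exact: dF.
- by apply: (cvg_comp _ (fun z => a + z)); [exact: gt0_cvgMrNy cvg_id|exact: cvg_addrl_Ny].
- by apply: (cvg_comp _ (fun z => a + z)); [exact: gt0_cvgMry cvg_id|exact: cvg_addrl].
- by move=> x; apply: cvgM; [exact: cf|exact: continuous_normal_pdf (lt0r_neq0 s0) x].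
- by move=> x; rewrite mulr_ge0// normal_pdf_ge0.
Qed.

Lemma smoothing_norm s f M x : measurable_fun setT f -> (forall y, `|f y| <= M) ->
  `|smoothing s f x| <= M.
Proof.
move=> mf fM; rewrite -(gauss_mean_cst M); apply: gauss_mean_norm => //.
  exact: gauss_integrable_smoothing fM.
exact: gauss_integrable_cst.
Qed.

Lemma measurable_smoothing s f : measurable_fun setT f -> (forall y, 0 <= f y) ->
  measurable_fun setT (smoothing s f).
Proof.
move=> mf f0; apply: measurableT_comp => //.
pose F (p : R * R) := (f (p.1 + s * p.2) * phi p.2)%:E.
have mF : measurable_fun setT F.
  apply/measurable_EFinP/measurable_funM; last exact: measurableT_comp.
  by apply: measurableT_comp => //; apply: measurable_funD => //; exact: measurable_funM.
have F0 p : (0 <= F p)%E by rewrite lee_fin mulr_ge0// normal_pdf_ge0.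
exact: (@measurable_fun_fubini_tonelli_F _ _ _ _ R mu F mF F0).
Qed.

(** Semigroup property: after Tonelli, [normal_pdf_conv] integrates out the first
    Gaussian increment. *)
Lemma smoothing_comp s t f x M : 0 <= s -> 0 <= t -> continuous f ->
  (forall y, 0 <= f y <= M) ->
  smoothing t (smoothing s f) x = smoothing (Num.sqrt (s ^+ 2 + t ^+ 2)) f x.
Proof.
rewrite le_eqVlt => /predU1P[<-|s0] t0 cf fM.
  by rewrite smoothing0 expr0n add0r sqrtr_sqr ger0_norm.
have nfM y : `|f y| <= M by case/andP: (fM y) => f0 f1; rewrite ger0_norm.
have f0 y : 0 <= f y by case/andP: (fM y).
have mf : measurable_fun setT f by exact: continuous_measurable_fun.
pose q := Num.sqrt (s ^+ 2 + t ^+ 2).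
have q0 : 0 < q by rewrite sqrtr_gt0 ltr_wpDr ?sqr_ge0// exprn_gt0.
pose g y := f (x + y).
have cg : continuous g.
  by move=> y; apply: continuous_comp; [exact: cvgD (cvg_cst _) cvg_id|exact: cf].
have mg : measurable_fun setT g by exact: continuous_measurable_fun.
have g0 y : 0 <= g y by exact: f0.
have gi a c : gauss_integrable (fun z => g (a + c * z)).
  by apply: (@gauss_integrable_bounded _ _ M) => [|z]; [exact: mshift|exact: nfM].
have msf := measurable_smoothing s mf f0.
have gsi : gauss_integrable (fun y => smoothing s f (x + t * y)).
  apply: (gauss_integrable_smoothing _ _ msf) => y; exact: smoothing_norm nfM.
apply: EFin_inj; rewrite !EFin_gE//; last exact: gauss_integrable_smoothing nfM.
pose H y w := (g w * (normal_pdf (t * y) s w * phi y))%:E.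
transitivity (\int[mu]_y \int[mu]_w H y w)%E.
  apply: eq_integral => y _; rewrite EFinM EFin_gE; last exact: gauss_integrable_smoothing nfM.
  under [in LHS]eq_integral do rewrite -addrA -/(g _).
  rewrite -subst_affine// -ge0_integralZr//.
  - by apply: eq_integral => w _; rewrite /H -EFinM mulrA.
  - apply/measurable_EFinP; apply: measurable_funM => //; exact: measurable_normal_pdf.
  - by move=> w _; rewrite lee_fin mulr_ge0 ?normal_pdf_ge0.
  - by rewrite lee_fin normal_pdf_ge0.
transitivity (\int[mu]_w \int[mu]_y H y w)%E.
  apply: (@fubini_tonelli _ _ _ _ R mu mu (fun p => H p.1 p.2)); last first.
    by move=> p; rewrite lee_fin !mulr_ge0// normal_pdf_ge0.
  apply/measurable_EFinP/measurable_funM; first exact: measurableT_comp.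
  apply: measurable_funM; last exact: measurableT_comp.
  rewrite (_ : (fun _ => _) = fun p : R * R => normal_pdf 0 s (p.2 - t * p.1)); last first.
    by apply/funext => p; rewrite !normal_pdf_gt0E// subr0.
  apply: measurableT_comp; first exact: measurable_normal_pdf.
  by apply: measurable_funB => //; exact: measurable_funM.
transitivity (\int[mu]_w (g w * normal_pdf 0 q w)%:E)%E; last first.
  by rewrite subst_affine//; apply: eq_integral => z _; rewrite add0r.
apply: eq_integral => w _; rewrite /H.
transitivity (\int[mu]_y ((g w * normal_pdf 0 q w)%:E * (normal_pdf (t * w / (s ^+ 2 +
  t ^+ 2)) (s / q) y)%:E))%E.
  by apply: eq_integral => y _; rewrite -EFinM /H normal_pdf_conv// mulrA.
rewrite ge0_integralZl//.
- by rewrite integral_normal_pdf mule1.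
- by apply/measurable_EFinP; exact: measurable_normal_pdf.
- by move=> y _; rewrite lee_fin normal_pdf_ge0.
- by rewrite lee_fin mulr_ge0// normal_pdf_ge0.
Qed.


End Smoothing.

(** * Replacement of one observation by a Gaussian increment *)

Section Lindeberg.
Variables (R : realType) (r : nat) (p zeta : 'I_r -> R).
Hypothesis p0 : forall i, 0 <= p i.
Hypothesis p1 : \sum_i p i = 1.
Hypothesis zeta_mean : \sum_i p i * zeta i = 0.
Hypothesis zeta_var : \sum_i p i * zeta i ^+ 2 = 1.
Implicit Types (f u : R -> R) (h K x : R).

(** Averages [f] over one more observation, worth [zeta i] with probability
    [p i], at scale [h]. *)
Definition step h f x := \sum_i p i * f (x + h * zeta i).

Definition third_moments : R := gauss_mean (fun z => `|z| ^+ 3) + \sum_i p i * `|zeta i| ^+ 3.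

Let step_taylor K u u1 u2 h x : taylor3 K u u1 u2 -> 0 <= h ->
  `|step h u x - (u x + u2 x * (h ^+ 2 / 2))| <= K * h ^+ 3 * \sum_i p i * `|zeta i| ^+ 3.
Proof.
move=> T h0.
have -> : step h u x - (u x + u2 x * (h ^+ 2 / 2)) = \sum_i p i *
    (u (x + h * zeta i) - u x - u1 x * (h * zeta i) - u2 x * ((h * zeta i) ^+ 2 / 2)).
  transitivity (step h u x - ((\sum_i p i) * u x + (\sum_i p i * zeta i) * (u1 x * h) +
      (\sum_i p i * zeta i ^+ 2) * (u2 x * (h ^+ 2 / 2)))).
    by rewrite p1 zeta_mean zeta_var; ring.
  rewrite /step !mulr_suml -!big_split/= -sumrB; apply: eq_bigr => i _; ring.
rewrite mulr_sumr (le_trans (ler_norm_sum _ _ _))//; apply: ler_sum => i _.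
rewrite normrM (ger0_norm (p0 i)) [leRHS]mulrCA ler_wpM2l// (le_trans (T _ _))//.
by rewrite normrM (ger0_norm h0) exprMn mulrA.
Qed.

Let smoothing_step K u u1 u2 h x M : measurable_fun setT u -> (forall y, `|u y| <= M) ->
  taylor3 K u u1 u2 -> 0 <= h ->
  `|smoothing h u x - (u x + u2 x * (h ^+ 2 / 2))| <=
    K * h ^+ 3 * gauss_mean (fun z => `|z| ^+ 3).
Proof.
move=> mu uM T h0.
have I0 := gauss_integrable_smoothing h x mu uM.
have I1 := gauss_integrable_cst (- u x).
have I2 := gauss_integrableZ (- (u1 x * h)) (gauss_integrable_id R).
have I3 := gauss_integrableZ (- (u2 x * (h ^+ 2 / 2))) (gauss_integrable_sqr R).
have -> : smoothing h u x - (u x + u2 x * (h ^+ 2 / 2)) = gauss_mean (fun z => u (x + h * z) +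
    (- u x + (- (u1 x * h) * z + - (u2 x * (h ^+ 2 / 2)) * z ^+ 2))).
  rewrite (gauss_meanD I0 (gauss_integrableD I1 (gauss_integrableD I2 I3)))
    (gauss_meanD I1 (gauss_integrableD I2 I3)) (gauss_meanD I2 I3).
  rewrite (gauss_meanZ _ (gauss_integrable_id R))
    (gauss_meanZ _ (gauss_integrable_sqr R)) gauss_mean_cst gauss_mean_id gauss_mean_sqr /smoothing; ring.
rewrite -(gauss_meanZ _ (gauss_integrable_cube R)); apply: gauss_mean_norm.
- exact: gauss_integrableD I0 (gauss_integrableD I1 (gauss_integrableD I2 I3)).
- exact: gauss_integrableZ (gauss_integrable_cube R).
- move=> z /=; have := T x (h * z);
  rewrite normrM (ger0_norm h0) [(h * _) ^+ 3]exprMn (mulrA K).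
  by apply: le_trans; rewrite le_eqVlt; apply/orP; left; apply/eqP; congr `|_|; ring.
Qed.

Lemma step_norm h f e : (forall x, `|f x| <= e) -> forall x, `|step h f x| <= e.
Proof.
move=> fe x; rewrite (le_trans (ler_norm_sum _ _ _))//.
rewrite -[leRHS]mul1r -p1 mulr_suml; apply: ler_sum => i _.
by rewrite normrM ger0_norm// ler_wpM2l.
Qed.

(** Lindeberg's argument: one observation and one Gaussian increment agree in their
    first two moments, so exchanging them costs a third-order term. Averaging is
    a contraction and Gaussian smoothing preserves the Taylor bound, so the
    [n] exchanges add up with the same constant. *)
Lemma lindeberg K f f1 f2 h n : continuous f -> (forall x, 0 <= f x <= 1) ->
  measurable_fun setT f1 -> measurable_fun setT f2 -> taylor3 K f f1 f2 -> 0 <= h ->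
  forall x, `|iter n (step h) f x - smoothing (Num.sqrt n%:R * h) f x|
    <= n%:R * (K * h ^+ 3 * third_moments).
Proof.
move=> cf f01 mf1 mf2 T h0.
have mf : measurable_fun setT f by exact: continuous_measurable_fun.
have fM x : `|f x| <= 1 by case/andP: (f01 x) => f0 f1x; rewrite ger0_norm.
have [f1M f2M] := taylor3_bounded T fM.
pose B := Num.max 1 (Num.max (1 + K) (4 * 1 + 2 * K)).
have fB x : `|f x| <= B by rewrite le_max fM.
have f1B x : `|f1 x| <= B by rewrite !le_max f1M !orbT.
have f2B x : `|f2 x| <= B by rewrite !le_max f2M !orbT.
elim: n => [x|n IH x]; first by rewrite sqrtr0 mul0r smoothing0 subrr normr0 mul0r.
set u := smoothing (Num.sqrt n%:R * h) f in IH.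
have -> : smoothing (Num.sqrt n.+1%:R * h) f x = smoothing h u x.
  rewrite (smoothing_comp _ _ _ cf f01)//; last by rewrite mulr_ge0// sqrtr_ge0.
  congr (smoothing _ f x); rewrite exprMn sqr_sqrtr// -{2}(mul1r (h ^+ 2)) -mulrDl natr1.
  by rewrite sqrtrM// sqrtr_sqr ger0_norm.
have Tu : taylor3 K u (smoothing (Num.sqrt n%:R * h) f1) (smoothing (Num.sqrt n%:R * h) f2).
  exact: (smoothing_taylor3 _ mf mf1 mf2 fB f1B f2B T).
have mu : measurable_fun setT u by apply: measurable_smoothing => // y; case/andP: (f01 y).
have uM y : `|u y| <= 1 by exact: smoothing_norm fM.
have := smoothing_step x mu uM Tu h0; have := step_taylor x Tu h0.
set c := u x + _ => H1 H2.
have -> : iter n.+1 (step h) f x - smoothing h u x =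
    step h (fun y => iter n (step h) f y - u y) x +
    ((step h u x - c) - (smoothing h u x - c)).
  rewrite iterS [step h (iter _ _ _)]/step [step h (fun _ => _)]/step.
  under [in RHS]eq_bigr do rewrite mulrBr.
  by rewrite sumrB [step h u x]/step; ring.
rewrite (le_trans (ler_normD _ _))// -natr1 mulrDl mul1r lerD//.
  exact: step_norm.
by rewrite (le_trans (ler_normB _ _))// /third_moments mulrDr addrC lerD.
Qed.

End Lindeberg.

Section SplineStep.
Variable R : realType.
Implicit Types (x h c d : R).

Definition cube_pos x := Num.max x 0 ^+ 3.

Lemma cube_pos_taylor3 :
  taylor3 1 cube_pos (fun x => 3 * Num.max x 0 ^+ 2) (fun x => 6 * Num.max x 0).
Proof.
move=> x h; rewrite /cube_pos mul1r.
have cubeM (a b : R) : a <= b -> a ^+ 3 <= b ^+ 3.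
  move=> ab; rewrite -subr_ge0 subrXX !big_ord_recl big_ord0 /bump/=.
  rewrite !subn0 !subn1/= expr0 !expr1 mul1r mulr1 addr0 mulr_ge0 ?subr_ge0//.
  by have := sqr_ge0 (a + b / 2); have := sqr_ge0 b; nra.
have [x0|/ltW x0] := leP x 0; have [xh|/ltW xh] := leP (x + h) 0.
- by rewrite !expr0n/= !mulr0 !mul0r !subr0 normr0 exprn_ge0.
- have h0 : 0 <= h by lra.
  rewrite !expr0n/= !mulr0 !mul0r !subr0 !ger0_norm ?exprn_ge0//.
  by apply: cubeM; lra.
- have h0 : h <= 0 by lra.
  have := cubeM _ _ xh; have := cubeM (h) (x + h) ltac:(lra).
  have := cubeM _ _ h0; rewrite expr0n/= (ler0_norm h0) ler_norml.
  by move=> H1 H2 H3; apply/andP; split; lra.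
- by rewrite -normrX le_eqVlt; apply/orP; left; apply/eqP; congr `|_|; field.
Qed.

(** A twice continuously differentiable descent from 1 to 0 on the interval from 0
    to 3: one minus the integral of the quadratic B-spline with knots 0, 1, 2, 3. *)
Definition spline_step x := 1 -
  (cube_pos x - 3 * cube_pos (x - 1) + 3 * cube_pos (x - 2) - cube_pos (x - 3)) / 6.

Lemma spline_step_bounds x : 0 <= spline_step x <= 1.
Proof.
rewrite /spline_step /cube_pos.
have [x0|x0] := leP x 0; have [x1|x1] := leP (x - 1) 0;
have [x2|x2] := leP (x - 2) 0; have [x3|x3] := leP (x - 3) 0; rewrite ?expr0n/=; try lra.
- have x1' : x <= 1 by lra.
  by have := exprn_ge0 3 (ltW x0); have := @exprn_ile1 _ 3 x (ltW x0) x1'; lra.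
- have y0 := ltW x1; have y1 : x - 1 <= 1 by lra.
  have : 0 <= (1 - (x - 1)) ^+ 2 * (1 + 2 * (x - 1)) by rewrite mulr_ge0 ?sqr_ge0//; lra.
  have : 0 <= (x - 1) ^+ 2 * (1 - (x - 1)) by rewrite mulr_ge0 ?sqr_ge0//; lra.
  by have := sqr_ge0 (x - 1); lra.
- have w0 : 0 <= 3 - x by lra.
  have w1 : 3 - x <= 1 by lra.
  by have := exprn_ge0 3 w0; have := @exprn_ile1 _ 3 _ w0 w1; lra.
Qed.

Lemma spline_step_le0 x : x <= 0 -> spline_step x = 1.
Proof.
move=> x0; rewrite /spline_step /cube_pos !max_r ?expr0n/=; lra.
Qed.

Lemma spline_step_ge3 x : 3 <= x -> spline_step x = 0.
Proof.
move=> x0; rewrite /spline_step /cube_pos !max_l; lra.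
Qed.

Lemma taylor3_affine K f f1 f2 c d : 0 < d -> taylor3 K f f1 f2 ->
  taylor3 (K * d ^+ 3) (fun x : R => f (d * (x - c))) (fun x => d * f1 (d * (x - c)))
    (fun x => d ^+ 2 * f2 (d * (x - c))).
Proof.
move=> d0 T x h /=; have := T (d * (x - c)) (d * h).
rewrite normrM (gtr0_norm d0) [(d * `|h|) ^+ 3]exprMn (mulrA K); apply: le_trans.
rewrite -mulrDr (addrAC x) le_eqVlt; apply/orP; left; apply/eqP; congr `|_|; ring.
Qed.

Lemma taylor3_lin K L f f1 f2 g g1 g2 a b : taylor3 K f f1 f2 -> taylor3 L g g1 g2 ->
  taylor3 (`|a| * K + `|b| * L) (fun x : R => a * f x + b * g x)
    (fun x => a * f1 x + b * g1 x) (fun x => a * f2 x + b * g2 x).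
Proof.
move=> Tf Tg x h.
have := ler_wpM2l (normr_ge0 a) (Tf x h); have := ler_wpM2l (normr_ge0 b) (Tg x h).
rewrite -!normrM => H1 H2.
have -> : (`|a| * K + `|b| * L) * `|h| ^+ 3 = `|a| * (K * `|h| ^+ 3) + `|b| * (L * `|h| ^+ 3).
  by ring.
apply: le_trans (lerD H2 H1); apply: le_trans (ler_normD _ _) => /=.
rewrite le_eqVlt; apply/orP; left; apply/eqP; congr `|_|; ring.
Qed.

Lemma spline_step_taylor3 c d : 0 < d -> exists K f1 f2,
  [/\ measurable_fun setT f1, measurable_fun setT f2 &
   taylor3 K (fun x => spline_step (d * (x - c))) f1 f2].
Proof.
move=> d0.
have mpos a : measurable_fun setT (fun x : R => Num.max (1 * (d * (x - c) - a)) 0).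
  apply: measurable_maxr => //; apply: measurable_funM => //.
  by apply: measurable_funB => //; apply: measurable_funM => //; exact: measurable_funB.
have Tc : taylor3 0 (fun=> 1 : R) (fun=> 0) (fun=> 0).
  by move=> x h; rewrite subrr !mul0r !subr0 normr0.
have T a := taylor3_affine c d0 (taylor3_affine a ltr01 cube_pos_taylor3).
have := taylor3_lin 1 1 Tc (taylor3_lin 1 1 (taylor3_lin (- 6^-1) (1 / 2) (T 0) (T 1))
  (taylor3_lin (- (1 / 2)) (6^-1) (T 2) (T 3))).
set f1 := (X in taylor3 _ _ X _); set f2 := (X in taylor3 _ _ _ X).
set K := (X in taylor3 X _ _ _) => H; exists K, f1, f2; split; last first.
- by move=> x h; apply: le_trans (H x h); rewrite /spline_step le_eqVlt; apply/orP; left;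
    apply/eqP; congr `|_|; rewrite !mul1r !subr0; field.
- rewrite /f2; repeat first [exact: mpos | apply: measurable_funD => // | apply: measurable_funM => // | apply: measurable_funX => // ].
- rewrite /f1; repeat first [exact: mpos | apply: measurable_funD => // | apply: measurable_funM => // | apply: measurable_funX => // ].
Qed.

End SplineStep.

(** * Multinomial expectations *)

Section MultinomialExpectation.
Variables (R : realType) (r : nat) (pi : 'cV[R]_r).
Local Notation counts_t := 'cV[nat]_r.
Implicit Types (c : counts_t) (f g : counts_t -> R) (i j : 'I_r).

Definition add_obs i c : counts_t := \col_j (c j ord0 + (j == i))%N.
Definition sample_size c := (\sum_j c j ord0)%N.

(** Mean of [g] under the counts of [n] independent draws, by conditioning on
    one draw; this recursion replaces all sums over count vectors. *)
Fixpoint multinomial_mean n g : R :=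
  if n is n'.+1 then \sum_i pi i 0 * multinomial_mean n' (fun c => g (add_obs i c)) else g (\col_j 0%N).

Lemma sample_size_add i c : sample_size (add_obs i c) = (sample_size c).+1.
Proof.
rewrite /sample_size; under eq_bigr do rewrite mxE.
rewrite big_split/= [X in (_ + X)%N](_ : _ = 1%N) ?addn1//.
by rewrite (bigD1 i)//= eqxx big1 ?addn0// => j /negPf ->.
Qed.

Lemma multinomial_mean_ext n f g : (forall c, sample_size c = n -> f c = g c) ->
  multinomial_mean n f = multinomial_mean n g.
Proof.
elim: n f g => [|n IH] f g fg /=.
  by apply: fg; rewrite /sample_size big1// => j _; rewrite mxE.
apply: eq_bigr => i _; congr (_ * _); apply: IH => c cn.
by apply: fg; rewrite sample_size_add cn.
Qed.

Lemma multinomial_meanD n f g : multinomial_mean n (fun c => f c + g c) =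
  multinomial_mean n f + multinomial_mean n g.
Proof.
elim: n f g => [//|n IH] f g /=.
by rewrite -big_split/=; apply: eq_bigr => i _; rewrite IH mulrDr.
Qed.

Lemma multinomial_meanZ n a g : multinomial_mean n (fun c => a * g c) =
  a * multinomial_mean n g.
Proof.
elim: n g => [//|n IH] g /=.
by rewrite mulr_sumr; apply: eq_bigr => i _; rewrite IH mulrCA.
Qed.

Lemma multinomial_mean0 n : multinomial_mean n (fun=> 0) = 0.
Proof. by elim: n => [//|n IH] /=; rewrite big1// => i _; rewrite IH mulr0. Qed.

Lemma multinomial_mean_sum n (I : Type) (s : seq I) (F : I -> counts_t -> R) :
  multinomial_mean n (fun c => \sum_(k <- s) F k c) = \sum_(k <- s) multinomial_mean n (F k).
Proof.
elim: s => [|k s IH].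
  by rewrite big_nil -[RHS](multinomial_mean0 n); apply: multinomial_mean_ext => c _;
    rewrite big_nil.
rewrite big_cons -IH -multinomial_meanD; apply: multinomial_mean_ext => c _;
  by rewrite big_cons.
Qed.

(** A linear statistic turns the recursion into iteration of the one-step average. *)
Lemma multinomial_mean_iter n (f : R -> R) (zeta : 'I_r -> R) h x :
  multinomial_mean n (fun c => f (x + h * \sum_i (c i 0)%:R * zeta i)) =
    iter n (step (fun i => pi i 0) zeta h) f x.
Proof.
elim: n x => [|n IH] x; first by rewrite /= big1 ?mulr0 ?addr0// => i _; rewrite mxE mul0r.
rewrite iterS /= {1}/step; apply: eq_bigr => i _; congr (_ * _).
rewrite -IH; apply: multinomial_mean_ext => c _; congr f; rewrite -addrA -mulrDr; congr (_ +
  _ * _).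
under eq_bigr do rewrite mxE natrD mulrDl; rewrite big_split/= addrC; congr (_ + _).
by rewrite (bigD1 i)//= eqxx mul1r big1 ?addr0// => j /negPf ->; rewrite mul0r.
Qed.

(** Conditioning on the last category observed, the multinomial coefficients obey
    the recursion that defines the mean: category [i] accounts for a share
    [c0 i / n.+1] of the probability of [c0]. *)
Lemma multinomial_mean_point n c0 : multinomial_mean n (fun c => (c == c0)%:R) =
  multinomial_pmf n pi c0.
Proof.
elim: n c0 => [|n IH] c0 /=; rewrite /multinomial_pmf.
  case: ifPn => [|cn].
    rewrite sum_nat_eq0 => /forallP c00.
    have c0E j : c0 j ord0 = 0%N by apply/eqP; exact: c00.
    rewrite !big1 => [|j _|j _]; rewrite ?c0E ?expr0//.
    rewrite divrr ?unitr1// mul1r (_ : _ == _)//.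
    by apply/eqP/matrixP => i j; rewrite mxE ord1 c0E.
  case: eqP => [cE|//]; case/negP: cn; rewrite -cE.
  by rewrite big1// => j _; rewrite mxE.
pose sub i : counts_t := \col_j (c0 j ord0 - (j == i))%N.
have subK i : (0 < c0 i ord0)%N -> add_obs i (sub i) = c0.
  move=> c0i; apply/matrixP => j k; rewrite !mxE (ord1 k).
  by have [->|] := eqVneq j i; rewrite ?subnK ?subn0 ?addn0.
have E i : multinomial_mean n (fun c => (add_obs i c == c0)%:R) =
    if (0 < c0 i ord0)%N then multinomial_pmf n pi (sub i) else 0.
  case: ifPn => c0i.
    rewrite -IH; apply: multinomial_mean_ext => c _; congr (_%:R); congr nat_of_bool.
    apply/eqP/eqP => [cE|->]; last exact: subK.
    by apply/matrixP => j k; rewrite mxE -cE mxE (ord1 k) addnK.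
  rewrite -[RHS](multinomial_mean0 n); apply: multinomial_mean_ext => c _; case: eqP => // cE.
  by move: c0i; rewrite -cE mxE eqxx addn1.
under eq_bigr do rewrite E.
case: ifPn => cn; last first.
  rewrite big1// => i _; case: ifPn => c0i; last by rewrite mulr0.
  rewrite /multinomial_pmf ifN ?mulr0//; apply: contra cn => /eqP.
  by rewrite -/(sample_size _) => sn;
    rewrite -/(sample_size c0) -(subK _ c0i) sample_size_add sn.
pose D : R := (\prod_j (c0 j ord0)`!)%N%:R.
have D0 : D != 0 by rewrite pnatr_eq0 -lt0n prodn_gt0// => j; exact: fact_gt0.
transitivity (\sum_i (c0 i ord0)%:R * (n`!%:R / D * \prod_j pi j ord0 ^+ c0 j ord0)).
  apply: eq_bigr => i _; case: ifPn => c0i; last first.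
    by move: c0i; rewrite lt0n negbK => /eqP ->; rewrite mul0r mulr0.
  rewrite /multinomial_pmf ifT; last first.
    by rewrite -eqSS -(eqP cn) -/(sample_size c0) -(subK _ c0i) sample_size_add.
  have other j : j != i -> sub i j ord0 = c0 j ord0 by move=> /negPf ji; rewrite mxE ji subn0.
  have self : c0 i ord0 = (sub i i ord0).+1 by rewrite mxE eqxx subn1 prednK.
  have -> : \prod_j pi j ord0 ^+ c0 j ord0 = pi i ord0 * \prod_j pi j ord0 ^+ sub i j ord0.
    rewrite (bigD1 i)//= [in RHS](bigD1 i)//= self exprS mulrA; congr (_ * _).
    by apply: eq_bigr => j ji; rewrite other.
  have -> : D = (c0 i ord0)%:R * (\prod_j (sub i j ord0)`!)%N%:R.
    rewrite /D -natrM (bigD1 i)//= [in RHS](bigD1 i)//= mulnA {1}self factS -self.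
    congr (_%:R); congr (_ * _)%N; apply: eq_bigr => j ji; by rewrite other.
  have s0 : (\prod_j (sub i j ord0)`!)%N%:R != 0 :> R.
    by rewrite pnatr_eq0 -lt0n prodn_gt0// => j; exact: fact_gt0.
  by field; rewrite s0 pnatr_eq0 -lt0n c0i.
rewrite -mulr_suml -natr_sum (eqP cn) factS natrM -/D.
by field.
Qed.

Hypothesis pi0 : forall i, 0 <= pi i 0.
Hypothesis pi1 : \sum_i pi i 0 = 1.

Lemma multinomial_mean_cst n a : multinomial_mean n (fun=> a) = a.
Proof. by elim: n => [//|n IH] /=; rewrite -mulr_suml IH pi1 mul1r. Qed.

Lemma multinomial_mean_le n f g : (forall c, sample_size c = n -> f c <= g c) ->
  multinomial_mean n f <= multinomial_mean n g.
Proof.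
elim: n f g => [|n IH] f g fg /=.
  by apply: fg; rewrite /sample_size big1// => j _; rewrite mxE.
apply: ler_sum => i _; rewrite ler_wpM2l//; apply: IH => c cn.
by apply: fg; rewrite sample_size_add cn.
Qed.

End MultinomialExpectation.

Section MultinomialLaw.
Variables (R : realType) (r : nat) (pi : 'cV[R]_r).
Local Notation counts_t := 'cV[nat]_r.
Implicit Types (A B : set counts_t) (c : counts_t).

Definition multinomial_pr n A : R := multinomial_mean pi n (\1_A : counts_t -> R).

Definition samples n : seq counts_t :=
  [seq c <- [seq map_mx (@nat_of_ord n.+1) k | k : 'cV['I_n.+1]_r] | sample_size c == n].

Let samples_uniq n : uniq (samples n).
Proof.
apply: filter_uniq; rewrite map_inj_uniq ?enum_uniq// => k l kl.
apply/matrixP => i j; apply: val_inj.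
by have /matrixP/(_ i j) := kl; rewrite !mxE.
Qed.

Let mem_samples n c : (c \in samples n) = (sample_size c == n).
Proof.
rewrite mem_filter; case: eqP => //= cn.
have cle j : (c j ord0 < n.+1)%N.
  by rewrite ltnS -cn /sample_size (bigD1 j)//= leq_addr.
apply/mapP; exists (\col_j Ordinal (cle j)); first by rewrite mem_enum.
by apply/matrixP => i j; rewrite !mxE ord1.
Qed.

Lemma multinomial_mean_samples n (g : counts_t -> R) :
  multinomial_mean pi n g = \sum_(c <- samples n) g c * multinomial_pmf n pi c.
Proof.
transitivity (multinomial_mean pi n (fun c => \sum_(c0 <- samples n) g c0 * (c == c0)%:R)).
  apply: multinomial_mean_ext => c cn; rewrite (bigD1_seq c)//=; last by rewrite mem_samples cn.
  by rewrite eqxx mulr1 big1 ?addr0// => c0 /negPf; rewrite eq_sym => ->; rewrite mulr0.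
by rewrite multinomial_mean_sum; apply: eq_bigr => c _;
  rewrite multinomial_meanZ multinomial_mean_point.
Qed.

Hypothesis pi0 : forall i, 0 <= pi i 0.
Hypothesis pi1 : \sum_i pi i 0 = 1.

(** Only the point masses of the counts are prescribed, on an arbitrary space. The
    finitely many vectors of size [n] already carry mass 1, so finite additivity
    determines the probability of every event about the counts. *)
Lemma pr_event n d (T : measurableType d) (P : probability T R) (y : T -> counts_t) :
  has_multinomial_law P y n pi -> forall A,
  measurable (y @^-1` A) /\ P (y @^-1` A) = (multinomial_pr n A)%:E.
Proof.
move=> hy.
have mA A : measurable (y @^-1` A).
  rewrite (_ : y @^-1` A = \bigcup_c (if c \in A then y @^-1` [set c] else set0)).
    apply: countable_bigcupT_measurable => [|c]; first exact: countableP.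
    by case: ifP => // _; exact: (hy c).1.
  apply/seteqP; split=> [w /= Aw|w [c _]]; first by exists (y w) => //; rewrite mem_set.
  by case: ifPn => [/set_mem Ac /= ->|].
have Ps s : uniq s -> P (y @^-1` [set` s]) = (\sum_(c <- s) multinomial_pmf n pi c)%:E.
  elim: s => [_|c s IH /= /andP[cs us]].
    rewrite big_nil (_ : [set` [::]] = set0) ?preimage_set0 ?measure0//.
    by apply/seteqP; split.
  rewrite big_cons (_ : [set` c :: s] = [set c] `|` [set` s]); last first.
    apply/seteqP; split=> c' /=; rewrite inE; first by move=> /orP[/eqP|]; [left|right].
    by move=> [->|->]; rewrite ?eqxx ?orbT.
  rewrite preimage_setU measureU//.
    by rewrite EFinD; congr (_ + _)%E; [exact: (hy c).2|exact: IH].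
  apply/seteqP; split=> // w /= [yc ys]; move: ys; rewrite yc => ys.
  by move: cs; rewrite ys.
have Psupp : P (y @^-1` [set` samples n]) = 1%E.
  rewrite Ps// -(multinomial_mean_cst pi1 n 1) multinomial_mean_samples.
  by congr EFin; apply: eq_bigr => c _; rewrite mul1r.
move=> A; split=> //.
have null : P (y @^-1` (A `\` [set` samples n])) = 0%E.
  apply: (@subset_measure0 _ _ _ P _ (~` (y @^-1` [set` samples n]))) => //.
  - exact: measurableC.
  - by move=> w [].
  - by have := probability_setC P (mA [set` samples n]); rewrite Psupp subee.
rewrite -[in LHS](setUIDK A [set` samples n]) preimage_setU measureU//.
- rewrite [X in (_ + X)%E]null adde0.
  rewrite (_ : A `&` _ = [set` [seq c <- samples n | c \in A]]); last first.
    apply/seteqP; split=> c /=.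
      by move=> [Ac sc]; rewrite mem_filter sc andbT; exact: mem_set.
    by rewrite [in X in X -> _]mem_filter => /andP[/set_mem].
  apply: (etrans (Ps _ (filter_uniq _ (samples_uniq n)))).
  rewrite /multinomial_pr multinomial_mean_samples big_filter [in LHS]big_mkcond/=.
  congr EFin; apply: eq_bigr => c _; rewrite indicE.
  by case: (c \in A); rewrite ?mul1r ?mul0r.
- by apply/seteqP; split=> // w /= [[_ ?] [_]].
Qed.

End MultinomialLaw.

(** * Normal and chi-square distribution functions *)

Section NormalCdf.
Variable R : realType.
Local Notation mu := (@lebesgue_measure R).
Implicit Types (t u : R).

Definition Phi t : R := fine (std_normal R `]-oo, t]%classic).

Lemma EFin_Phi t : (Phi t)%:E = std_normal R `]-oo, t]%classic.
Proof. by rewrite /Phi fineK// fin_num_measure. Qed.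

Lemma gauss_integrable_indic (A : set R) : measurable A -> gauss_integrable (\1_A : R -> R).
Proof.
move=> mA; apply: (@gauss_integrable_bounded _ _ 1); first exact: measurable_indic.
by move=> z; rewrite indicE normr_nat; case: (z \in A).
Qed.

Lemma gauss_mean_Phi t : gauss_mean (\1_(`]-oo, t]%classic) : R -> R) = Phi t.
Proof.
rewrite /gauss_mean /Phi /std_normal /= /normal_prob /=.
rewrite -[RHS]/(Rintegral mu `]-oo, t]%classic (normal_pdf 0 1)) Rintegral_mkcond.
apply: eq_Rintegral => z _; rewrite indicE patchE.
by case: (z \in _); rewrite ?mul1r ?mul0r.
Qed.

(** The density is bounded by its peak. *)
Lemma Phi_lipschitz t u : t <= u -> Phi t <= Phi u <= Phi t + normal_peak 1 * (u - t).
Proof.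
move=> tu; rewrite -!lee_fin EFinD !EFin_Phi.
have mI (i : interval R) : measurable [set` i] by [].
rewrite (_ : `]-oo, u]%classic = `]-oo, t]%classic `|` `]t, u]%classic); last first.
  by rewrite -itv_bndbnd_setU// bnd_simp.
rewrite measureU//; last first.
  apply/seteqP; split=> // x /=; rewrite !in_itv/= => -[xt /andP[tx _]].
  by move: xt; rewrite leNgt tx.
rewrite leeDl ?measure_ge0//= leeD2l//.
rewrite /std_normal /= /normal_prob.
apply: (@le_trans _ _ (\int[mu]_(x in `]t, u]) (normal_peak 1)%:E)%E).
  apply: ge0_le_integral => //.
  - by move=> x _; rewrite lee_fin normal_pdf_ge0.
  - by apply/measurable_EFinP; apply: measurable_funTS; exact: measurable_normal_pdf.
  - by move=> x _; rewrite lee_fin normal_pdf_ub.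
rewrite integral_cst//= lebesgue_measure_itv/= lte_fin.
case: ltP => [_|ut]; first by rewrite -EFinD -EFinM.
by rewrite mule0 lee_fin mulr_ge0 ?normal_peak_ge0// subr_ge0.
Qed.

Lemma continuous_Phi : continuous Phi.
Proof.
move=> t; apply/cvgrPdist_le => e e0.
have p0 : 0 < normal_peak 1 :> R by rewrite normal_peak_gt0 ?oner_eq0.
near=> u.
have ut : `|t - u| <= e / normal_peak 1.
  by near: u; apply: cvgr_dist_le; [exact: cvg_id|rewrite divr_gt0].
apply: (@le_trans _ _ (normal_peak 1 * `|t - u|)); last by rewrite mulrC -ler_pdivlMr.
have [tu|/ltW tu] := leP t u; have /andP[h1 h2] := Phi_lipschitz tu.
  by rewrite !ler0_norm ?subr_le0//; lra.
by rewrite !ger0_norm ?subr_ge0//; lra.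
Unshelve. all: by end_near.
Qed.

Lemma std_normal_opp t : std_normal R [set x | - x <= t] = (Phi t)%:E.
Proof.
rewrite EFin_Phi (_ : [set x | _] = `[(- t)%R, +oo[%classic); last first.
  by apply/seteqP; split=> x /=; rewrite in_itv/= andbT lerNl.
rewrite /std_normal /= /normal_prob -{2}(opprK t) ge0_integration_by_substitutionNy.
- apply: eq_integral => x _; congr EFin; rewrite /= !normal_pdf_gt0E// !subr0.
  by rewrite sqrrN.
- by apply: continuous_subspaceT => x; exact: continuous_normal_pdf.
- by move=> x _; exact: normal_pdf_ge0.
Qed.

(** The square is at most [t] when both [x] and [- x] are at most its root. These
    two events cover the line and have the same probability by symmetry. *)
Lemma chi_square1_le t : chi_square1 R `]-oo, t]%classic =
  (if t < 0 then 0 else 2 * Phi (Num.sqrt t) - 1)%:E.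
Proof.
rewrite /chi_square1 /distribution /pushforward/=.
case: ltP => t0.
  rewrite (_ : _ @^-1` _ = set0) ?measure0//; apply/seteqP; split=> // x /=.
  rewrite /Defs.square in_itv/= => xt.
  by have := le_lt_trans xt t0; rewrite ltNge sqr_ge0.
pose A : set (measurableTypeR R) := `]-oo, Num.sqrt t]%classic.
pose B : set (measurableTypeR R) := [set x | - (x : R) <= Num.sqrt t].
have mA : measurable A by exact: measurable_itv.
have mB : measurable B.
  rewrite (_ : B = `[(- Num.sqrt t)%R, +oo[%classic); first exact: measurable_itv.
  by apply/seteqP; split=> x /=; rewrite /B/= in_itv/= andbT lerNl.
rewrite (_ : _ @^-1` _ = A `\` ~` B); last first.
  rewrite setDE setCK; apply/seteqP; split=> x; rewrite /A /B /= /Defs.square !in_itv/=.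
    move=> xt; have : `|x| <= Num.sqrt t by rewrite -sqrtr_sqr ler_wsqrtr.
    by rewrite ler_norml lerNl => /andP[].
  move=> [xt xt']; rewrite -(sqr_sqrtr t0) -(real_normK (num_real x)).
  by rewrite lerXn2r ?nnegrE ?sqrtr_ge0// ler_norml lerNl xt' xt.
rewrite measureD//; last 2 first.
  exact: measurableC.
  by rewrite (le_lt_trans (probability_le1 _ mA))// ltry.
rewrite (_ : A `&` ~` B = ~` B); last first.
  apply/setIidr => x; rewrite /B/A/= in_itv/= => /negP; rewrite -ltNge => /ltW h.
  by rewrite (le_trans _ (sqrtr_ge0 t))// -oppr_ge0 (le_trans (sqrtr_ge0 t)).
transitivity ((Phi (Num.sqrt t))%:E - (1 - (Phi (Num.sqrt t))%:E))%E.
  congr (_ - _)%E; first by rewrite EFin_Phi.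
  by rewrite -std_normal_opp; exact: probability_setC.
by rewrite -!EFinB; congr EFin; ring.
Qed.

End NormalCdf.

(** * Central limit theorem and control of remainders *)

Section LimitTheorems.
Variables (R : realType) (r : nat) (pi : 'cV[R]_r).
Local Notation counts_t := 'cV[nat]_r.
Hypothesis pi0 : forall i, 0 <= pi i 0.
Hypothesis pi1 : \sum_i pi i 0 = 1.
Implicit Types (A B : set counts_t) (c : counts_t).
Local Notation pr := (multinomial_pr pi).

Lemma pr_le n A B : (forall c, sample_size c = n -> A c -> B c) -> pr n A <= pr n B.
Proof.
move=> AB; apply: multinomial_mean_le => // c cn; rewrite !indicE ler_nat.
by case: (boolP (c \in A)) => // /set_mem /(AB _ cn) /mem_set ->.
Qed.

Lemma pr_ge0 n A : 0 <= pr n A.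
Proof. by rewrite -(multinomial_mean0 pi n); apply: multinomial_mean_le => // c _;
  rewrite indicE ler0n. Qed.

Lemma pr_leU n A B C : (forall c, sample_size c = n -> A c -> B c \/ C c) ->
  pr n A <= pr n B + pr n C.
Proof.
move=> ABC; rewrite -multinomial_meanD; apply: multinomial_mean_le => // c cn;
  rewrite !indicE -natrD ler_nat.
case: (boolP (c \in A)) => // /set_mem /(ABC _ cn) [] /mem_set ->//.
by rewrite addn1.
Qed.

Lemma near_inv_sqrt (C e : R) : 0 < e -> \forall n \near \oo, C / Num.sqrt n%:R <= e.
Proof.
move=> e0; near=> n.
have n0 : 0 < Num.sqrt n%:R :> R by rewrite sqrtr_gt0 ltr0n; near: n; exact: nbhs_infty_gt.
rewrite ler_pdivrMr// mulrC -ler_pdivrMr// (le_trans (ler_norm _))// -sqrtr_sqr ler_wsqrtr//.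
by near: n; exact: nbhs_infty_ger.
Unshelve. all: by end_near.
Qed.

Definition zscore (zeta : 'I_r -> R) n c : R := (Num.sqrt n%:R)^-1 * \sum_i (c i 0)%:R * zeta i.

Section CentralLimit.
Variable zeta : 'I_r -> R.
Hypothesis zeta_mean : \sum_i pi i 0 * zeta i = 0.
Hypothesis zeta_var : \sum_i pi i 0 * zeta i ^+ 2 = 1.

Let clt_spline (b d e : R) : 0 < d -> 0 < e -> \forall n \near \oo,
  `|multinomial_mean pi n (fun c => spline_step (d * (zscore zeta n c - b)))
    - gauss_mean (fun z => spline_step (d * (z - b)))| <= e.
Proof.
move=> d0 e0; have [K [f1 [f2 [mf1 mf2 T]]]] := spline_step_taylor3 b d0.
set f : R -> R := fun x => spline_step (d * (x - b)) in T *.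
have cf := taylor3_continuous T.
have f01 x : 0 <= f x <= 1 by exact: spline_step_bounds.
near=> n.
have n0 : 0 < n%:R :> R by rewrite ltr0n; near: n; exact: nbhs_infty_gt.
have s0 : 0 < Num.sqrt n%:R :> R by rewrite sqrtr_gt0.
have h0 : 0 <= (Num.sqrt n%:R)^-1 :> R by rewrite invr_ge0 ltW.
have := lindeberg pi0 pi1 zeta_mean zeta_var n cf f01 mf1 mf2 T h0 0.
rewrite mulfV ?gt_eqF// -multinomial_mean_iter /smoothing.
have -> : (fun z => f (0 + 1 * z)) = f by apply/funext => z; rewrite add0r mul1r.
rewrite (_ : multinomial_mean pi n _ = multinomial_mean pi n (fun c => f (zscore zeta n c)));
  last first.
  by apply: multinomial_mean_ext => c _; rewrite add0r.
move=> /le_trans; apply.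
set m := third_moments _ _; set h := (Num.sqrt n%:R)^-1.
have -> : n%:R * (K * h ^+ 3 * m) = K * m / Num.sqrt n%:R.
  by rewrite /h -{1}(sqr_sqrtr (ltW n0)); field; rewrite gt_eqF.
by near: n; exact: near_inv_sqrt.
Unshelve. all: by end_near.
Qed.

(** The indicator of a half-line is squeezed between two spline steps of width
    [de], for which the Lindeberg bound tends to 0; the gap between the two
    Gaussian means is controlled because [Phi] is Lipschitz. *)
Lemma clt t : pr n [set c | zscore zeta n c <= t] @[n --> \oo] --> Phi t.
Proof.
apply/cvgrPdist_le => e e0.
pose k : R := normal_peak 1 + 1.
have k0 : 0 < k by rewrite ltr_wpDl// normal_peak_ge0.
pose de := e / (2 * k); have de0 : 0 < de by rewrite divr_gt0// mulr_gt0.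
pose d := 3 / de; have d0 : 0 < d by rewrite divr_gt0.
have e20 : 0 < e / 2 by rewrite divr_gt0.
have kde : normal_peak 1 * de <= e / 2.
  apply: (@le_trans _ _ (k * de)); first by rewrite ler_wpM2r ?(ltW de0)// /k lerDl.
  by rewrite /de le_eqVlt; apply/orP; left; apply/eqP; field; rewrite gt_eqF.
have iPhi u : gauss_integrable (\1_(`]-oo, u]%classic) : R ->
  R) by exact: gauss_integrable_indic.
have mspl (b : R) : measurable_fun setT (fun z : R => spline_step (d * (z - b))).
  have [K [f1 [f2 [_ _ T]]]] := spline_step_taylor3 b d0.
  by apply: continuous_measurable_fun; exact: taylor3_continuous T.
have ispl (b : R) : gauss_integrable (fun z : R => spline_step (d * (z - b))).
  apply: (@gauss_integrable_bounded _ _ 1) => // z.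
  by have /andP[? ?] := spline_step_bounds (d * (z - b)); rewrite ger0_norm.
have spl1 (b z : R) : (z <= b)%R%:R <= spline_step (d * (z - b)).
  have /andP[? ?] := spline_step_bounds (d * (z - b)).
  have [zc|zc] := leP z b; rewrite // spline_step_le0//.
  by rewrite pmulr_rle0// subr_le0.
have spl2 (b z : R) : spline_step (d * (z - b)) <= (z <= b + de)%R%:R.
  have /andP[? ?] := spline_step_bounds (d * (z - b)).
  have [zc|zc] := leP z (b + de); rewrite // spline_step_ge3//.
  by rewrite /d mulrAC ler_pdivlMr// ler_wpM2l//; lra.
have indE u (z : R) : \1_(`]-oo, u]%classic) z = (z <= u)%R%:R :> R.
  by rewrite indicE; congr (_%:R); congr nat_of_bool; apply/idP/idP; rewrite inE/= in_itv.
near=> n.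
have H1 : `|multinomial_mean pi n (fun x => spline_step (d * (zscore zeta n x - t)))
    - gauss_mean (fun z => spline_step (d * (z - t)))| <= e / 2 by near: n; exact: clt_spline.
have H2 : `|multinomial_mean pi n (fun x => spline_step (d * (zscore zeta n x - (t - de))))
    - gauss_mean (fun z => spline_step (d * (z - (t - de))))| <= e / 2 by near: n;
      exact: clt_spline.
have G1 : gauss_mean (fun z => spline_step (d * (z - t))) <= Phi (t + de).
  by rewrite -gauss_mean_Phi; apply: gauss_mean_le => // z; rewrite indE.
have G2 : Phi (t - de) <= gauss_mean (fun z => spline_step (d * (z - (t - de)))).
  by rewrite -gauss_mean_Phi; apply: gauss_mean_le => // z; rewrite indE.
have M1 : pr n [set c | zscore zeta n c <= t] <=
  multinomial_mean pi n (fun x => spline_step (d * (zscore zeta n x - t))).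
  apply: multinomial_mean_le => // c _; rewrite indicE; apply: le_trans (spl1 _ _).
  by rewrite ler_nat; case: (boolP (c \in _)) => // /set_mem /= ->.
have M2 : multinomial_mean pi n (fun x => spline_step (d * (zscore zeta n x - (t - de)))) <=
  pr n [set c | zscore zeta n c <= t].
  apply: multinomial_mean_le => // c _; rewrite indicE; apply: le_trans (spl2 _ _) _.
  rewrite subrK ler_nat; case: (boolP (_ <= t)) => // zt.
  by rewrite mem_set.
have := @Phi_lipschitz R t (t + de); rewrite lerDl ltW// => /(_ isT) /andP[_].
have := @Phi_lipschitz R (t - de) t; rewrite gerBl ltW// => /(_ isT) /andP[_].
rewrite opprB addrCA subrr addr0 addrAC subrr add0r => P1 P2.
move: H1 H2; rewrite !ler_norml => /andP[_ H1] /andP[H2 _].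
by apply/andP; split; lra.
Unshelve. all: by end_near.
Qed.

End CentralLimit.

(** If [a] and [w] differ by less than [d / 2], then [a n c <= x] lies between
    [w n c <= x - d / 2] and [w n c <= x + d / 2]. *)
Lemma slutsky (w a : nat -> counts_t -> R) (F : R -> R) x :
  (forall t, pr n [set c | w n c <= t] @[n --> \oo] --> F t) ->
  (forall e, 0 < e -> pr n [set c | e <= `|a n c - w n c|] @[n --> \oo] --> (0 : R)) ->
  {for x, continuous F} -> pr n [set c | a n c <= x] @[n --> \oo] --> F x.
Proof.
move=> wF aw cF; apply/cvgrPdist_le => e e0.
have e3 : 0 < e / 3 by rewrite divr_gt0.
have /cvgrPdist_le/(_ _ e3) := cF.
move=> [d/= d0 dF].
have d20 : 0 < d / 2 by rewrite divr_gt0.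
have F1 : `|F x - F (x + d / 2)| <= e / 3.
  by apply: dF; rewrite /ball/= opprD addNKr normrN gtr0_norm//; lra.
have F2 : `|F x - F (x - d / 2)| <= e / 3.
  by apply: dF; rewrite /ball/= opprB addrC subrK gtr0_norm//; lra.
have /cvgrPdist_le/(_ _ e3) N1 := wF (x + d / 2).
have /cvgrPdist_le/(_ _ e3) N2 := wF (x - d / 2).
have /cvgrPdist_le/(_ _ e3) N3 := aw _ d20.
near=> n.
have H1 : `|F (x + d / 2) - pr n [set c | w n c <= x + d / 2]| <= e / 3.
  by near: n; exact: N1.
have H2 : `|F (x - d / 2) - pr n [set c | w n c <= x - d / 2]| <= e / 3.
  by near: n; exact: N2.
have H3 : `|0 - pr n [set c | d / 2 <= `|a n c - w n c| ]| <= e / 3.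
  by near: n; exact: N3.
have U1 : pr n [set c | a n c <= x] <= pr n [set c | w n c <= x + d / 2] +
  pr n [set c | d / 2 <= `|a n c - w n c| ].
  apply: pr_leU => c _ /= ax; have [|wx] := leP (w n c) (x + d / 2); [by left|right].
  by rewrite distrC (le_trans _ (ler_norm _))//; lra.
have U2 : pr n [set c | w n c <= x - d / 2] <= pr n [set c | a n c <= x] +
  pr n [set c | d / 2 <= `|a n c - w n c| ].
  apply: pr_leU => c _ /= wx; have [|ax] := leP (a n c) x; [by left|right].
  by rewrite (le_trans _ (ler_norm _))//; lra.
move: F1 F2 H1 H2 H3; rewrite sub0r normrN (ger0_norm (pr_ge0 _ _)) !ler_norml.
move=> /andP[? ?] /andP[? ?] /andP[? ?] /andP[? ?] ?.
by apply/andP; split; lra.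
Unshelve. all: by end_near.
Qed.

(** The sample size times the squared distance from the observed proportions to
    [pi]: the scale on which every remainder is measured. *)
Definition tau n c : R := (\sum_i ((c i 0)%:R - n%:R * pi i 0) ^+ 2) / n%:R.

Lemma tau_ge0 n c : 0 <= tau n c.
Proof. by rewrite divr_ge0// sumr_ge0// => i _; rewrite sqr_ge0. Qed.

Let multinomial_mean_sqr n (zeta : 'I_r -> R) : \sum_i pi i 0 * zeta i = 0 ->
  multinomial_mean pi n (fun c => (\sum_i (c i 0)%:R * zeta i) ^+ 2) =
  n%:R * \sum_i pi i 0 * zeta i ^+ 2.
Proof.
move=> mean0; transitivity (iter n (step (fun i => pi i 0) zeta 1) (fun x => x ^+ 2) 0).
  by rewrite -multinomial_mean_iter; apply: multinomial_mean_ext => c _; rewrite add0r mul1r.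
suff H x : iter n (step (fun i => pi i 0) zeta 1) (fun x => x ^+ 2) x =
    x ^+ 2 + n%:R * \sum_i pi i 0 * zeta i ^+ 2 by rewrite H expr0n/= add0r.
elim: n x => [|n IH] x; first by rewrite mul0r addr0.
rewrite iterS /step.
under eq_bigr do rewrite IH mul1r.
transitivity ((\sum_i pi i 0) * (x ^+ 2 + n%:R * \sum_i pi i 0 * zeta i ^+ 2) +
    (\sum_i pi i 0 * zeta i) * (2 * x) + \sum_i pi i 0 * zeta i ^+ 2).
  by rewrite !mulr_suml -!big_split/=; apply: eq_bigr => i _; ring.
by rewrite pi1 mean0 -natr1; ring.
Qed.

(** The variances [pi i * (1 - pi i)] of single draws sum to at most 1. *)
Lemma multinomial_mean_tau_le1 n : (0 < n)%N -> multinomial_mean pi n (tau n) <= 1.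
Proof.
move=> n0; have nR : n%:R != 0 :> R by rewrite pnatr_eq0 -lt0n.
pose z i j : R := (j == i)%:R - pi i 0.
have sumz (F : 'I_r -> R) i : \sum_j F j * z i j = F i - (\sum_j F j) * pi i 0.
  under eq_bigr do rewrite mulrBr; rewrite sumrB -mulr_suml; congr (_ - _).
  by rewrite (bigD1 i)//= eqxx mulr1 big1 ?addr0// => j /negPf ->; rewrite mulr0.
have -> : multinomial_mean pi n (tau n) = \sum_i pi i 0 * (1 - pi i 0).
  transitivity (multinomial_mean pi n (fun c => \sum_i n%:R^-1 * (\sum_j (c j 0)%:R * z i j) ^+ 2)).
    apply: multinomial_mean_ext => c cn; rewrite /tau mulr_suml; apply: eq_bigr => i _.
    by rewrite mulrC sumz -natr_sum -[(\sum_j _)%N]/(sample_size c) cn.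
  rewrite multinomial_mean_sum; apply: eq_bigr => i _;
    rewrite multinomial_meanZ multinomial_mean_sqr; last by rewrite sumz pi1 mul1r subrr.
  rewrite mulKf// (_ : \sum_j _ = \sum_j (pi j 0 * z i j) * z i j); last first.
    by apply: eq_bigr => j _; rewrite expr2 mulrA.
  by rewrite sumz sumz pi1 /z eqxx/=; ring.
rewrite -[leRHS]pi1; apply: ler_sum => i _.
by rewrite ler_piMr// gerBl.
Qed.

Lemma pr_tau n M : (0 < n)%N -> 0 < M -> pr n [set c | M <= tau n c] <= M^-1.
Proof.
move=> n0 M0; rewrite -[leRHS]mulr1.
apply: le_trans (ler_wpM2l _ (multinomial_mean_tau_le1 n0)); last by rewrite invr_ge0 ltW.
rewrite -multinomial_meanZ; apply: multinomial_mean_le => // c _; rewrite indicE.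
case: (boolP (c \in _)) => [/set_mem/= Mt|_]; first by rewrite mulrC ler_pdivlMr// mul1r.
by rewrite mulr_ge0 ?tau_ge0// invr_ge0 ltW.
Qed.

(** On [tau <= M] the bound is of order the inverse root of [n], and the
    complement has probability at most [M^-1], whatever [n]. *)
Lemma pr_remainder (W : nat -> counts_t -> R) (K e0 : R) : 0 < e0 -> 0 <= K ->
  (forall n c, (0 < n)%N -> sample_size c = n -> tau n c <= n%:R * e0 ->
     `|W n c| <= K * (1 + tau n c) ^+ 2 / Num.sqrt n%:R) ->
  forall e, 0 < e -> pr n [set c | e <= `|W n c|] @[n --> \oo] --> (0 : R).
Proof.
move=> e00 K0 HW e e_gt0; apply/cvgrPdist_le => d d0.
have M0 : 0 < d^-1 by rewrite invr_gt0.
near=> n.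
have n0 : (0 < n)%N by near: n; exact: nbhs_infty_gt.
rewrite sub0r normrN ger0_norm ?pr_ge0// -(invrK d).
apply: le_trans (pr_tau n0 M0); apply: pr_le => c cn /= eW.
rewrite leNgt; apply/negP => tM.
have tn : tau n c <= n%:R * e0.
  rewrite (le_trans (ltW tM))// -ler_pdivrMr//; near: n; exact: nbhs_infty_ger.
have := HW n c n0 cn tn; rewrite leNgt => /negP; apply; apply: lt_le_trans eW.
apply: (@le_lt_trans _ _ (K * (1 + d^-1) ^+ 2 / Num.sqrt n%:R)).
  rewrite ler_wpM2r ?invr_ge0 ?sqrtr_ge0// ler_wpM2l// ler_sqr ?nnegrE ?addr_ge0 ?(ltW M0)//.
    by rewrite lerD2l ltW.
  exact: tau_ge0.
apply: (@le_lt_trans _ _ (e / 2)); last by lra.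
by near: n; apply: near_inv_sqrt; rewrite divr_gt0.
Unshelve. all: by end_near.
Qed.

End LimitTheorems.

(** * Taylor bounds for the exponential and the logarithm *)

Section ExpLog.
Variable R : realType.
Implicit Types x y : R.

Lemma expR_taylor1 x : `|x| <= 1 / 2 -> 0 <= expR x - 1 - x <= 2 * x ^+ 2.
Proof.
rewrite ler_norml => /andP[x1 x2]; have h := expR_ge1Dx x; apply/andP; split; first by lra.
have := expR_ge1Dx (- x); rewrite expRN => h'.
have e0 := expR_gt0 x.
have : expR x * (1 - x) <= 1 by rewrite -[leRHS](mulfV (lt0r_neq0 e0)) ler_wpM2l// ltW.
move=> h2; have h3 : expR x <= (1 - x)^-1 by rewrite -[leRHS]mul1r ler_pdivlMr//; lra.
suff : (1 - x)^-1 <= 1 + x + 2 * x ^+ 2 by lra.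
rewrite -[leLHS]mul1r ler_pdivrMr; last by lra.
have : 0 <= x ^+ 2 * (1 - 2 * x) by rewrite mulr_ge0 ?sqr_ge0//; lra.
lra.
Qed.

Let mean_value_bound (f df : R -> R) (a C : R) : 0 <= C -> f 0 = 0 ->
  (forall x, `|x| <= a -> is_derive x 1 f (df x)) ->
  (forall x, `|x| <= a -> `|df x| <= C * x ^+ 2) ->
  forall x, `|x| <= a -> `|f x| <= C * `|x| ^+ 3.
Proof.
move=> C0 f0 fd dfC x xa.
have cf (u v : R) : - a <= u -> v <= a -> {within `[u, v], continuous f}.
  move=> ua va; apply: derivable_within_continuous => z; rewrite in_itv/= => /andP[z1 z2].
  by have [] : is_derive z 1 f (df z) by apply: fd; rewrite ler_norml; lra.
have xa' := xa; rewrite ler_norml in xa'; case/andP: xa' => xa1 xa2.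
have fin c : `|c| <= `|x| -> `|df c * x| <= C * `|x| ^+ 3.
  move=> cx; rewrite normrM exprSr mulrA ler_wpM2r// (le_trans (dfC _ (le_trans cx xa)))//.
  by rewrite ler_wpM2l// -(real_normK (num_real c)) lerXn2r ?nnegrE.
have [x0|x0] := leP 0 x.
- have fdi z : z \in `]0, x[ -> is_derive z 1 f (df z).
    by rewrite in_itv/= => /andP[z1 z2]; apply: fd; rewrite ger0_norm ?ltW//; lra.
  have [|c] := MVT_segment x0 fdi _; first by apply: cf; lra.
  rewrite in_itv/= => /andP[c0 cx]; rewrite f0 !subr0 => ->; apply: fin.
  by rewrite !ger0_norm.
- have fdi z : z \in `]x, 0[ -> is_derive z 1 f (df z).
    by rewrite in_itv/= => /andP[z1 z2]; apply: fd; rewrite ltr0_norm//; lra.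
  have [|c] := MVT_segment (ltW x0) fdi _; first by apply: cf; lra.
  rewrite in_itv/= => /andP[cx c0]; rewrite f0 !sub0r => h.
  have -> : f x = df c * x by move: h; lra.
  by apply: fin; rewrite (ler0_norm c0) (ltr0_norm x0); lra.
Qed.

Lemma expR_taylor2 x : `|x| <= 1 / 2 -> `|expR x - 1 - x - x ^+ 2 / 2| <= 2 * `|x| ^+ 3.
Proof.
apply: (@mean_value_bound (fun x => expR x - 1 - x - x ^+ 2 / 2) (fun x => expR x - 1 - x)
  (1 / 2) 2) => // [|z _|z za].
- by rewrite expR0 expr0n/= mul0r; lra.
- by apply: is_derive_eq; rewrite /GRing.scale/=; field.
- by have /andP[h1 h2] := expR_taylor1 za; rewrite ger0_norm.
Qed.

Lemma ln_taylor2 x : `|x| <= 1 / 2 -> `|ln (1 + x) - x + x ^+ 2 / 2| <= 2 * `|x| ^+ 3.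
Proof.
apply: (@mean_value_bound (fun x => ln (1 + x) - x + x ^+ 2 / 2) (fun x => (1 + x)^-1 - 1 +
  x) (1 / 2) 2) => // [|z za|z za].
- by rewrite addr0 ln1 expr0n/= mul0r; lra.
- have z0 : 0 < 1 + z by move: za; rewrite ler_norml => /andP[]; lra.
  have := is_derive1_ln z0 => dln.
  apply: is_derive_eq; rewrite /GRing.scale/=; field.
  by rewrite gt_eqF.
- move: za; rewrite ler_norml => /andP[z1 z2].
  have z0 : 0 < 1 + z by lra.
  have -> : (1 + z)^-1 - 1 + z = z ^+ 2 / (1 + z) by field; rewrite gt_eqF.
  rewrite ger0_norm ?divr_ge0 ?sqr_ge0 ?(ltW z0)//.
  rewrite ler_pdivrMr//.
  have : 0 <= z ^+ 2 * (1 + 2 * z) by rewrite mulr_ge0 ?sqr_ge0//; lra.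
  lra.
Qed.

End ExpLog.

(** * Euclidean norm and Fisher information *)

Section EuclideanNorm.
Variable R : realType.

Definition nrm m (v : 'cV[R]_m) : R := Num.sqrt (\sum_i v i 0 ^+ 2).

Lemma innerE m (u v : 'cV[R]_m) : inner u v = \sum_i u i 0 * v i 0.
Proof. by rewrite /inner mxE; apply: eq_bigr => i _; rewrite mxE. Qed.

Lemma innerC m (u v : 'cV[R]_m) : inner u v = inner v u.
Proof. by rewrite !innerE; apply: eq_bigr => i _; rewrite mulrC. Qed.

Lemma innerDr m (u v w : 'cV[R]_m) : inner u (v + w) = inner u v + inner u w.
Proof. by rewrite !innerE -big_split; apply: eq_bigr => i _; rewrite mxE mulrDr. Qed.

Lemma innerZr m a (u v : 'cV[R]_m) : inner u (a *: v) = a * inner u v.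
Proof. by rewrite !innerE mulr_sumr; apply: eq_bigr => i _; rewrite mxE mulrCA. Qed.

Lemma innerNr m (u v : 'cV[R]_m) : inner u (- v) = - inner u v.
Proof. by rewrite -scaleN1r innerZr mulN1r. Qed.

Lemma innerBr m (u v w : 'cV[R]_m) : inner u (v - w) = inner u v - inner u w.
Proof. by rewrite innerDr innerNr. Qed.

Lemma innerDl m (u v w : 'cV[R]_m) : inner (u + v) w = inner u w + inner v w.
Proof. by rewrite ![inner _ w]innerC innerDr. Qed.

Lemma innerZl m a (u v : 'cV[R]_m) : inner (a *: u) v = a * inner u v.
Proof. by rewrite ![inner _ v]innerC innerZr. Qed.

Lemma innerBl m (u v w : 'cV[R]_m) : inner (u - v) w = inner u w - inner v w.
Proof. by rewrite ![inner _ w]innerC innerBr. Qed.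

Lemma inner_mulmx m n (A : 'M[R]_(m, n)) u v : inner u (A *m v) = inner (A^T *m u) v.
Proof. by rewrite /inner trmx_mul trmxK mulmxA. Qed.

Lemma inner_ge0 m (v : 'cV[R]_m) : 0 <= inner v v.
Proof. by rewrite innerE sumr_ge0// => i _; rewrite -expr2 sqr_ge0. Qed.

Lemma inner_eq0 m (v : 'cV[R]_m) : inner v v = 0 -> v = 0.
Proof.
rewrite innerE => /psumr_eq0P v0; apply/matrixP => i j; rewrite (ord1 j) mxE.
by apply/eqP; rewrite -sqrf_eq0 expr2 v0// => k _; rewrite -expr2 sqr_ge0.
Qed.

Lemma nrm_ge0 m (v : 'cV[R]_m) : 0 <= nrm v. Proof. exact: sqrtr_ge0. Qed.

Lemma sqr_nrm m (v : 'cV[R]_m) : nrm v ^+ 2 = inner v v.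
Proof.
rewrite /nrm sqr_sqrtr; last by rewrite sumr_ge0// => i _; rewrite sqr_ge0.
by rewrite innerE; apply: eq_bigr => i _; rewrite expr2.
Qed.

Lemma nrmZ m a (v : 'cV[R]_m) : nrm (a *: v) = `|a| * nrm v.
Proof.
rewrite /nrm -sqrtr_sqr -sqrtrM ?sqr_ge0//; congr Num.sqrt; rewrite mulr_sumr.
by apply: eq_bigr => i _; rewrite mxE exprMn.
Qed.

Lemma coord_le_nrm m (v : 'cV[R]_m) i : `|v i 0| <= nrm v.
Proof.
rewrite -sqrtr_sqr ler_wsqrtr// (bigD1 i)//= lerDl sumr_ge0// => j _.
exact: sqr_ge0.
Qed.

Lemma inner_le_nrm m (u v : 'cV[R]_m) : `|inner u v| <= nrm u * nrm v.
Proof.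
have [v0|v0] := eqVneq (inner v v) 0.
  rewrite (inner_eq0 v0) (_ : inner u 0 = 0) ?normr0 ?mulr_ge0 ?nrm_ge0//.
  by rewrite -[0]/(0 : 'cV[R]_m) /inner mulmx0 mxE.
have vp : 0 < inner v v by rewrite lt0r v0 inner_ge0.
have := inner_ge0 (inner v v *: u - inner u v *: v).
rewrite !(innerBl, innerBr, innerZl, innerZr) (innerC v u) -!sqr_nrm.
move=> h; rewrite -(@ler_pXn2r _ 2) ?nnegrE ?mulr_ge0 ?nrm_ge0//.
rewrite real_normK ?num_real// exprMn; rewrite -sqr_nrm in vp.
by rewrite -(ler_pM2l vp); lra.
Qed.

Lemma coord_mulmx_le m n (A : 'M[R]_(m, n)) (v : 'cV[R]_n) i :
  `|(A *m v) i 0| <= nrm (row i A)^T * nrm v.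
Proof.
apply: le_trans (inner_le_nrm _ _); rewrite innerE mxE le_eqVlt; apply/orP; left.
by apply/eqP; congr `|_|; apply: eq_bigr => j _; rewrite !mxE.
Qed.

Lemma nrm_le_sum m (v : 'cV[R]_m) : nrm v <= \sum_i `|v i 0|.
Proof.
have s0 : 0 <= \sum_i `|v i 0| by rewrite sumr_ge0.
rewrite -(@ler_pXn2r _ 2) ?nnegrE ?nrm_ge0// sqr_nrm innerE expr2 mulr_suml.
apply: ler_sum => i _; rewrite -expr2 -(real_normK (num_real _)) expr2 ler_wpM2l//.
by rewrite (bigD1 i)//= lerDl sumr_ge0.
Qed.

End EuclideanNorm.

Section DesignMatrix.
Variables (R : realType) (r k : nat) (X : 'M[R]_(r, k)).
Hypothesis hX : design_matrix X.

Lemma row_sum_ge1 j : 1 <= (X *m (const_mx 1 : 'cV[R]_k)) j 0.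
Proof.
case: hX => X01 _ _ /(_ j)[i Xji]; rewrite mxE (bigD1 i)//= Xji mxE mulr1 lerDl.
by apply: sumr_ge0 => l _; rewrite mxE mulr1; case: (X01 j l) => ->.
Qed.

Lemma inner_row_sum_ge1 (s : 'cV[R]_r) : (forall j, 0 <= s j 0) -> \sum_j s j 0 = 1 ->
  1 <= inner s (X *m (const_mx 1 : 'cV[R]_k)).
Proof.
move=> s0 s1; rewrite -[leLHS]s1 innerE; apply: ler_sum => j _.
by rewrite ler_peMr// row_sum_ge1.
Qed.

(** Since the constants are outside the column space of [X], the matrix [X]
    bordered by a column of ones has full column rank; the first rows of a left
    inverse recover [v] from [X *m v] and annihilate constants. *)
Lemma design_left_inverse : exists L : 'M[R]_(k, r), L *m X = 1%:M /\ L *m (ones R r) = 0.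
Proof.
case: hX => _ rX n1 _.
pose A : 'M[R]_(k + 1, r) := col_mx X^T (ones R r)^T.
have : row_free A.
  apply: inj_row_free => v; rewrite -(hsubmxK v) mul_row_col.
  set v1 := lsubmx v; set a := rsubmx v 0 0.
  have -> : rsubmx v = a%:M by rewrite [LHS]mx11_scalar.
  rewrite mul_scalar_mx => h.
  have a0 : a = 0.
    apply/eqP/negP => /negP a0; apply: n1; exists (- a^-1 *: v1^T).
    have /(congr1 trmx) := h; rewrite linearD/= linearZ/= trmx_mul !trmxK trmx0.
    move=> /eqP; rewrite addr_eq0 => /eqP e.
    by rewrite -scalemxAr e scalerN scaleNr opprK scalerA mulVf// scale1r.
  rewrite a0 scale0r addr0 in h; rewrite a0.
  have v10 : v1 = 0.
    have rf : row_free X^T by rewrite /row_free mxrank_tr rX.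
    by apply: (row_free_inj rf); rewrite h mul0mx.
  by rewrite v10 raddf0 row_mx0.
move=> /row_freeP[B AB]; exists (lsubmx B)^T.
have : A *m lsubmx B = lsubmx (1%:M : 'M[R]_(k + 1, k + 1)) by rewrite -AB;
  apply/matrixP => i j; rewrite !mxE; apply: eq_bigr => l _; rewrite !mxE.
rewrite mul_col_mx scalar_mx_block block_mxEh row_mxKl => /eq_col_mx[h1 h2].
split; apply: trmx_inj; rewrite trmx_mul !trmxK ?h1 ?h2 ?trmx1 ?trmx0//.
Qed.

(** The covariance of the two linear predictors under [rho]. *)
Lemma inner_Fmx (rho : 'cV[R]_r) (u v : 'cV[R]_k) :
  inner u (Fmx X rho *m v) = \sum_j rho j 0 * (X *m u) j 0 * (X *m v) j 0
   - inner rho (X *m u) * inner rho (X *m v).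
Proof.
rewrite /Fmx -!mulmxA inner_mulmx trmxK mulmxBl innerBr; congr (_ - _).
  rewrite innerE; apply: eq_bigr => j _; rewrite mul_diag_mx !mxE; ring.
rewrite -mulmxA [rho^T *m _]mx11_scalar mul_mx_scalar innerZr mulrC.
by rewrite innerC.
Qed.

Lemma Fmx_sym (rho : 'cV[R]_r) : (Fmx X rho)^T = Fmx X rho.
Proof.
rewrite /Fmx !trmx_mul trmxK mulmxA; congr (_ *m _ *m _).
by rewrite linearB/= tr_diag_mx trmx_mul trmxK.
Qed.

(** The quadratic form is the variance of [X *m v] under [rho], hence at least [c]
    times the squared norm of the centered predictor, from which the left inverse
    recovers [v]. The constant [kappa] serves all [rho]. *)
Lemma Fmx_pos : exists2 kappa : R, 0 < kappa &
  forall (rho : 'cV[R]_r) c (v : 'cV[R]_k), \sum_j rho j 0 = 1 -> 0 <= c ->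
    (forall j, c <= rho j 0) -> c * kappa * nrm v ^+ 2 <= inner v (Fmx X rho *m v).
Proof.
have [L [LX L1]] := design_left_inverse.
pose N : R := 1 + \sum_i nrm (row i L)^T ^+ 2.
have N0 : 0 < N by rewrite ltr_pwDl// sumr_ge0// => i _; rewrite sqr_ge0.
exists N^-1; first by rewrite invr_gt0.
move=> rho c v rho1 c0 crho.
set w := X *m v; set m := inner rho w.
pose w' := w - m *: ones R r.
have vE : v = L *m w' by rewrite mulmxBr -scalemxAr L1 scaler0 subr0 mulmxA LX mul1mx.
have vw : nrm v ^+ 2 <= N * nrm w' ^+ 2.
  have -> : nrm v ^+ 2 = \sum_i v i 0 ^+ 2.
    by rewrite sqr_nrm innerE; apply: eq_bigr => i _; rewrite expr2.
  apply: (@le_trans _ _ ((\sum_i nrm (row i L)^T ^+ 2) * nrm w' ^+ 2)).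
    rewrite mulr_suml; apply: ler_sum => i _.
    rewrite {1}vE -(real_normK (num_real _)) -exprMn.
    by rewrite lerXn2r ?nnegrE ?mulr_ge0 ?nrm_ge0// coord_mulmx_le.
  by rewrite ler_wpM2r ?sqr_ge0// /N lerDr.
have -> : inner v (Fmx X rho *m v) = \sum_j rho j 0 * w' j 0 ^+ 2.
  rewrite inner_Fmx -/w -/m.
  transitivity (\sum_j rho j 0 * w j 0 ^+ 2 - 2 * m * (\sum_j rho j 0 * w j 0) +
    m ^+ 2 * \sum_j rho j 0).
    rewrite rho1 -innerE -/m mulr1.
    rewrite (eq_bigr (fun j => rho j 0 * w j 0 ^+ 2)); first by ring.
    by move=> j _; rewrite expr2 mulrA.
  rewrite !mulr_sumr -sumrB -big_split/=; apply: eq_bigr => j _.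
  by rewrite !mxE mulr1; ring.
rewrite -mulrA mulrCA ler_pdivrMl//.
apply: (@le_trans _ _ (c * (N * nrm w' ^+ 2))); first by rewrite ler_wpM2l.
rewrite mulrCA ler_wpM2l ?(ltW N0)// sqr_nrm innerE mulr_sumr.
by apply: ler_sum => j _; rewrite -expr2 ler_wpM2r// sqr_ge0.
Qed.

Lemma Fmx_unit (rho : 'cV[R]_r) : simplex rho -> Fmx X rho \in unitmx.
Proof.
move=> [rho0 rho1].
have {}rho1 : \sum_j rho j 0 = 1.
  by rewrite -rho1 innerE; apply: eq_bigr => j _; rewrite mxE mul1r.
have [kappa k0 H] := Fmx_pos.
have [c c0 crho] : exists2 c, 0 < c & forall j, c <= rho j 0.
  exists (\big[Num.min/1]_j rho j 0); last by move=> j; exact: bigmin_le_cond.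
  by apply/bigmin_gtP; split.
rewrite -row_free_unit; apply: inj_row_free => v v0.
apply: trmx_inj; rewrite trmx0; apply: inner_eq0; rewrite -sqr_nrm.
have := H rho c v^T rho1 (ltW c0) crho.
have -> : Fmx X rho *m v^T = 0 by rewrite -{1}(Fmx_sym rho) -trmx_mul v0 trmx0.
rewrite (_ : inner _ 0 = 0); last by rewrite /inner mulmx0 mxE.
rewrite pmulr_rle0 ?mulr_gt0// => h; apply/eqP; rewrite eq_le h sqr_ge0//.
Qed.

End DesignMatrix.

(** * Log-likelihood and localization of its maximizers *)

Section OperatorNorm.
Variable R : realType.

(** A bound for the operator norm; the added 1 makes it positive also for a zero
    matrix. *)
Definition op_bound m n (A : 'M[R]_(m, n)) : R := 1 + nrm (\col_i nrm (row i A)^T).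

Lemma op_bound_gt0 m n (A : 'M[R]_(m, n)) : 0 < op_bound A.
Proof. by rewrite ltr_pwDl// nrm_ge0. Qed.

Lemma nrm_mulmx m n (A : 'M[R]_(m, n)) v : nrm (A *m v) <= op_bound A * nrm v.
Proof.
rewrite /op_bound mulrDl mul1r ler_wpDl ?nrm_ge0// -(ger0_norm (nrm_ge0 v)).
rewrite mulrC -nrmZ /nrm ler_wsqrtr//; apply: ler_sum => i _.
rewrite !mxE -(real_normK (num_real _)) lerXn2r ?nnegrE ?mulr_ge0 ?nrm_ge0//.
by rewrite [leRHS]mulrC; have := coord_mulmx_le A v i; rewrite mxE.
Qed.

End OperatorNorm.

Section LogLikelihood.
Variables (R : realType) (r k : nat) (X : 'M[R]_(r, k)) (pi : 'cV[R]_r).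
Hypothesis pi0 : forall j, 0 < pi j 0.
Hypothesis pi1 : \sum_j pi j 0 = 1.
Implicit Types (w p : 'cV[R]_r) (v : 'cV[R]_k).

Definition tilt w : 'cV[R]_r := \col_j (pi j 0 * expR (w j 0)).
(** Log-sum-exp: the log-normalizer of the exponential family through [pi], as a
    function of the linear predictor. *)
Definition lse w : R := ln (\sum_j tilt w j 0).

Lemma tilt_gt0 w j : 0 < tilt w j 0.
Proof. by rewrite mxE mulr_gt0 ?expR_gt0. Qed.

Lemma tilt_sum_gt0 w : 0 < \sum_j tilt w j 0.
Proof.
rewrite lt0r sumr_ge0 ?andbT; last by move=> j _; rewrite ltW// tilt_gt0.
apply/eqP => /psumr_eq0P s0.
have : \sum_j pi j 0 = 0.
  rewrite big1// => j _; have := tilt_gt0 w j.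
  by rewrite s0 ?ltxx// => l _; rewrite ltW// tilt_gt0.
by move/eqP; rewrite pi1 oner_eq0.
Qed.

Lemma expR_lse w : expR (lse w) = \sum_j tilt w j 0.
Proof. by rewrite lnK// posrE tilt_sum_gt0. Qed.

Lemma lse0 : lse 0 = 0.
Proof.
by rewrite /lse -[RHS]ln1 -pi1; congr ln; apply: eq_bigr => j _; rewrite !mxE expR0 mulr1.
Qed.

(** Convexity along the ray from the origin, where the function vanishes. *)
Lemma lse_scale t w : 0 <= t <= 1 -> lse (t *: w) <= t * lse w.
Proof.
move=> /andP[t0 t1]; rewrite -(@ler_expR R) expR_lse.
rewrite -[leRHS]mul1r -ler_pdivrMr ?expR_gt0// -expRN mulr_suml.
have cvx (x : R) : expR (t * x) <= (1 - t) + t * expR x.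
  (* both ends of the chord lie above the tangent at [t * x] *)
  have e0 := expR_gt0 (t * x).
  have h1 : expR (t * x) * (1 - t * x) <= 1.
    have := expR_ge1Dx (- (t * x)); rewrite expRN => h.
    by rewrite -(ler_pM2l e0) mulfV ?gt_eqF// in h.
  have h2 : expR (t * x) * (1 + (x - t * x)) <= expR x.
    have -> : expR x = expR (t * x) * expR (x - t * x) by rewrite -expRD subrKC.
    by rewrite ler_pM2l// expR_ge1Dx.
  have t1' : 0 <= 1 - t by rewrite subr_ge0.
  by have := ler_wpM2l t0 h2; have := ler_wpM2l t1' h1; lra.
apply: (@le_trans _ _ (\sum_j pi j 0 * ((1 - t) + t * expR (w j 0 - lse w)))).
  apply: ler_sum => j _; rewrite !mxE -mulrA -expRD ler_wpM2l ?(ltW (pi0 j))//.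
  by rewrite -mulrBr; exact: cvx.
have -> : \sum_j pi j 0 * ((1 - t) + t * expR (w j 0 - lse w)) =
    (\sum_j pi j 0) * (1 - t) + t * ((\sum_j tilt w j 0) / expR (lse w)).
  rewrite !mulr_suml mulr_sumr -big_split/=; apply: eq_bigr => j _.
  by rewrite mxE expRB; ring.
by rewrite pi1 -expR_lse mulfV ?gt_eqF ?expR_gt0// mul1r mulr1 subrK.
Qed.

Lemma lse_taylor w h : 0 <= h <= 1 / 4 -> (forall j, `|w j 0| <= h) ->
  `|lse w - (inner pi w + (\sum_j pi j 0 * w j 0 ^+ 2 - inner pi w ^+ 2) / 2)| <= 8 * h ^+ 3.
Proof.
move=> /andP[h0 h4] wh.
set m := inner pi w; set q := \sum_j _; set S := \sum_j tilt w j 0.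
have wsum (F : 'I_r -> R) C : (forall j, `|F j| <= C) -> `|\sum_j pi j 0 * F j| <= C.
  move=> FC; rewrite (le_trans (ler_norm_sum _ _ _))// -[leRHS]mul1r -pi1 mulr_suml.
  by apply: ler_sum => j _; rewrite normrM (gtr0_norm (pi0 j)) ler_wpM2l// ltW.
have hm : `|m| <= h by rewrite /m innerE; exact: wsum.
have hq : `|q| <= h ^+ 2.
  by apply: wsum => j; rewrite normrX lerXn2r ?nnegrE.
have q0 : 0 <= q by rewrite sumr_ge0// => j _; rewrite mulr_ge0 ?sqr_ge0// ltW.
have hS : `|S - 1 - m - q / 2| <= 2 * h ^+ 3.
  have -> : S - 1 - m - q / 2 = \sum_j pi j 0 * (expR (w j 0) - 1 - w j 0 - w j 0 ^+ 2 / 2).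
    rewrite /S -[X in _ - X - _ - _]pi1 /m innerE /q mulr_suml -!sumrB.
    by apply: eq_bigr => j _; rewrite mxE; ring.
  apply: wsum => j; apply: le_trans (expR_taylor2 _) _.
    by rewrite (le_trans (wh j))//; lra.
  by rewrite ler_wpM2l// lerXn2r ?nnegrE.
set y := S - 1 in hS.
have hh : h ^+ 2 <= h / 4 by rewrite expr2 ler_wpM2l//; lra.
have hhh : h ^+ 3 <= h ^+ 2 / 4 by rewrite exprSr ler_wpM2l ?sqr_ge0//; lra.
move: hm hq hS; rewrite !ler_norml => /andP[m1 m2] /andP[q1 q2] /andP[S1 S2].
have y2 : `|y| <= 5 / 4 * h by rewrite ler_norml; apply/andP; split; lra.
have y12 : `|y| <= 1 / 2 by lra.
have yS : 1 + y = S by rewrite /y addrC subrK.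
have := ln_taylor2 y12; rewrite yS -[ln S]/(lse w).
have y3 : `|y| ^+ 3 <= 2 * h ^+ 3.
  apply: (@le_trans _ _ ((5 / 4 * h) ^+ 3)).
    by rewrite lerXn2r ?nnegrE ?mulr_ge0//; lra.
  by have := exprn_ge0 3 h0; lra.
have ym : `|y ^+ 2 - m ^+ 2| <= 9 / 4 * h ^+ 3.
  have -> : y ^+ 2 - m ^+ 2 = (y - m) * (y + m) by ring.
  have a1 : `|y - m| <= h ^+ 2 by rewrite ler_norml; apply/andP; split; lra.
  have a2 : `|y + m| <= 9 / 4 * h by move: y2; rewrite !ler_norml => /andP[? ?]; apply/andP;
    split; lra.
  rewrite normrM (le_trans (ler_pM _ _ a1 a2))//.
  by rewrite exprSr; lra.
move: ym y3; set Y3 := `|y| ^+ 3; rewrite !ler_norml => /andP[? ?] ? /andP[? ?].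
have := exprn_ge0 3 h0 => h30.
by apply/andP; split; lra.
Qed.

(** Mean log-likelihood at proportions [p] of the parameter at offset [v] from the
    true one, relative to its value at the truth. *)
Definition loglik p v : R := inner p (X *m v) - lse (X *m v).

Lemma loglik0 p : loglik p 0 = 0.
Proof. by rewrite /loglik mulmx0 lse0 subr0 /inner mulmx0 mxE. Qed.

Lemma loglik_scale p t v : 0 <= t <= 1 -> t * loglik p v <= loglik p (t *: v).
Proof.
move=> t01; rewrite /loglik -scalemxAr innerZr mulrBr lerD2l lerN2.
exact: lse_scale.
Qed.

Definition score p : 'cV[R]_k := X^T *m (p - pi).

Lemma loglik_taylor p v h : 0 <= h <= 1 / 4 -> (forall j, `|(X *m v) j 0| <= h) ->
  `|loglik p v - (inner (score p) v - inner v (Fmx X pi *m v) / 2)| <= 8 * h ^+ 3.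
Proof.
move=> h01 vh; have := lse_taylor h01 vh; rewrite -normrN; apply: le_trans.
rewrite le_eqVlt; apply/orP; left; apply/eqP; congr `|_|.
rewrite inner_Fmx /loglik /score -{1}(trmxK X) -inner_mulmx trmxK innerBl.
have -> : \sum_j pi j 0 * (X *m v) j 0 ^+ 2 = \sum_j pi j 0 * (X *m v) j 0 * (X *m v) j 0.
  by apply: eq_bigr => j _; rewrite expr2 mulrA.
ring.
Qed.

Hypothesis hX : design_matrix X.

(** A parameter as likely as the truth is close to it. By concavity its whole
    segment to the truth is as likely, in particular the point at distance [rho],
    where the Taylor formula is valid; there the score term, linear in the
    distance of [p] to [pi], would have to beat a positive quadratic form. *)
Lemma loglik_localization : exists C e0 : R, [/\ 0 < C, 0 < e0 &
  forall p v, nrm (p - pi) <= e0 -> 0 <= loglik p v -> nrm v <= C * nrm (p - pi)].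
Proof.
have [kappa kp Fpos] := Fmx_pos hX.
have [c c0 cpi] : exists2 c, 0 < c & forall j, c <= pi j 0.
  exists (\big[Num.min/1]_j pi j 0); last by move=> j; exact: bigmin_le_cond.
  by apply/bigmin_gtP; split.
pose l := c * kappa; have l0 : 0 < l by rewrite mulr_gt0.
pose B := op_bound X; have B0 : 0 < B := op_bound_gt0 X.
pose G := op_bound X^T; have G0 : 0 < G := op_bound_gt0 X^T.
have Xv v j : `|(X *m v) j 0| <= B * nrm v.
  by rewrite (le_trans (coord_le_nrm _ _))// nrm_mulmx.
have local p v : B * nrm v <= 1 / 4 -> 8 * B ^+ 3 * nrm v <= l / 4 ->
    0 <= loglik p v -> l / 4 * nrm v <= G * nrm (p - pi).
  move=> v4 v8 lv; have [->|vn0] := eqVneq (nrm v) 0;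
    first by rewrite mulr0 mulr_ge0 ?nrm_ge0// ltW.
  have v0 : 0 < nrm v by rewrite lt0r vn0 nrm_ge0.
  have h01 : 0 <= B * nrm v <= 1 / 4 by rewrite v4 mulr_ge0 ?nrm_ge0// ltW.
  have := loglik_taylor p h01 (Xv v); rewrite ler_norml => /andP[_ h1].
  have h2 : inner (score p) v <= G * nrm (p - pi) * nrm v.
    rewrite (le_trans (ler_norm _))// (le_trans (inner_le_nrm _ _))//.
    by rewrite ler_wpM2r ?nrm_ge0// nrm_mulmx.
  have h3 : l * nrm v ^+ 2 <= inner v (Fmx X pi *m v) by apply: Fpos => //; exact: ltW.
  have h4 : 8 * (B * nrm v) ^+ 3 <= l / 4 * nrm v ^+ 2.
    have -> : 8 * (B * nrm v) ^+ 3 = 8 * B ^+ 3 * nrm v * nrm v ^+ 2 by ring.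
    by rewrite ler_wpM2r// sqr_ge0.
  by rewrite -(ler_pM2r v0); lra.
pose rho := Num.min (1 / (4 * B)) (l / (32 * B ^+ 3)).
have rho0 : 0 < rho by rewrite lt_min !divr_gt0 ?mulr_gt0 ?exprn_gt0.
have rho1 : B * rho <= 1 / 4.
  apply: (@le_trans _ _ (B * (1 / (4 * B))));
    first by rewrite ler_wpM2l ?(ltW B0)// ge_min lexx.
  by rewrite le_eqVlt; apply/orP; left; apply/eqP; field; rewrite gt_eqF.
have rho2 : 8 * B ^+ 3 * rho <= l / 4.
  apply: (@le_trans _ _ (8 * B ^+ 3 * (l / (32 * B ^+ 3)))).
    by rewrite ler_wpM2l ?mulr_ge0 ?exprn_ge0 ?(ltW B0)// ge_min lexx orbT.
  by rewrite le_eqVlt; apply/orP; left; apply/eqP; field; rewrite gt_eqF.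
exists (4 / l * G), (l * rho / (8 * G)); split;
  [by rewrite !mulr_gt0 ?invr_gt0|by rewrite divr_gt0 ?mulr_gt0|].
move=> p v pe lv.
have nv0 := nrm_ge0 v.
have pe' : G * nrm (p - pi) <= l / 8 * rho.
  by rewrite -ler_pdivlMl// (le_trans pe)// le_eqVlt; apply/orP; left; apply/eqP; field;
    rewrite gt_eqF.
suff vr : nrm v <= rho.
  have v4 : B * nrm v <= 1 / 4 by rewrite (le_trans _ rho1)// ler_wpM2l// ltW.
  have v8 : 8 * B ^+ 3 * nrm v <= l / 4.
    by rewrite (le_trans _ rho2)// ler_wpM2l ?mulr_ge0 ?exprn_ge0 ?(ltW B0).
  have := local p v v4 v8 lv; rewrite -ler_pdivlMl ?divr_gt0//.
  by rewrite invf_div mulrA.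
rewrite leNgt; apply/negP => vr.
have v0 : 0 < nrm v by exact: lt_trans rho0 vr.
have t01 : 0 <= rho / nrm v <= 1 by rewrite divr_ge0 ?(ltW rho0)//= ler_pdivrMr// mul1r ltW.
have nt : nrm (rho / nrm v *: v) = rho.
  by rewrite nrmZ ger0_norm ?(divr_ge0 (ltW rho0))// divfK// gt_eqF.
have := local p (rho / nrm v *: v); rewrite nt => /(_ rho1 rho2) H.
have : 0 <= loglik p (rho / nrm v *: v).
  by apply: le_trans (loglik_scale p v t01); rewrite mulr_ge0//; case/andP: t01.
move=> /H; have := mulr_gt0 l0 rho0; lra.
Qed.

End LogLikelihood.

(** * Existence of the constrained maximum and of its multiplier *)

Section Existence.
Variables (R : realType) (r k : nat) (X : 'M[R]_(r, k)) (pi : 'cV[R]_r).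
Hypothesis pi0 : forall j, 0 < pi j 0.
Hypothesis pi1 : \sum_j pi j 0 = 1.
Hypothesis hX : design_matrix X.
Implicit Types (w p : 'cV[R]_r) (v u : 'cV[R]_k).
Local Notation tilt := (tilt pi).
Local Notation lse := (lse pi).
Local Notation loglik := (loglik X pi).

Lemma continuous_bigsum (T : topologicalType) (I : Type) (s : seq I) (F : I -> T -> R) :
  (forall i, continuous (F i)) -> continuous (fun t => \sum_(i <- s) F i t).
Proof.
move=> cF; elim: s => [|i s IH] t.
  by under eq_fun do rewrite big_nil; exact: cvg_cst.
by under eq_fun do rewrite big_cons; apply: cvgD; [exact: cF|exact: IH].
Qed.

Let eta_continuous j : continuous (fun v : 'rV[R]_k => (X *m v^T) j 0).
Proof.
rewrite (_ : (fun _ => _) = fun v : 'rV[R]_k => \sum_i X j i * v 0 i); last first.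
  by apply/funext => v; rewrite mxE; apply: eq_bigr => i _; rewrite mxE.
apply: continuous_bigsum => i v; apply: (continuousM (s := fun=> X j i)).
  exact: cst_continuous.
exact: coord_continuous.
Qed.

Let lse_continuous : continuous (fun v : 'rV[R]_k => lse (X *m v^T)).
Proof.
move=> v; rewrite /lse.
apply: (continuous_comp (f := fun v : 'rV[R]_k => \sum_j tilt (X *m v^T) j 0) (g := @ln R)).
  apply: continuous_bigsum => j.
  rewrite (_ : (fun _ => _) = fun v : 'rV[R]_k => pi j 0 * expR ((X *m v^T) j 0)); last first.
    by apply/funext => {}v; rewrite mxE.
  move=> {}v.
  apply: (@continuousM _ _ (fun=> pi j 0) (fun v : 'rV[R]_k => expR ((X *m v^T) j 0))).
    exact: cst_continuous.
  by apply: continuous_comp; [exact: eta_continuous|exact: continuous_expR].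
by apply: continuous_ln; exact: tilt_sum_gt0.
Qed.

Let loglik_continuous p : continuous (fun v : 'rV[R]_k => loglik p v^T).
Proof.
have cp : continuous (fun v : 'rV[R]_k => inner p (X *m v^T)).
  rewrite (_ : (fun _ => _) = fun v : 'rV[R]_k => \sum_j p j 0 * (X *m v^T) j 0); last first.
    by apply/funext => v; rewrite innerE.
  apply: continuous_bigsum => j v.
  apply: (@continuousM _ _ (fun=> p j 0) (fun v : 'rV[R]_k => (X *m v^T) j 0)).
    exact: cst_continuous.
  exact: eta_continuous.
move=> v; have H1 := @lse_continuous v; have H2 := cp v.
exact: cvgB H2 H1.
Qed.

(** Maximize over a box; by localization the points outside are less likely than
    the truth. *)
Lemma exists_maximum : exists2 e0 : R, 0 < e0 & forall p (A : set 'cV[R]_k),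
  nrm (p - pi) <= e0 -> A 0 -> closed [set v : 'rV[R]_k | A v^T] ->
  exists2 u, A u & forall v, A v -> loglik p v <= loglik p u.
Proof.
have [C [e0 [C0 e00 loc]]] := loglik_localization pi0 pi1 hX.
exists e0 => // p A pe A0 cA.
pose rho := C * e0; have rho0 : 0 <= rho by rewrite mulr_ge0// ltW.
pose K := [set v : 'rV[R]_k | forall i, `[- rho, rho]%classic (v ord0 i)] `&`
          [set v : 'rV[R]_k | A v^T].
have cK : compact K.
  apply: compact_closedI => //; apply: (@rV_compact _ _ (fun=> `[- rho, rho]%classic)) => i.
  exact: segment_compact.
have K0 : K 0.
  split=> [i|]; last by rewrite /= trmx0.
  by rewrite /= mxE in_itv/= oppr_le0 rho0.
have [||u /set_mem[_ Au] umax] := compact_EVT_max (f := fun v : 'rV[R]_k => loglik p v^T) _ cK.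
- by exists 0.
- by apply: continuous_subspaceT; exact: loglik_continuous.
exists u^T => // v Av.
have [lv|lv] := leP 0 (loglik p v); last first.
  rewrite (le_trans (ltW lv))// -(loglik0 X pi1 p) -trmx0; apply: umax.
  exact: mem_set.
rewrite -(trmxK v); apply: umax; apply: mem_set; split; last by rewrite /= trmxK.
move=> i; rewrite /= mxE in_itv/= -ler_norml (le_trans (coord_le_nrm _ _))//.
by rewrite (le_trans (loc p v pe lv))// /rho ler_wpM2l// ltW.
Qed.

Lemma exists_mle_loglinear : exists2 e0 : R, 0 < e0 & forall p,
  nrm (p - pi) <= e0 -> exists u, forall v, loglik p v <= loglik p u.
Proof.
have [e0 e00 H] := exists_maximum; exists e0 => // p pe.
have [//||u _ umax] := H p setT pe; last by exists u => v; exact: umax.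
by rewrite (_ : [set _ | _] = setT)//; exact: closedT.
Qed.

Lemma exists_mle_multiplicative : exists2 e0 : R, 0 < e0 & forall p,
  nrm (p - pi) <= e0 -> exists2 u, lse (X *m u) = 0 &
    forall v, lse (X *m v) = 0 -> loglik p v <= loglik p u.
Proof.
have [e0 e00 H] := exists_maximum; exists e0 => // p pe.
apply: (H p [set v | lse (X *m v) = 0] pe); first by rewrite /= mulmx0 lse0.
rewrite (_ : [set _ | _] = (fun v : 'rV[R]_k => lse (X *m v^T)) @^-1` [set 0])//.
apply: closed_comp => [v _|]; first exact: lse_continuous.
exact: closed_eq.
Qed.

(** Along a direction tangent to the constraint the likelihood cannot increase:
    otherwise tilt the direction slightly into the region where the total mass is
    at most 1, then restore mass 1 along the row sums of [X], which only
    increases the likelihood since these are positive. So the two gradients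
    annihilate the same directions and are proportional. *)
Lemma exists_multiplier p u : (forall j, 0 <= p j 0) -> \sum_j p j 0 = 1 ->
  lse (X *m u) = 0 -> (forall v, lse (X *m v) = 0 -> loglik p v <= loglik p u) ->
  exists a, X^T *m p = (1 + a) *: (X^T *m tilt (X *m u)).
Proof.
move=> p0 p1 u0 umax.
set q := tilt (X *m u); have q0 j : 0 < q j 0 by exact: tilt_gt0.
have q1 : \sum_j q j 0 = 1 by rewrite -(expR_lse pi0 pi1) u0 expR0.
pose m : 'cV[R]_r := X *m const_mx 1.
have m1 j : 1 <= m j 0 by exact: row_sum_ge1.
have pm : 0 < inner p m by rewrite (lt_le_trans ltr01)// inner_row_sum_ge1.
have qm : 1 <= inner q m by apply: inner_row_sum_ge1 => // j; exact: ltW.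
(* feasible directions cannot increase the likelihood *)
have tangent v : inner q (X *m v) = 0 -> inner p (X *m v) <= 0.
  move=> qv; rewrite leNgt; apply/negP => pv.
  pose de := inner p (X *m v) / (2 * inner p m).
  have de0 : 0 < de by rewrite divr_gt0// mulr_gt0.
  pose z := v - de *: const_mx 1.
  have Xz : X *m z = X *m v - de *: m by rewrite /z mulmxBr scalemxAr.
  have qz : inner q (X *m z) <=
    - de by rewrite Xz innerBr qv sub0r innerZr lerN2 ler_peMr// ltW.
  have pz : 0 < inner p (X *m z).
    rewrite Xz innerBr innerZr (_ : de * _ = inner p (X *m v) / 2); first by lra.
    by rewrite /de; field; rewrite gt_eqF.
  pose N := nrm (X *m z) + 1; have N0 : 0 < N by rewrite ltr_wpDl// nrm_ge0.
  pose t := Num.min (1 / (2 * N)) (de / (2 * N ^+ 2)).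
  have t0 : 0 < t by rewrite lt_min !divr_gt0 ?mulr_gt0 ?exprn_gt0.
  have tN : t * N <= 1 / 2.
    apply: (@le_trans _ _ (1 / (2 * N) * N));
      first by rewrite ler_wpM2r ?(ltW N0)// ge_min lexx.
    by rewrite le_eqVlt; apply/orP; left; apply/eqP; field; rewrite gt_eqF.
  have tN2 : t * (2 * N ^+ 2) <= de.
    apply: (@le_trans _ _ (de / (2 * N ^+ 2) * (2 * N ^+ 2))).
      by rewrite ler_wpM2r ?mulr_ge0 ?exprn_ge0 ?(ltW N0)// ge_min lexx orbT.
    by rewrite le_eqVlt; apply/orP; left; apply/eqP; field; rewrite gt_eqF.
  pose y j := t * (X *m z) j 0.
  have zN j : `|(X *m z) j 0| <= N by rewrite (le_trans (coord_le_nrm _ _))// lerDl.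
  have yt j : `|y j| <= t * N by rewrite normrM (gtr0_norm t0) ler_wpM2l// ltW.
  have S1 : \sum_j q j 0 * expR (y j) <= 1.
    apply: (@le_trans _ _ (\sum_j (q j 0 + q j 0 * y j + q j 0 * (2 * (t * N) ^+ 2)))).
      apply: ler_sum => j _; rewrite -{2}(mulr1 (q j 0)) -!mulrDr ler_wpM2l ?(ltW (q0 j))//.
      have /andP[_ h] := expR_taylor1 (le_trans (yt j) tN).
      have : y j ^+ 2 <= (t * N) ^+ 2.
        by rewrite -(real_normK (num_real (y j))) lerXn2r ?nnegrE// mulr_ge0 ?(ltW t0) ?(ltW N0).
      by move: h; lra.
    rewrite !big_split/= q1 -mulr_suml q1 mul1r.
    have -> : \sum_j q j 0 * y j = t * inner q (X *m z).
      by rewrite innerE mulr_sumr; apply: eq_bigr => j _; rewrite /y mulrCA.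
    have h1 := ler_wpM2l (ltW t0) qz; have h2 := ler_wpM2l (ltW t0) tN2.
    by lra.
  (* rescaling along [m] returns to the constraint and increases the likelihood further *)
  pose phi (s : R) := \sum_j q j 0 * expR (y j + s * m j 0).
  have cphi : continuous phi.
    apply: continuous_bigsum => j s; apply: cvgM; first exact: cvg_cst.
    apply: (@cvg_comp _ _ _ (fun s => y j + s * m j 0) (@expR R)); last exact: continuous_expR.
    by apply: cvgD; [exact: cvg_cst|apply: cvgM; [exact: cvg_id|exact: cvg_cst]].
  have [s] : exists2 s, s \in `[0, 1] & phi s = 1.
    apply: IVT => //; first exact: continuous_subspaceT.
    have p0' : phi 0 <= 1.
      by apply: le_trans S1; rewrite le_eqVlt; apply/orP; left; apply/eqP;
        apply: eq_bigr => j _; rewrite mul0r addr0.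
    have p1' : 1 <= phi 1.
      rewrite -[leLHS]q1; apply: ler_sum => j _; rewrite ler_peMr ?(ltW (q0 j))//.
      rewrite -[leLHS]expR0 ler_expR mul1r.
      by have := m1 j; have := yt j; rewrite ler_norml => /andP[h _]; lra.
    by rewrite ge_min p0' le_max p1' orbT.
  rewrite in_itv/= => /andP[s0 _] phis.
  pose v' := u + t *: z + s *: const_mx 1.
  have Xv' : X *m v' = X *m u + t *: (X *m z) + s *: m by rewrite mulmxDr mulmxDr -!scalemxAr.
  have lv' : lse (X *m v') = 0.
    rewrite /lse -[RHS]ln1 -phis; congr ln; apply: eq_bigr => j _.
    rewrite [LHS]mxE Xv' [q _ _]mxE -mulrA -expRD; congr (_ * expR _).
    have aff (a b c : 'cV[R]_r) : (a + t *: b + s *: c) j 0 = a j 0 + t * b j 0 + s * c j 0.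
      by rewrite !mxE.
    by rewrite aff addrA.
  have := umax v' lv'; rewrite /loglik lv' u0 !subr0 Xv' !innerDr !innerZr leNgt => /negP;
    apply.
  by rewrite -addrA ltrDl ltr_pwDl ?mulr_gt0// mulr_ge0// ltW.
pose x := X^T *m q.
have x1 : 0 < inner x (const_mx 1).
  by rewrite /x innerC inner_mulmx trmxK innerC; exact: lt_le_trans ltr01 qm.
have xx : inner x x != 0.
  apply/eqP => /inner_eq0 xe; move: x1; rewrite xe innerE big1 ?ltxx// => i _.
  by rewrite mxE mul0r.
pose b := inner (X^T *m p) x / inner x x.
exists (b - 1); rewrite subrKC -/q -/x.
pose v := X^T *m p - b *: x.
have vx : inner x v = 0 by rewrite innerBr innerZr /b divfK// innerC subrr.
have qv : inner q (X *m v) = 0 by rewrite inner_mulmx.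
have pv : inner p (X *m v) = 0.
  apply/eqP; rewrite eq_le tangent//=.
  have := @tangent (- v); rewrite mulmxN !innerNr qv oppr0 oppr_le0; exact.
apply/eqP; rewrite -subr_eq0; apply/eqP; apply: inner_eq0; rewrite -/v {1}/v.
by rewrite innerBl innerZl vx mulr0 subr0 -inner_mulmx.
Qed.

End Existence.

(** * The estimators as maximizers of the log-likelihood *)

Section Multiplier.
Variables (R : realType) (r k : nat) (X : 'M[R]_(r, k)).
Implicit Types (p rho : 'cV[R]_r) (th v : 'cV[R]_k).

(** Directional derivatives only see the restriction to a line. *)
Lemma is_derive_line n (f : 'cV[R]_n -> R) (x v : 'cV[R]_n) (d : R) :
  is_derive (0 : R) 1 (fun h : R => f (h *: v + x)) d -> is_derive x v f d.
Proof.
move=> [dv <-]; have E : (fun h : R => h^-1 *: ((f \o shift x) (h *: v) - f x)) =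
    (fun h : R => h^-1 *: (((fun h : R => f (h *: v + x)) \o shift 0) (h *: (1 : R)) -
      (f (0 *: v + x)))).
  by apply/funext => h /=; rewrite addr0 scale0r add0r [h *: 1]mulr1.
by constructor; rewrite /derivable /derive E.
Qed.

Lemma is_derive_lagrangian p a th v : 0 < inner (ones R r) (exp (X *m th)) ->
  is_derive th v (lagrangian X p a) (inner p (X *m v) -
    (1 + a) * (inner (exp (X *m th)) (X *m v) / inner (ones R r) (exp (X *m th)))).
Proof.
move=> S0; apply: is_derive_line.
pose e j := (X *m th) j 0; pose w j := (X *m v) j 0.
pose S (h : R) := \sum_j expR (h * w j + e j).
have SE h : inner (ones R r) (exp (X *m (h *: v + th))) = S h.
  rewrite innerE; apply: eq_bigr => j _.
  by rewrite mxE mul1r mxE mulmxDr -scalemxAr mxE [X in expR (X + _)]mxE.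
have -> : (fun h : R => lagrangian X p a (h *: v + th)) =
    (fun h => h * inner p (X *m v) + inner p (X *m th) - (1 + a) * ln (S h)).
  apply/funext => h; rewrite /lagrangian /log_total SE mulmxDr -scalemxAr innerDr innerZr.
  by ring.
have S0E : inner (ones R r) (exp (X *m th)) = S 0 by rewrite -SE scale0r add0r.
rewrite S0E in S0 *.
have dS : is_derive (0 : R) 1 S (\sum_j expR (e j) * w j).
  have -> : S = \sum_j (fun h : R => expR (h * w j + e j)).
    by apply/funext => h; rewrite fct_sumE.
  apply: is_derive_sum => j.
  have da : is_derive (0 : R) 1 (fun h : R => h * w j + e j) (w j).
    by apply: is_derive_eq; rewrite /GRing.scale/= !(mulr0, mulr1, addr0, add0r).
  have := @is_derive1_comp _ (@expR R) (fun h : R => h * w j + e j) 0 _ _ _ da.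
  by rewrite mul0r add0r; apply.
have dl : is_derive (0 : R) 1 (fun h => ln (S h)) ((S 0)^-1 * \sum_j expR (e j) * w j).
  exact: (@is_derive1_comp _ (@ln R) S 0 _ _ (is_derive1_ln S0) dS).
have -> : inner (exp (X *m th)) (X *m v) = \sum_j expR (e j) * w j.
  by rewrite innerE; apply: eq_bigr => j _; rewrite mxE.
apply: is_derive_eq; rewrite /GRing.scale/=; ring.
Qed.

Lemma multiplierP p rho a th : simplex rho -> log rho = X *m th ->
  is_multiplier X p rho a <-> X^T *m p = (1 + a) *: (X^T *m rho).
Proof.
move=> [rho0 rho1] lrho.
have expX t : log rho = X *m t -> exp (X *m t) = rho.
  by move=> <-; apply/matrixP => i j; rewrite !mxE lnK// posrE (ord1 j).
have dL t v : log rho = X *m t ->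
    is_derive t v (lagrangian X p a) (inner p (X *m v) - (1 + a) * inner rho (X *m v)).
  move=> lt; have := @is_derive_lagrangian p a t v; rewrite (expX _ lt) rho1 divr1.
  by apply.
split=> [[t [lt dt]]|E].
  apply/eqP; rewrite -subr_eq0; apply/eqP; apply: inner_eq0.
  set z := _ - _; have [_ H] := dL t z lt; have [_ H'] := dt z.
  move: H; rewrite H' => /esym H.
  by rewrite {1}/z innerBl innerZl -!inner_mulmx.
exists th; split=> // v.
by have := dL th v lrho; rewrite !inner_mulmx E innerZl subrr.
Qed.

End Multiplier.

Section MaximumLikelihood.
Variables (R : realType) (r k : nat) (X : 'M[R]_(r, k)) (pi : 'cV[R]_r) (th0 : 'cV[R]_k).
Hypothesis simplex_pi : simplex pi.
Hypothesis log_pi : log pi = X *m th0.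
Implicit Types (p rho : 'cV[R]_r) (v u : 'cV[R]_k) (c : 'cV[nat]_r).
Local Notation tilt := (tilt pi).
Local Notation lse := (lse pi).
Local Notation loglik := (loglik X pi).

Lemma logE m (s : 'cV[R]_m) j : log s j 0 = ln (s j 0). Proof. exact: mxE. Qed.

Lemma simplex_gt0 j : 0 < pi j 0. Proof. by case: simplex_pi. Qed.

Lemma simplex_sum1 : \sum_j pi j 0 = 1.
Proof.
by case: simplex_pi => _ <-; rewrite innerE; apply: eq_bigr => j _; rewrite mxE mul1r.
Qed.

(** The log-linear model, parametrized by the offset from the true parameter. *)
Definition exp_family v : 'cV[R]_r := \col_j (pi j 0 * expR ((X *m v) j 0 - lse (X *m v))).

Lemma exp_family_tilt v : lse (X *m v) = 0 -> exp_family v = tilt (X *m v).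
Proof. by move=> v0; apply/matrixP => i j; rewrite !mxE v0 subr0. Qed.

Lemma simplex_exp_family v : simplex (exp_family v).
Proof.
split=> [j|]; first by rewrite mxE mulr_gt0 ?expR_gt0 ?simplex_gt0.
rewrite innerE; transitivity ((\sum_j tilt (X *m v) j 0) / expR (lse (X *m v))).
  by rewrite mulr_suml; apply: eq_bigr => j _; rewrite !mxE mul1r expRB mulrA.
by rewrite expR_lse ?mulfV ?gt_eqF ?tilt_sum_gt0//;
  [exact: simplex_gt0|exact: simplex_sum1|exact: simplex_gt0|exact: simplex_sum1].
Qed.

Lemma log_exp_family v : log (exp_family v) = log pi + X *m v - lse (X *m v) *: ones R r.
Proof.
apply/matrixP => j i; rewrite (ord1 i) logE [exp_family _ _ _]mxE.
rewrite lnM ?posrE ?expR_gt0 ?simplex_gt0// expRK addrA.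
by rewrite [RHS]mxE [X in _ = X + _]mxE logE [X in _ = _ + X]mxE [X in _ =
  _ - X]mxE [ones R r _ _]mxE mulr1.
Qed.

Lemma inner_log_exp_family p v : \sum_j p j 0 = 1 ->
  inner p (log (exp_family v)) = inner p (log pi) + loglik p v.
Proof.
move=> p1; rewrite log_exp_family innerBr innerDr innerZr /loglik.
have -> : inner p (ones R r) = 1.
  by rewrite innerE -p1; apply: eq_bigr => j _; rewrite mxE mulr1.
ring.
Qed.

Let log_totalE v : log_total X (th0 + v) = lse (X *m v).
Proof.
rewrite /log_total /lse; congr ln; rewrite innerE; apply: eq_bigr => j _.
rewrite mxE mul1r mxE mulmxDr -log_pi mxE expRD logE lnK ?posrE ?simplex_gt0//.
by rewrite [RHS]mxE.
Qed.

Let log_inj rho sig : simplex rho -> simplex sig -> log rho = log sig -> rho = sig.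
Proof.
move=> [rho0 _] [sig0 _] /matrixP e; apply/matrixP => i j.
have := e i j; rewrite !mxE (ord1 j) => /ln_inj; apply; rewrite posrE;
  [exact: rho0|exact: sig0].
Qed.

Lemma loglinear_modelP rho : loglinear_model X rho <-> exists v, rho = exp_family v.
Proof.
split=> [[srho [th lrho]]|[v ->]].
  exists (th - th0); apply: log_inj => //; first exact: simplex_exp_family.
  rewrite log_exp_family lrho -log_totalE subrKC; congr (_ - _).
  by rewrite log_pi mulmxBr subrKC.
split; first exact: simplex_exp_family.
exists (th0 + v); rewrite log_exp_family log_totalE log_pi; congr (_ - _).
by rewrite mulmxDr.
Qed.

Lemma multiplicative_modelP rho :
  multiplicative_model X rho <-> exists2 v, lse (X *m v) = 0 & rho = exp_family v.
Proof.
split=> [[srho [th lrho]]|[v v0 ->]].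
  have v0 : lse (X *m (th - th0)) = 0.
    rewrite -log_totalE subrKC /log_total -lrho.
    rewrite (_ : exp (log rho) = rho); first by case: srho => _ ->; rewrite ln1.
    by case: srho => rho0 _; apply/matrixP => i j; rewrite !mxE lnK// posrE (ord1 j).
  exists (th - th0) => //; apply: log_inj => //; first exact: simplex_exp_family.
  by rewrite log_exp_family v0 scale0r subr0 lrho log_pi mulmxBr subrKC.
split; first exact: simplex_exp_family.
exists (th0 + v); rewrite log_exp_family v0 scale0r subr0 log_pi.
by rewrite mulmxDr.
Qed.

Lemma multinomial_pmf_le n c rho sig : (0 < n)%N -> sample_size c = n ->
  simplex rho -> simplex sig ->
  (multinomial_pmf n rho c <= multinomial_pmf n sig c) =
  (inner (proportions R n c) (log rho) <= inner (proportions R n c) (log sig)).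
Proof.
move=> n0 cn [rho0 _] [sig0 _].
have lik (s : 'cV[R]_r) : (forall j, 0 < s j 0) ->
    \prod_j s j ord0 ^+ c j ord0 = expR (n%:R * inner (proportions R n c) (log s)).
  move=> s0; rewrite innerE mulr_sumr expR_sum; apply: eq_bigr => j _.
  rewrite !mxE !mulrA mulfV ?pnatr_eq0 -?lt0n// mul1r expRM_natl lnK// posrE.
  exact: s0.
rewrite /multinomial_pmf -/(sample_size c) cn eqxx.
rewrite ler_pM2l; last first.
  by rewrite divr_gt0 ?ltr0n ?fact_gt0// prodn_gt0// => j; exact: fact_gt0.
by rewrite !lik// ler_expR ler_pM2l ?ltr0n.
Qed.

Lemma proportions_sum1 n c : (0 < n)%N -> sample_size c = n ->
  \sum_j proportions R n c j 0 = 1.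
Proof.
move=> n0 cn; under eq_bigr do rewrite !mxE.
by rewrite -mulr_sumr -natr_sum -[(\sum_j _)%N]/(sample_size c) cn mulVf// pnatr_eq0 -lt0n.
Qed.

Lemma exp_family_pmf_le n c v u : (0 < n)%N -> sample_size c = n ->
  (multinomial_pmf n (exp_family v) c <= multinomial_pmf n (exp_family u) c) =
  (loglik (proportions R n c) v <= loglik (proportions R n c) u).
Proof.
move=> n0 cn; have p1 := proportions_sum1 n0 cn.
apply: (etrans (multinomial_pmf_le n0 cn (simplex_exp_family v) (simplex_exp_family u))).
transitivity (inner (proportions R n c) (log pi) + loglik (proportions R n c) v <=
  inner (proportions R n c) (log pi) + loglik (proportions R n c) u); last exact: lerD2l.
by congr (_ <= _); exact: inner_log_exp_family.
Qed.

Hypothesis hX : design_matrix X.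
Variables (pitilde pihat : nat -> 'cV[nat]_r -> 'cV[R]_r) (alphahat : nat -> 'cV[nat]_r -> R).
Hypothesis hpitilde : mle_estimator (loglinear_model X) pitilde.
Hypothesis hpihat : mle_estimator (multiplicative_model X) pihat.
Hypothesis halphahat : multiplier_estimator X pihat alphahat.

(** Near [pi] both maxima exist, so the estimators and the multiplier are pinned
    down. What the expansions need is kept: the constrained fit satisfies the
    constraint and the multiplier equation and is at least as likely as the
    truth, and the unconstrained fit is a global maximum. *)
Lemma estimators_exist : exists2 e0 : R, 0 < e0 & forall n c,
  (0 < n)%N -> sample_size c = n -> nrm (proportions R n c - pi) <= e0 ->
  let p := proportions R n c in
  exists u ut, [/\ pihat n c = tilt (X *m u), lse (X *m u) = 0, 0 <= loglik p u,
    X^T *m p = (1 + alphahat n c) *: (X^T *m tilt (X *m u)) &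
    pitilde n c = exp_family ut /\ forall v, loglik p v <= loglik p ut].
Proof.
have [e1 e10 H1] := exists_mle_loglinear simplex_gt0 simplex_sum1 hX.
have [e2 e20 H2] := exists_mle_multiplicative simplex_gt0 simplex_sum1 hX.
exists (Num.min e1 e2); first by rewrite lt_min e10.
move=> n c n0 cn; rewrite le_min => /andP[/H1[ut0 utmax] /H2[u0 lu0 umax]] p.
have p1 : \sum_j p j 0 = 1 by exact: proportions_sum1.
have p0 j : 0 <= p j 0 by rewrite !mxE mulr_ge0// invr_ge0.
have [ut utE lut] : exists2 ut, pitilde n c = exp_family ut & forall v, loglik p v <=
  loglik p ut.
  have [] : is_mle (loglinear_model X) n c (pitilde n c).
    apply: hpitilde; exists (exp_family ut0); split; first by apply/loglinear_modelP;
      exists ut0.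
    by move=> rho /loglinear_modelP[v ->]; rewrite (exp_family_pmf_le v ut0 n0 cn);
      exact: utmax.
  move=> /loglinear_modelP[ut utE] mle; exists ut; first exact: utE.
  move=> v; have := mle _ (proj2 (loglinear_modelP _) (ex_intro _ v erefl)).
  rewrite utE (exp_family_pmf_le v ut n0 cn); exact.
have mleh : is_mle (multiplicative_model X) n c (pihat n c).
  apply: hpihat; exists (exp_family u0); split.
    exact: (proj2 (multiplicative_modelP _) (ex_intro2 _ _ u0 lu0 erefl)).
  move=> rho /multiplicative_modelP[v lv ->].
  rewrite (exp_family_pmf_le v u0 n0 cn); exact: umax.
have [/multiplicative_modelP[u lu uE] mle] := mleh.
have lumax v : lse (X *m v) = 0 -> loglik p v <= loglik p u.
  move=> lv; have := mle _ (proj2 (multiplicative_modelP _) (ex_intro2 _ _ v lv erefl)).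
  rewrite uE (exp_family_pmf_le v u n0 cn); exact.
have [a aE] := exists_multiplier simplex_gt0 simplex_sum1 hX p0 p1 lu lumax.
have lpih : log (pihat n c) = X *m (th0 + u).
  by rewrite uE log_exp_family lu scale0r subr0 log_pi mulmxDr.
have spih : simplex (pihat n c) by rewrite uE; exact: simplex_exp_family.
have uT : pihat n c = tilt (X *m u) by rewrite uE exp_family_tilt.
have mult : is_multiplier X p (pihat n c) (alphahat n c).
  by apply: halphahat => //; exists a; apply/(multiplierP p a spih lpih); rewrite uT.
exists u, ut; split=> //.
- by rewrite -(loglik0 X simplex_sum1 p); apply: lumax; rewrite mulmx0 lse0//;
  exact: simplex_sum1.
- by move/(multiplierP p _ spih lpih) : mult; rewrite uT.
Qed.

End MaximumLikelihood.

(** * Landau calculus near the true distribution *)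

Section BigO.
Variables (R : realType) (Om : Type) (D : Om -> Prop) (e : Om -> R).
Hypothesis e_ge0 : forall om, 0 <= e om.
Implicit Types (f g : Om -> R) (m n : nat).

(** Eventually in [D] as [e] tends to 0. *)
Definition near0 (P : Om -> Prop) :=
  exists2 e1 : R, 0 < e1 & forall om, D om -> e om <= e1 -> P om.

Definition bigO m f := exists C, near0 (fun om => `|f om| <= C * e om ^+ m).

Lemma near0T (P : Om -> Prop) : (forall om, D om -> P om) -> near0 P.
Proof. by move=> DP; exists 1 => // om Dom _; exact: DP. Qed.

Lemma near0_le c : 0 < c -> near0 (fun om => e om <= c).
Proof. by move=> c0; exists c. Qed.

Lemma near0S2 (P Q S : Om -> Prop) : (forall om, D om -> P om -> Q om -> S om) ->
  near0 P -> near0 Q -> near0 S.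
Proof.
move=> PQS [e1 e10 HP] [e2 e20 HQ]; exists (Num.min e1 e2); first by rewrite lt_min e10.
by move=> om Dom; rewrite le_min => /andP[h1 h2]; apply: PQS => //; [exact: HP|exact: HQ].
Qed.

Lemma near0S (P Q : Om -> Prop) : (forall om, D om -> P om -> Q om) -> near0 P -> near0 Q.
Proof. by move=> PQ nP; apply: (near0S2 _ nP nP) => om Dom Pom _; exact: PQ. Qed.

Lemma near0_forall k (P : 'I_k -> Om -> Prop) :
  (forall i, near0 (P i)) -> near0 (fun om => forall i, P i om).
Proof.
move=> nP; have [e1 e1P] : {e1 : 'I_k -> R & forall i, 0 < e1 i /\
    forall om, D om -> e om <= e1 i -> P i om}.
  apply: (@boolp.choice _ _ (fun i c => 0 < c /\ forall om, D om -> e om <= c -> P i om)) => i.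
  have [c c0 h] := nP i; by exists c.
exists (\big[Num.min/1]_i e1 i).
  by apply/bigmin_gtP; split=> // i _; case: (e1P i).
move=> om Dom eom i; case: (e1P i) => _; apply=> //.
by rewrite (le_trans eom)//; exact: bigmin_le_cond.
Qed.

Lemma bigO_ext m f g : near0 (fun om => f om = g om) -> bigO m f -> bigO m g.
Proof.
move=> fg [C fC]; exists C.
by apply: (near0S2 _ fg fC) => om _ ->.
Qed.

Lemma bigO_eq m f g : (forall om, D om -> f om = g om) -> bigO m f -> bigO m g.
Proof. by move=> fg; apply: bigO_ext; exact: near0T. Qed.

Lemma bigOD m f g : bigO m f -> bigO m g -> bigO m (fun om => f om + g om).
Proof.
move=> [C fC] [C' gC]; exists (C + C'); apply: (near0S2 _ fC gC) => om _ h h'.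
by rewrite mulrDl (le_trans (ler_normD _ _))// lerD.
Qed.

Lemma bigOM m n f g : bigO m f -> bigO n g -> bigO (m + n) (fun om => f om * g om).
Proof.
move=> [C fC] [C' gC]; exists (C * C'); apply: (near0S2 _ fC gC) => om _ h h'.
by rewrite normrM exprD mulrACA ler_pM.
Qed.

Lemma bigO_cst c : bigO 0 (fun=> c).
Proof. by exists `|c|; apply: near0T => om _; rewrite mulr1. Qed.

Lemma bigOZ m c f : bigO m f -> bigO m (fun om => c * f om).
Proof. by move=> fO; exact: (bigOM (bigO_cst c) fO). Qed.

Lemma bigON m f : bigO m f -> bigO m (fun om => - f om).
Proof. by move=> [C fC]; exists C; apply: near0S fC => om _; rewrite normrN. Qed.

Lemma bigOB m f g : bigO m f -> bigO m g -> bigO m (fun om => f om - g om).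
Proof. by move=> fO gO; apply: bigOD => //; exact: bigON. Qed.

Lemma bigO_weaken m n f : (m <= n)%N -> bigO n f -> bigO m f.
Proof.
move=> mn [C fC]; exists `|C|; apply: (near0S2 _ fC (near0_le ltr01)) => om _ h e1.
rewrite (le_trans h)// (le_trans (ler_wpM2r _ (ler_norm C))) ?exprn_ge0//.
by rewrite ler_wpM2l// ler_wiXn2l.
Qed.

Lemma bigO_sum m (I : Type) (s : seq I) (F : I -> Om -> R) :
  (forall i, bigO m (F i)) -> bigO m (fun om => \sum_(i <- s) F i om).
Proof.
move=> FO; elim: s => [|i s IH].
  apply: (@bigO_eq _ (fun=> 0)) => [om _|]; first by rewrite big_nil.
  by exists 0; apply: near0T => om _; rewrite normr0 mul0r.
by apply: bigO_eq (bigOD (FO i) IH) => om _; rewrite big_cons.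
Qed.

Lemma bigO_small m f c : bigO m.+1 f -> 0 < c -> near0 (fun om => `|f om| <= c).
Proof.
move=> /(@bigO_weaken 1 m.+1 _ (ltn0Sn m)) [C fC] c0.
have C0 : 0 < `|C| + 1 by rewrite ltr_wpDl.
apply: (near0S2 _ fC (near0_le (divr_gt0 c0 C0))) => om _ h he.
rewrite (le_trans h)// expr1 (@le_trans _ _ ((`|C| + 1) * e om))//.
  by rewrite ler_wpM2r// (le_trans (ler_norm _))// lerDl.
by rewrite mulrC -ler_pdivlMr.
Qed.

Lemma bigO_div m f g c : 0 < c -> near0 (fun om => c <= `|g om|) -> bigO m f ->
  bigO m (fun om => f om / g om).
Proof.
move=> c0 gc [C fC]; exists (C / c); apply: (near0S2 _ fC gc) => om _ h h'.
have g0 : 0 < `|g om| by exact: lt_le_trans h'.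
rewrite normrM normfV ler_pdivrMr// (le_trans h)//.
have Ce : 0 <= C * e om ^+ m by exact: le_trans h.
rewrite (_ : C / c * e om ^+ m * `|g om| = C * e om ^+ m * (`|g om| / c)); last by ring.
by rewrite ler_peMr// ler_pdivlMr// mul1r.
Qed.

Lemma bigO_squeeze m f g h : near0 (fun om => f om <= g om <= h om) ->
  bigO m f -> bigO m h -> bigO m g.
Proof.
move=> fgh [C fC] [C' hC]; exists (`|C| + `|C'|).
have := near0S2 (S := fun om => `|f om| <= C * e om ^+ m /\ `|h om| <= C' * e om ^+ m)
  (fun om _ p q => conj p q) fC hC.
apply: (near0S2 _ fgh) => om _ /andP[fg gh] [hf hh].
have em : 0 <= e om ^+ m by rewrite exprn_ge0.
have := ler_wpM2r em (ler_norm C); have := ler_wpM2r em (ler_norm C').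
have := mulr_ge0 (normr_ge0 C) em; have := mulr_ge0 (normr_ge0 C') em.
move: hf hh; rewrite !ler_norml => /andP[? ?] /andP[? ?] ? ? ? ?.
by apply/andP; split; lra.
Qed.

Definition vecO m k (f : Om -> 'cV[R]_k) := forall i, bigO m (fun om => f om i 0).

Lemma vecO_eq m k (f g : Om -> 'cV[R]_k) : (forall om, D om -> f om = g om) -> vecO m f ->
  vecO m g.
Proof. by move=> fg fO i; apply: bigO_eq (fO i) => om Dom; rewrite fg. Qed.

Lemma vecO_weaken m n k (f : Om -> 'cV[R]_k) : (m <= n)%N -> vecO n f -> vecO m f.
Proof. by move=> mn fO i; exact: bigO_weaken mn (fO i). Qed.

Lemma vecO_cst k (v : 'cV[R]_k) : vecO 0 (fun=> v).
Proof. by move=> i; exact: bigO_cst. Qed.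

Lemma vecOD m k (f g : Om -> 'cV[R]_k) : vecO m f -> vecO m g -> vecO m (fun om => f om + g om).
Proof. by move=> fO gO i; apply: bigO_eq (bigOD (fO i) (gO i)) => om _; rewrite mxE. Qed.

Lemma vecON m k (f : Om -> 'cV[R]_k) : vecO m f -> vecO m (fun om => - f om).
Proof. by move=> fO i; apply: bigO_eq (bigON (fO i)) => om _; rewrite mxE. Qed.

Lemma vecOB m k (f g : Om -> 'cV[R]_k) : vecO m f -> vecO m g -> vecO m (fun om => f om - g om).
Proof. by move=> fO gO; apply: vecOD => //; exact: vecON. Qed.

Lemma vecOZ m n k a (f : Om -> 'cV[R]_k) : bigO m a -> vecO n f ->
  vecO (m + n) (fun om => a om *: f om).
Proof. by move=> aO fO i; apply: bigO_eq (bigOM aO (fO i)) => om _; rewrite mxE. Qed.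

Lemma vecO_mulmx m k l (A : 'M[R]_(l, k)) (f : Om -> 'cV[R]_k) : vecO m f ->
  vecO m (fun om => A *m f om).
Proof.
move=> fO i; apply: (@bigO_eq _ (fun om => \sum_j A i j * f om j 0)) => [om _|].
  by rewrite mxE.
by apply: bigO_sum => j; exact: bigOZ.
Qed.

Lemma bigO_inner m n k (f g : Om -> 'cV[R]_k) : vecO m f -> vecO n g ->
  bigO (m + n) (fun om => inner (f om) (g om)).
Proof.
move=> fO gO; apply: (@bigO_eq _ (fun om => \sum_j f om j 0 * g om j 0)) => [om _|].
  by rewrite innerE.
by apply: bigO_sum => j; exact: bigOM.
Qed.

Lemma bigO_dom m f g : near0 (fun om => `|f om| <= g om) -> bigO m g -> bigO m f.
Proof.
move=> fg [C gC]; exists C; apply: (near0S2 _ fg gC) => om _ h h'.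
by rewrite (le_trans h)// (le_trans (ler_norm _)).
Qed.

Lemma bigO_norm m f : bigO m f -> bigO m (fun om => `|f om|).
Proof. by move=> [C fC]; exists C; apply: near0S fC => om _; rewrite normr_id. Qed.

Lemma vecO_nrm m n (f : Om -> 'cV[R]_n) : vecO m f -> bigO m (fun om => nrm (f om)).
Proof.
move=> fO; apply: (@bigO_dom _ _ (fun om => \sum_i `|f om i 0|)).
  by apply: near0T => om _; rewrite ger0_norm ?nrm_ge0//; exact: nrm_le_sum.
by apply: bigO_sum => i; exact: bigO_norm (fO i).
Qed.

End BigO.

(** * Second-order expansion of the two fits *)

Section ShiftInformation.
Variables (R : realType) (r k : nat) (X : 'M[R]_(r, k)).

(** The gradient of the constraint measured in the information metric: the
    direction in which relaxing the constraint moves the estimate, and the squared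
    length that determines the variance of the multiplier. *)
Definition shift_dir (rho : 'cV[R]_r) : 'cV[R]_k := invmx (Fmx X rho) *m (X^T *m rho).

Definition shift_info (rho : 'cV[R]_r) : R := inner (X^T *m rho) (shift_dir rho).

Lemma sigma2_alphaE n rho : sigma2_alpha X n rho = (n%:R * shift_info rho)^-1.
Proof.
rewrite /sigma2_alpha /shift_info /shift_dir /inner trmx_mul trmxK.
by rewrite !mulmxA.
Qed.

End ShiftInformation.

Section Expansions.
Variables (R : realType) (r k : nat) (X : 'M[R]_(r, k)) (pi : 'cV[R]_r).
Hypothesis pi0 : forall j, 0 < pi j 0.
Hypothesis pi1 : \sum_j pi j 0 = 1.
Hypothesis hX : design_matrix X.
Local Notation tilt := (tilt pi).
Local Notation lse := (lse pi).
Local Notation loglik := (loglik X pi).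
Local Notation score := (score X pi).
Local Notation F := (Fmx X pi).

(** The two fits and the multiplier as one point of a finite-dimensional space:
    observed proportions, offsets of both estimated parameters from the true
    one, and the multiplier. *)
Let Om : Type := ('cV[R]_r * 'cV[R]_k * 'cV[R]_k * R)%type.
Let prop (om : Om) : 'cV[R]_r := om.1.1.1.
Let cpar (om : Om) : 'cV[R]_k := om.1.1.2.
Let fpar (om : Om) : 'cV[R]_k := om.1.2.
Let mult (om : Om) : R := om.2.
Let fitted (om : Om) : 'cV[R]_r := tilt (X *m cpar om).
Let D (om : Om) : Prop := [/\ lse (X *m cpar om) = 0, 0 <= loglik (prop om) (cpar om),
  X^T *m prop om = (1 + mult om) *: (X^T *m fitted om) &
  forall v, loglik (prop om) v <= loglik (prop om) (fpar om)].
Let e (om : Om) : R := nrm (prop om - pi).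
Let e_ge0 om : 0 <= e om. Proof. exact: nrm_ge0. Qed.
Local Notation bigO := (bigO D e).
Local Notation vecO := (vecO D e).
Local Notation near0 := (near0 D e).

Let prop_O : vecO 1 (fun om => prop om - pi).
Proof.
by move=> i; exists 1; apply: near0T => om _; rewrite mul1r expr1 coord_le_nrm.
Qed.

Let score_O : vecO 1 (fun om => score (prop om)).
Proof. exact: vecO_mulmx. Qed.

Let local_O (v : Om -> 'cV[R]_k) :
  (forall om, D om -> 0 <= loglik (prop om) (v om)) -> vecO 1 v.
Proof.
have [C [e0 [C0 e00 loc]]] := loglik_localization pi0 pi1 hX.
move=> lv i; exists C; apply: near0S (near0_le D e e00) => om Dom pe.
by rewrite (le_trans (coord_le_nrm _ _))// expr1 loc// lv.
Qed.

Let cpar_O : vecO 1 cpar.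
Proof. by apply: local_O => om []. Qed.

Let fpar_O : vecO 1 fpar.
Proof.
by apply: local_O => om [_ _ _ h]; rewrite -(loglik0 X pi1 (prop om)) h.
Qed.

Let eta_O : vecO 1 (fun om => X *m cpar om).
Proof. exact: vecO_mulmx. Qed.

Let quad (om : Om) v := inner (score (prop om)) v - inner v (F *m v) / 2.

Let loglik_O (v : Om -> 'cV[R]_k) : vecO 1 v ->
  bigO 3 (fun om => loglik (prop om) (v om) - quad om (v om)).
Proof.
move=> vO; pose h om := nrm (X *m v om).
have hO : bigO 1 h by apply: vecO_nrm; exact: vecO_mulmx.
apply: (@bigO_dom _ _ _ _ _ _ (fun om => 8 * h om ^+ 3)).
  have q0 : 0 < 1 / 4 :> R by rewrite divr_gt0.
  apply: near0S (bigO_small e_ge0 hO q0) => om _ h4.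
  apply: loglik_taylor => // [|j]; last exact: coord_le_nrm.
  by rewrite nrm_ge0/=; apply: le_trans h4; exact: ler_norm.
apply: bigOZ => //; have := bigOM hO (bigOM hO hO).
by apply: bigO_eq.
Qed.

Let half_gt0 : 0 < 1 / 2 :> R. Proof. by rewrite divr_gt0. Qed.

Let curv (om : Om) : 'cV[R]_r := \col_j (pi j 0 * (X *m cpar om) j 0).

Let fitted_O : vecO 2 (fun om => fitted om - pi - curv om).
Proof.
move=> j; apply: (@bigO_dom _ _ _ _ _ _ (fun om => pi j 0 * 2 * (X *m cpar om) j 0 ^+ 2)).
  apply: near0S (bigO_small e_ge0 (eta_O j) half_gt0) => om _ h.
  have /andP[h1 h2] := expR_taylor1 h.
  have -> : (fitted om - pi - curv om) j 0 =
      pi j 0 * (expR ((X *m cpar om) j 0) - 1 - (X *m cpar om) j 0).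
    have aux (a b c : 'cV[R]_r) : (a - b - c) j 0 = a j 0 - b j 0 - c j 0 by rewrite !mxE.
    by rewrite aux [fitted om j 0]mxE [curv om j 0]mxE; ring.
  by rewrite normrM (gtr0_norm (pi0 j)) -mulrA ler_wpM2l ?(ltW (pi0 j))// ger0_norm.
apply: bigOZ => //; have := bigOM (eta_O j) (eta_O j).
by apply: bigO_eq.
Qed.

(** Along the constraint the first-order change of the total mass vanishes. *)
Let mean_O : bigO 2 (fun om => inner pi (X *m cpar om)).
Proof.
apply: (@bigO_eq _ _ _ _ _ (fun om => - inner (ones R r) (fitted om - pi - curv om))).
  move=> om [u0 _ _ _]; rewrite !innerBr !innerE.
  have -> : \sum_j ones R r j 0 * fitted om j 0 = 1.
    transitivity (\sum_j fitted om j 0); last by rewrite -(expR_lse pi0 pi1) u0 expR0.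
    by apply: eq_bigr => j _; rewrite [ones _ _ _ _]mxE mul1r.
  have -> : \sum_j ones R r j 0 * pi j 0 = 1.
    by rewrite -[RHS]pi1; apply: eq_bigr => j _; rewrite mxE mul1r.
  rewrite subrr sub0r opprK; apply: eq_bigr => j _.
  by rewrite [ones _ _ _ _]mxE [curv om j 0]mxE mul1r.
by apply: bigON; exact: (bigO_inner (vecO_cst D e (ones R r)) fitted_O).
Qed.

Let x := X^T *m pi.
Let b := invmx F *m x.
Let s2 := inner x b.

Let simplex_pi : simplex pi.
Proof.
split=> //; rewrite innerE -[RHS]pi1; apply: eq_bigr => j _; by rewrite mxE mul1r.
Qed.

Let F_unit : F \in unitmx. Proof. exact: Fmx_unit. Qed.

Let F_sym u v : inner (F *m u) v = inner u (F *m v).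
Proof. by rewrite [RHS]inner_mulmx Fmx_sym. Qed.

Let Fb : F *m b = x. Proof. by rewrite /b mulmxA mulmxV// mul1mx. Qed.

Lemma Fmx_mulE (rho : 'cV[R]_r) (v : 'cV[R]_k) : Fmx X rho *m v =
  X^T *m (\col_j (rho j 0 * (X *m v) j 0)) - inner rho (X *m v) *: (X^T *m rho).
Proof.
rewrite /Fmx -!mulmxA mulmxBl mulmxBr; congr (_ - _).
  congr (_ *m _); apply/matrixP => j i.
  by rewrite (ord1 i) mul_diag_mx !mxE.
rewrite -mulmxA [rho^T *m _]mx11_scalar mul_mx_scalar -scalemxAr.
by rewrite /inner.
Qed.

Let b_mean om : inner b (F *m cpar om) = inner pi (X *m cpar om).
Proof. by rewrite innerC F_sym Fb innerC inner_mulmx. Qed.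

Let fitted_score_O : vecO 2 (fun om => X^T *m fitted om - x - F *m cpar om).
Proof.
apply: (@vecO_eq _ _ _ _ _ _ (fun om => X^T *m (fitted om - pi - curv om) +
    inner pi (X *m cpar om) *: x)).
  move=> om _; rewrite Fmx_mulE !mulmxBr -/x -/(curv om) opprB.
  by rewrite addrA [in RHS]addrAC.
apply: vecOD; first exact: vecO_mulmx.
exact: (vecOZ mean_O (vecO_cst D e x)).
Qed.

Let Bden (om : Om) := inner b (X^T *m fitted om).

(** Contracting the fitted sufficient statistics with [b] removes the unknown
    first-order offset: [inner b (F *m u) = inner pi (X *m u)] is negligible. *)
Let Bden_O : bigO 2 (fun om => Bden om - s2).
Proof.
apply: (@bigO_eq _ _ _ _ _ (fun om => inner b (X^T *m fitted om - x - F *m cpar om) +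
    inner pi (X *m cpar om))).
  by move=> om _; rewrite !innerBr b_mean subrK /s2 (innerC x).
by apply: bigOD => //; exact: (bigO_inner (vecO_cst D e b) fitted_score_O).
Qed.

Let s2_gt0 : 0 < s2.
Proof.
have [kappa k0 Fpos] := Fmx_pos hX.
have [c c0 cpi] : exists2 c, 0 < c & forall j, c <= pi j 0.
  exists (\big[Num.min/1]_j pi j 0); last by move=> j; exact: bigmin_le_cond.
  by apply/bigmin_gtP; split.
have bF : s2 = inner b (F *m b) by rewrite Fb innerC.
rewrite bF; apply: lt_le_trans (Fpos pi c b pi1 (ltW c0) cpi).
apply: mulr_gt0; first exact: mulr_gt0.
rewrite exprn_gt0// lt0r nrm_ge0 andbT; apply/eqP => b0.
have {}b0 : b = 0 by apply: inner_eq0; rewrite -sqr_nrm b0 expr0n.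
have x0 : x = 0 by rewrite -Fb b0 mulmx0.
have := inner_row_sum_ge1 hX (fun j => ltW (pi0 j)) pi1.
by rewrite inner_mulmx -/x x0 innerE big1 ?ler10// => i _; rewrite mxE mul0r.
Qed.


Let score_eq om : D om -> (1 + mult om) * Bden om = s2 + inner b (score (prop om)).
Proof.
move=> [_ _ H _]; rewrite /Bden -innerZr -H /score mulmxBr innerBr /s2 (innerC x).
by rewrite subrKC.
Qed.

Let mult_O : bigO 1 mult.
Proof.
have h0 : 0 < s2 / 2 by rewrite divr_gt0.
have Bge : near0 (fun om => s2 / 2 <= Bden om).
  apply: near0S (bigO_small e_ge0 Bden_O h0) => om _.
  by rewrite ler_norml => /andP[h _]; lra.
apply: (@bigO_ext _ _ _ _ _ (fun om => (inner b (score (prop om)) - (Bden om - s2)) / Bden om)).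
  apply: near0S Bge => om Dom hB.
  have B0 : Bden om != 0 by rewrite gt_eqF// (lt_le_trans h0).
  by apply: (mulIf B0); rewrite divfK//; have := score_eq Dom; lra.
apply: (bigO_div h0).
  by apply: near0S Bge => om _ hB; rewrite (le_trans hB)// ler_norm.
apply: bigOB; first exact: (bigO_inner (vecO_cst D e b) score_O).
exact: (bigO_weaken e_ge0 _ Bden_O).
Qed.

Let mult1_O : bigO 0 (fun om => 1 + mult om).
Proof. by apply: bigOD; [exact: bigO_cst|exact: (bigO_weaken e_ge0 _ mult_O)]. Qed.

Let mult_score_O : bigO 2 (fun om => s2 * mult om - inner b (score (prop om))).
Proof.
apply: (@bigO_eq _ _ _ _ _ (fun om => (1 + mult om) * - (Bden om - s2))).
  by move=> om Dom; have := score_eq Dom; lra.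
exact: (bigOM mult1_O (bigON Bden_O)).
Qed.

Let resid (om : Om) := score (prop om) - F *m cpar om - mult om *: x.

(** Linearized likelihood equation. *)
Let resid_O : vecO 2 resid.
Proof.
apply: (@vecO_eq _ _ _ _ _ _ (fun om => (1 + mult om) *: (X^T *m fitted om - x - F *m cpar om) +
    mult om *: (F *m cpar om))).
  move=> om [_ _ H _]; rewrite /resid /score mulmxBr H -/x.
  rewrite !scalerBr [(1 + mult om) *: x]scalerDl [(1 + mult om) *: (F *m _)]scalerDl !scale1r.
  by rewrite opprD !addrA !opprD !addrA; apply/matrixP => i j; rewrite !mxE; ring.
apply: vecOD; first exact: (vecOZ mult1_O fitted_score_O).
exact: (vecOZ mult_O (vecO_mulmx F cpar_O)).
Qed.

Let V (om : Om) := invmx F *m score (prop om).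

Let FV om : F *m V om = score (prop om). Proof. by rewrite /V mulmxA mulmxV// mul1mx. Qed.

Let V_O : vecO 1 V. Proof. exact: vecO_mulmx. Qed.

(* completing the square *)
Let quadE om v : quad om v = inner (score (prop om)) (V om) / 2 -
  inner (score (prop om) - F *m v) (V om - v) / 2.
Proof.
rewrite /quad !(innerBl, innerBr) !F_sym FV (innerC v (score _)).
lra.
Qed.

Let quad_le om v : quad om v <= inner (score (prop om)) (V om) / 2.
Proof.
rewrite quadE gerBl divr_ge0// -FV -mulmxBr innerC.
have [kappa _ Fpos] := Fmx_pos hX.
have := Fpos pi 0 (V om - v) pi1 (lexx 0) (fun j => ltW (pi0 j)).
by rewrite !mul0r.
Qed.

(** No stationarity is needed: the maximum lies between the values at [V], the
    maximizer of the quadratic approximation, and the maximum of that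
    approximation. *)
Let full_O : bigO 3 (fun om => loglik (prop om) (fpar om) - inner (score (prop om)) (V om) / 2).
Proof.
apply: (bigO_squeeze e_ge0 _ (loglik_O V_O) (loglik_O fpar_O)); apply: near0T => om [_ _ _ ml].
apply/andP; split; last by rewrite lerD2l lerN2 quad_le.
rewrite {1}/quad FV innerC (innerC (V om)).
by have := ml (V om); rewrite (innerC (score _)); lra.
Qed.

(** The constrained fit misses the quadratic maximizer by [mult om *: b] up to
    second order, which costs [s2 * mult om ^+ 2 / 2]. *)
Let constrained_O : bigO 3 (fun om => loglik (prop om) (cpar om) -
  (inner (score (prop om)) (V om) - s2 * mult om ^+ 2) / 2).
Proof.
have VE om : V om - cpar om = mult om *: b + invmx F *m resid om.
  have -> : invmx F *m resid om = V om - cpar om - mult om *: b.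
    by rewrite /resid !mulmxBr -scalemxAr [invmx F *m (F *m _)]mulmxA mulVmx// mul1mx.
  by rewrite subrKC.
have yE om : score (prop om) - F *m cpar om = mult om *: x + resid om.
  by rewrite /resid subrKC.
pose rest om := mult om * inner b (resid om) + mult om * inner x (invmx F *m resid om) +
  inner (resid om) (invmx F *m resid om).
have restO : bigO 3 rest.
  apply: bigOD; first apply: bigOD.
  - exact: (bigOM mult_O (bigO_inner (vecO_cst D e b) resid_O)).
  - exact: (bigOM mult_O (bigO_inner (vecO_cst D e x) (vecO_mulmx _ resid_O))).
  - exact: (bigO_weaken e_ge0 (n := 4) _ (bigO_inner resid_O (vecO_mulmx _ resid_O))).
apply: (@bigO_eq _ _ _ _ _ (fun om => (loglik (prop om) (cpar om) - quad om (cpar om)) +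
    (- 2^-1) * rest om)); last by apply: bigOD; [exact: loglik_O|exact: bigOZ].
move=> om _; rewrite quadE VE yE /rest; move: (resid om) => rho.
by rewrite !(innerDl, innerDr, innerZl, innerZr) -/s2 (innerC rho b); lra.
Qed.

Let dev (om : Om) := loglik (prop om) (fpar om) - loglik (prop om) (cpar om).

Let dev_O : bigO 3 (fun om => 2 * dev om - s2 * mult om ^+ 2).
Proof.
apply: bigO_eq (bigOZ 2 (bigOB full_O constrained_O)) => om _; rewrite /dev; lra.
Qed.

Let fitted1_O : vecO 1 (fun om => fitted om - pi).
Proof.
have curvO : vecO 1 curv.
  by move=> j; apply: bigO_eq (bigOZ (pi j 0) (eta_O j)) => om _; rewrite [curv om j 0]mxE.
apply: vecO_eq (vecOD (vecO_weaken e_ge0 (ltnW (ltnSn 1)) fitted_O) curvO) => om _.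
by rewrite subrK.
Qed.

Let xhat (om : Om) := X^T *m fitted om.

Let xhat_O : vecO 1 (fun om => xhat om - x).
Proof. by apply: vecO_eq (vecO_mulmx X^T fitted1_O) => om _; rewrite mulmxBr. Qed.

Let xhat0_O : vecO 0 xhat.
Proof.
apply: vecO_eq (vecOD (vecO_weaken e_ge0 (leq0n 1) xhat_O) (vecO_cst D e x)) => om _.
by rewrite subrK.
Qed.

Let Fhat (om : Om) := Fmx X (fitted om).

Let bhat (om : Om) := invmx (Fhat om) *m xhat om.

Let fitted_sum om : D om -> \sum_j fitted om j 0 = 1.
Proof. by move=> [u0 _ _ _]; rewrite -(expR_lse pi0 pi1) u0 expR0. Qed.

Let Fbhat om : D om -> Fhat om *m bhat om = xhat om.
Proof.
move=> Dom; rewrite /bhat mulmxA mulmxV ?mul1mx//; apply: Fmx_unit => //.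
split=> [j|]; first exact: tilt_gt0.
by rewrite -(fitted_sum Dom) innerE; apply: eq_bigr => j _; rewrite [ones _ _ _ _]mxE mul1r.
Qed.

(** The information at the fit dominates a fixed positive form, so its inverse
    stays bounded. *)
Let bhat_O : vecO 0 bhat.
Proof.
have [kappa k0 Fpos] := Fmx_pos hX.
have [c c0 cpi] : exists2 c, 0 < c & forall j, c <= pi j 0.
  exists (\big[Num.min/1]_j pi j 0); last by move=> j; exact: bigmin_le_cond.
  by apply/bigmin_gtP; split.
pose l := c / 2 * kappa; have l0 : 0 < l by rewrite mulr_gt0 ?divr_gt0.
have c2 : 0 < c / 2 by rewrite divr_gt0.
have low : near0 (fun om => forall j, `|(fitted om - pi) j 0| <= c / 2).
  by apply: near0_forall => j; exact: (bigO_small e_ge0 (fitted1_O j) c2).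
move=> i; apply: (@bigO_dom _ _ _ _ _ _ (fun om => l^-1 * nrm (xhat om))); last first.
  by apply: bigOZ; exact: vecO_nrm.
apply: near0S low => om Dom h; rewrite (le_trans (coord_le_nrm _ _))// ler_pdivlMl//.
have [->|bn] := eqVneq (nrm (bhat om)) 0; first by rewrite mulr0 nrm_ge0.
have b0 : 0 < nrm (bhat om) by rewrite lt0r bn nrm_ge0.
have clow j : c / 2 <= fitted om j 0.
  have aux (v w : 'cV[R]_r) : (v - w) j 0 = v j 0 - w j 0 by rewrite !mxE.
  by have := h j; rewrite aux ler_norml => /andP[? _]; have := cpi j; lra.
have := Fpos (fitted om) (c / 2) (bhat om) (fitted_sum Dom) (ltW c2) clow.
rewrite -/(Fhat om) Fbhat// -/l => hl.
rewrite -(ler_pM2r b0) -mulrA -expr2 (le_trans hl)// (le_trans (ler_norm _))//.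
by rewrite (le_trans (inner_le_nrm _ _))// mulrC.
Qed.

Let shat2 (om : Om) := inner (xhat om) (bhat om).

(** Comparing [bhat] with [b] through [Fhat *m bhat = xhat] avoids differentiating
    the matrix inverse. *)
Let shat2_O : bigO 1 (fun om => shat2 om - s2).
Proof.
pose del om : 'cV[R]_r := fitted om - pi.
have E om : xhat om - Fhat om *m b = (xhat om - x) -
    (X^T *m (\col_j (del om j 0 * (X *m b) j 0)) -
      (inner (del om) (X *m b) *: xhat om + inner pi (X *m b) *: (xhat om - x))).
  have -> : Fhat om *m b = x + (Fhat om *m b - F *m b) by rewrite Fb addrC subrK.
  rewrite opprD addrA; congr (_ - _); rewrite !Fmx_mulE -/(xhat om) -/x.
  have -> : \col_j (del om j 0 * (X *m b) j 0) =
      \col_j (fitted om j 0 * (X *m b) j 0) - \col_j (pi j 0 * (X *m b) j 0).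
    apply/matrixP => j i; have aux (v w : 'cV[R]_r) l : (v - w) l 0 =
      v l 0 - w l 0 by rewrite !mxE.
    by rewrite (ord1 i) aux [LHS]mxE aux [in RHS]mxE [X in _ = _ - X]mxE mulrBl.
  rewrite mulmxBr innerBl scalerBl scalerBr subrKA.
  by rewrite !opprB addrACA [RHS]addrACA; congr (_ + _); exact: addrC.
have EO : vecO 1 (fun om => xhat om - Fhat om *m b).
  apply: (vecO_eq (fun om _ => esym (E om))); apply: vecOB => //; apply: vecOB.
    apply: vecO_mulmx => j; apply: bigO_eq (bigOZ ((X *m b) j 0) (fitted1_O j)) => om _.
    by rewrite [RHS]mxE mulrC.
  apply: vecOD; last by apply: (vecOZ (bigO_cst D e _)); exact: xhat_O.
  exact: (vecOZ (bigO_inner fitted1_O (vecO_cst D e (X *m b))) xhat0_O).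
apply: (@bigO_eq _ _ _ _ _ (fun om => inner (bhat om) (xhat om - Fhat om *m b) +
    inner b (xhat om - x))).
  move=> om Dom; rewrite !innerBr inner_mulmx Fmx_sym Fbhat// (innerC (bhat om)).
  by rewrite /shat2 /s2 (innerC x) (innerC (xhat om) b); lra.
apply: bigOD; first exact: (bigO_inner bhat_O EO).
exact: (bigO_inner (vecO_cst D e b) xhat_O).
Qed.

Let s := Num.sqrt s2.
Let shat om := Num.sqrt (shat2 om).
Let g1 om := inner b (score (prop om)).
Let gam om := adjustment (mult om).

Let s_gt0 : 0 < s. Proof. by rewrite sqrtr_gt0. Qed.

Let sE : s ^+ 2 = s2. Proof. by rewrite sqr_sqrtr// ltW. Qed.

Let shat2_pos : near0 (fun om => 0 < shat2 om).
Proof.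
have h0 : 0 < s2 / 2 by rewrite divr_gt0.
apply: near0S (bigO_small e_ge0 shat2_O h0) => om _.
by rewrite ler_norml => /andP[h _]; have := s2_gt0; lra.
Qed.

Let mult_pos : near0 (fun om => 1 / 2 <= 1 + mult om).
Proof.
apply: near0S (bigO_small e_ge0 mult_O half_gt0) => om _.
by rewrite ler_norml => /andP[h _]; lra.
Qed.

Let shat_O : bigO 1 (fun om => shat om - s).
Proof.
apply: (@bigO_ext _ _ _ _ _ (fun om => (shat2 om - s2) / (shat om + s))).
  apply: near0S shat2_pos => om _ h.
  have p : 0 < shat om + s by rewrite ltr_wpDl ?sqrtr_ge0.
  have q : shat om ^+ 2 = shat2 om by rewrite sqr_sqrtr// ltW.
  by rewrite -q -sE; field; rewrite gt_eqF.
apply: (bigO_div s_gt0) shat2_O; apply: near0T => om _.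
by rewrite ger0_norm ?addr_ge0 ?sqrtr_ge0// lerDr sqrtr_ge0.
Qed.

Let shat0_O : bigO 0 shat.
Proof.
apply: bigO_eq (bigOD (bigO_weaken e_ge0 (leq0n 1) shat_O) (bigO_cst D e s)) => om _.
by rewrite subrK.
Qed.

Let g1_O : bigO 1 g1.
Proof. exact: (bigO_inner (vecO_cst D e b) score_O). Qed.

Let alpha_O : bigO 2 (fun om => shat om * mult om - g1 om / s).
Proof.
apply: (@bigO_eq _ _ _ _ _ (fun om => (shat om - s) * mult om +
    s^-1 * (s2 * mult om - g1 om))).
  by move=> om _; rewrite -sE; field; rewrite gt_eqF.
by apply: bigOD; [exact: (bigOM shat_O mult_O)|exact: bigOZ].
Qed.

Let gam0_O : bigO 0 gam.
Proof.
apply: (bigO_div half_gt0) (bigO_cst D e 1); apply: near0S mult_pos => om _ h.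
by rewrite (le_trans h)// ler_norm.
Qed.

Let gam1_O : bigO 1 (fun om => gam om - 1).
Proof.
apply: (@bigO_ext _ _ _ _ _ (fun om => - (mult om * gam om))).
  apply: near0S mult_pos => om _ h; rewrite /gam /adjustment.
  by field; rewrite gt_eqF// (lt_le_trans half_gt0).
exact: (bigON (bigOM mult_O gam0_O)).
Qed.

Let gam3_O : bigO 1 (fun om => gam om ^+ 3 - 1).
Proof.
apply: (@bigO_eq _ _ _ _ _ (fun om => (gam om - 1) * (gam om * gam om + (gam om + 1)))).
  by move=> om _; ring.
apply: (bigOM gam1_O (n := 0)); apply: bigOD; first exact: (bigOM gam0_O gam0_O).
by apply: bigOD => //; exact: bigO_cst.
Qed.

Let gam6_O : bigO 1 (fun om => gam om ^+ 6 - 1).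
Proof.
apply: (@bigO_eq _ _ _ _ _ (fun om => (gam om ^+ 3 - 1) * ((gam om ^+ 3 - 1) + 2))).
  by move=> om _; ring.
apply: (bigOM gam3_O (n := 0)); apply: bigOD; last exact: bigO_cst.
exact: (bigO_weaken e_ge0 _ gam3_O).
Qed.

Let gamma_O : bigO 2 (fun om => - (gam om ^+ 3 * (shat om * mult om)) + g1 om / s).
Proof.
apply: (@bigO_eq _ _ _ _ _ (fun om => - ((gam om ^+ 3 - 1) * (shat om * mult om)) -
    (shat om * mult om - g1 om / s))); first by move=> om _; ring.
apply: bigOB => //; apply: bigON.
exact: (bigOM gam3_O (bigOM shat0_O mult_O)).
Qed.

Let dev_score_O : bigO 3 (fun om => 2 * dev om - (g1 om / s) ^+ 2).
Proof.
apply: (@bigO_eq _ _ _ _ _ (fun om => (2 * dev om - s2 * mult om ^+ 2) +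
    s2^-1 * ((s2 * mult om - g1 om) * (s2 * mult om + g1 om)))).
  by move=> om _; rewrite expr_div_n sE; field; rewrite gt_eqF.
apply: bigOD => //; apply: bigOZ; apply: (bigOM mult_score_O (n := 1)).
by apply: bigOD => //; exact: bigOZ.
Qed.

Let wald_O : bigO 3 (fun om => mult om ^+ 2 * shat2 om - 2 * dev om).
Proof.
apply: (@bigO_eq _ _ _ _ _ (fun om => (mult om * mult om) * (shat2 om - s2) -
    (2 * dev om - s2 * mult om ^+ 2))); first by move=> om _; ring.
by apply: bigOB => //; exact: (bigOM (bigOM mult_O mult_O) shat2_O).
Qed.

Let wald_gamma_O : bigO 3 (fun om => gam om ^+ 6 * mult om ^+ 2 * shat2 om - 2 * dev om).
Proof.
apply: (@bigO_eq _ _ _ _ _ (fun om => (gam om ^+ 6 - 1) * ((mult om * mult om) * shat2 om) +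
    (mult om ^+ 2 * shat2 om - 2 * dev om))); first by move=> om _; ring.
apply: bigOD => //; apply: (bigOM gam6_O (n := 2)).
apply: (bigOM (n := 0) (bigOM mult_O mult_O)).
exact: (bigO_inner xhat0_O bhat_O).
Qed.

Let small m (f : Om -> R) : bigO m f -> exists2 C, 0 <= C &
  near0 (fun om => `|f om| <= C * e om ^+ m).
Proof.
move=> [C fC]; exists `|C| => //; apply: near0S fC => om _ h.
by rewrite (le_trans h)// ler_wpM2r ?exprn_ge0// ler_norm.
Qed.

(** Deterministic second-order analysis of both maximum likelihood fits. All
    statistics are expressed through one linear functional of the observed
    proportions, up to errors of higher order in their distance to the truth. *)
Lemma mle_expansions : 0 < shift_info X pi /\ exists C e1 : R, [/\ 0 <= C, 0 < e1 &
  forall p u ut a, nrm (p - pi) <= e1 ->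
    lse (X *m u) = 0 -> 0 <= loglik p u ->
    X^T *m p = (1 + a) *: (X^T *m tilt (X *m u)) ->
    (forall v, loglik p v <= loglik p ut) ->
  let dev := 2 * (loglik p ut - loglik p u) in
  let i := shift_info X (tilt (X *m u)) in
  let z := inner (shift_dir X pi) (score p) / Num.sqrt (shift_info X pi) in
  let eps := nrm (p - pi) in
  [/\ 0 < i /\ 0 < 1 + a,
      `|Num.sqrt i * a - z| <= C * eps ^+ 2,
      `|- (adjustment a ^+ 3 * (Num.sqrt i * a)) + z| <= C * eps ^+ 2,
      `|dev - z ^+ 2| <= C * eps ^+ 3 &
      `|a ^+ 2 * i - dev| <= C * eps ^+ 3 /\
      `|adjustment a ^+ 6 * a ^+ 2 * i - dev| <= C * eps ^+ 3]].
Proof.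
split; first exact: s2_gt0.
have [C1 C10 [e1 e10 H1]] := small alpha_O.
have [C2 C20 [e2 e20 H2]] := small gamma_O.
have [C3 C30 [e3 e30 H3]] := small dev_score_O.
have [C4 C40 [e4 e40 H4]] := small wald_O.
have [C5 C50 [e5 e50 H5]] := small wald_gamma_O.
have [e6 e60 H6] := shat2_pos.
have [e7 e70 H7] := mult_pos.
exists (C1 + C2 + C3 + C4 + C5).
exists (Num.min e1 (Num.min e2 (Num.min e3 (Num.min e4 (Num.min e5 (Num.min e6 e7)))))).
split; [by rewrite !addr_ge0|by rewrite !lt_min e10 e20 e30 e40 e50 e60|].
move=> p u ut a; rewrite !le_min => /and5P[E1 E2 E3 E4 /and3P[E5 E6 E7]] u0 lu ml fm /=.
pose om : Om := (p, u, ut, a).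
have Dom : D om by [].
have eps m : 0 <= e om ^+ m by rewrite exprn_ge0.
have up C' m : C' <= C1 + C2 + C3 + C4 + C5 ->
    C' * e om ^+ m <= (C1 + C2 + C3 + C4 + C5) * e om ^+ m.
  by move=> h; rewrite ler_wpM2r.
split.
- by split; [exact: (H6 om Dom E6)|apply: lt_le_trans half_gt0 (H7 om Dom E7)].
- by apply: (le_trans (H1 om Dom E1)); apply: up; lra.
- by apply: (le_trans (H2 om Dom E2)); apply: up; lra.
- by apply: (le_trans (H3 om Dom E3)); apply: up; lra.
- split.
  + by apply: (le_trans (H4 om Dom E4)); apply: up; lra.
  + by apply: (le_trans (H5 om Dom E5)); apply: up; lra.
Qed.

(** The contribution of an observation in category [j] to the standardized linear
    statistic that governs all the limits. *)
Definition zeta j : R := ((X *m shift_dir X pi) j 0 - inner pi (X *m shift_dir X pi)) /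
  Num.sqrt (shift_info X pi).

Lemma zeta_mean : \sum_j pi j 0 * zeta j = 0.
Proof.
rewrite /zeta; set w := X *m _; set q := Num.sqrt _.
transitivity ((inner pi w - (\sum_j pi j 0) * inner pi w) / q);
  last by rewrite pi1 mul1r subrr mul0r.
rewrite innerE !mulr_suml -sumrB mulr_suml; apply: eq_bigr => j _.
by rewrite -innerE; ring.
Qed.

Lemma zeta_var : \sum_j pi j 0 * zeta j ^+ 2 = 1.
Proof.
rewrite /zeta -[shift_dir X pi]/b -[shift_info X pi]/s2 -/s; set w := X *m b;
  set m := inner pi w.
transitivity ((\sum_j pi j 0 * w j 0 * w j 0 - 2 * m * (\sum_j pi j 0 * w j 0) +
    (\sum_j pi j 0) * m ^+ 2) / s ^+ 2).
  rewrite mulr_sumr !mulr_suml -sumrB -big_split/= mulr_suml; apply: eq_bigr => j _.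
  by field; rewrite gt_eqF.
have v := inner_Fmx X pi b b; rewrite Fb -/w -/m in v.
rewrite pi1 -innerE -/m sE (_ : _ + 1 * m ^+ 2 = s2); first by rewrite mulfV ?gt_eqF.
by rewrite /s2 innerC v; ring.
Qed.

End Expansions.

(** * Limit laws of the statistics *)

Section Assembly.
Variables (R : realType) (r k : nat) (X : 'M[R]_(r, k)).
Hypothesis hX : design_matrix X.
Variable pi : 'cV[R]_r.
Hypothesis simplex_pi : simplex pi.
Variable th0 : 'cV[R]_k.
Hypothesis log_pi : log pi = X *m th0.
Variables (pitilde pihat : nat -> 'cV[nat]_r -> 'cV[R]_r) (alphahat : nat -> 'cV[nat]_r -> R).
Hypothesis hpitilde : mle_estimator (loglinear_model X) pitilde.
Hypothesis hpihat : mle_estimator (multiplicative_model X) pihat.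
Hypothesis halphahat : multiplier_estimator X pihat alphahat.
Implicit Types (c : 'cV[nat]_r) (n : nat).

Let pi_gt0 := simplex_gt0 simplex_pi.
Let pi_ge0 j : 0 <= pi j 0 := ltW (pi_gt0 j).
Let pi_sum := simplex_sum1 simplex_pi.
Local Notation pr := (multinomial_pr pi).
Local Notation z := (zscore (zeta X pi)).

Definition alpha_stat n c : R := alphahat n c / Num.sqrt (sigma2_alpha X n (pihat n c)).
Definition gamma_stat n c : R := (adjustment (alphahat n c) - 1) /
  Num.sqrt (sigma2_gamma X n (pihat n c) (alphahat n c)).
Definition deviance n c : R := D_stat c (pitilde n c) (pihat n c).
Definition wald_alpha n c : R := L_stat X n (pihat n c) (alphahat n c).
Definition wald_gamma n c : R := G_stat X n (pihat n c) (alphahat n c).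

Let nrm_tau n c : (0 < n)%N -> nrm (proportions R n c - pi) ^+ 2 = tau pi n c / n%:R.
Proof.
move=> n0; have nR : n%:R != 0 :> R by rewrite pnatr_eq0 -lt0n.
rewrite sqr_nrm innerE /tau !mulr_suml; apply: eq_bigr => i _.
by rewrite !mxE; field.
Qed.

Let zscoreE n c : (0 < n)%N -> sample_size c = n -> z n c =
  Num.sqrt n%:R * (inner (shift_dir X pi) (score X pi (proportions R n c)) /
    Num.sqrt (shift_info X pi)).
Proof.
move=> n0 cn; have nR : 0 < n%:R :> R by rewrite ltr0n.
have q0 : 0 < Num.sqrt n%:R :> R by rewrite sqrtr_gt0.
have iE : inner (shift_dir X pi) (score X pi (proportions R n c)) =
    inner (X *m shift_dir X pi) (proportions R n c - pi) by rewrite inner_mulmx trmxK.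
rewrite iE /zscore /zeta; set w := X *m _; set s := Num.sqrt (shift_info X pi).
transitivity ((Num.sqrt n%:R)^-1 *
    ((n%:R * inner w (proportions R n c) - n%:R * inner pi w) / s)).
  have nE : n%:R = \sum_i (c i 0)%:R :> R by rewrite -natr_sum -[(\sum_i _)%N]/(sample_size c) cn.
  have pE : n%:R * inner w (proportions R n c) = \sum_i (c i 0)%:R * w i 0.
    rewrite innerE mulr_sumr; apply: eq_bigr => i _.
    by rewrite [proportions _ _ _ _ _]mxE [counts _ _ _ _]mxE; field; rewrite gt_eqF.
  rewrite pE [X in _ - X * _]nE !mulr_suml -sumrB mulr_suml; congr (_ * _).
  by apply: eq_bigr => i _; ring.
have s0 : s != 0 by rewrite gt_eqF// sqrtr_gt0; case: (mle_expansions pi_gt0 pi_sum hX).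
have qE : n%:R = Num.sqrt n%:R ^+ 2 :> R by rewrite sqr_sqrtr// ltW.
rewrite innerBr (innerC w pi); set q := Num.sqrt _ in q0 qE *.
by rewrite qE; field; rewrite s0 gt_eqF.
Qed.

(** All statistics are functions of the standardized linear statistic, up to
    errors uniform in [n] on the scale of [tau]: second-order errors are multiplied
    by the root of [n], third-order errors by [n]. *)
Lemma remainders : exists C e0 : R, [/\ 0 <= C, 0 < e0 &
  forall n c, (0 < n)%N -> sample_size c = n -> tau pi n c <= n%:R * e0 ->
  let B := C * (1 + tau pi n c) ^+ 2 / Num.sqrt n%:R in
  [/\ `|alpha_stat n c - z n c| <= B, `|gamma_stat n c + z n c| <= B,
      `|deviance n c - z n c ^+ 2| <= B, `|wald_alpha n c - deviance n c| <= B &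
      `|wald_gamma n c - deviance n c| <= B]].
Proof.
have [e1 e10 est] := estimators_exist simplex_pi log_pi hX hpitilde hpihat halphahat.
have [i0 [C [e2 [C0 e20 H]]]] := mle_expansions pi_gt0 pi_sum hX.
pose e3 := Num.min e1 e2; have e30 : 0 < e3 by rewrite lt_min e10.
exists C, (e3 ^+ 2); split=> //; first exact: exprn_gt0.
move=> n c n0 cn tn B.
have nR : 0 < n%:R :> R by rewrite ltr0n.
set p := proportions R n c; set eps := nrm (p - pi).
have epsE : eps ^+ 2 = tau pi n c / n%:R by exact: nrm_tau.
have eps3 : eps <= e3.
  rewrite -(@ler_pXn2r _ 2) ?nnegrE ?nrm_ge0 ?(ltW e30)// epsE.
  by rewrite ler_pdivrMr// mulrC.
move: eps3; rewrite le_min => /andP[eps1 eps2].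
have [u [ut [hatE u0 lu ml [tilE umax]]]] := est n c n0 cn eps1.
have [[ipos apos] HA HB HC [HL HG]] := H p u ut (alphahat n c) eps2 u0 lu ml umax.
rewrite -hatE in ipos; move: HA HB HC HL HG; rewrite -/eps -hatE.
set i := shift_info X (pihat n c) in ipos *; set a := alphahat n c.
set zz := _ / Num.sqrt (shift_info X pi); set dev := 2 * _.
set q : R := Num.sqrt n%:R; have q0 : 0 < q by rewrite sqrtr_gt0.
have qE : n%:R = q ^+ 2 by rewrite sqr_sqrtr// ltW.
have zE : z n c = q * zz by exact: zscoreE.
have siE : Num.sqrt i ^+ 2 = i by rewrite sqr_sqrtr// ltW.
have si0 : 0 < Num.sqrt i by rewrite sqrtr_gt0.
have g0 : 0 < adjustment a by rewrite /adjustment divr_gt0.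
have gE : adjustment a - 1 = - (a * adjustment a).
  by rewrite /adjustment; field; rewrite gt_eqF.
have s2E : sigma2_alpha X n (pihat n c) = (q * Num.sqrt i) ^- 2.
  by rewrite sigma2_alphaE -/i exprMn siE -qE.
have sE : Num.sqrt (sigma2_alpha X n (pihat n c)) = (q * Num.sqrt i)^-1.
  by rewrite s2E -exprVn sqrtr_sqr ger0_norm// invr_ge0 mulr_ge0// ltW.
have alphaE : alpha_stat n c = q * (Num.sqrt i * a).
  by rewrite /alpha_stat sE invrK -/a; ring.
have gammaE : gamma_stat n c = - (q * (adjustment a ^+ 3 * (Num.sqrt i * a))).
  rewrite /gamma_stat /sigma2_gamma -/a gE s2E.
  rewrite (_ : (q * Num.sqrt i) ^- 2 / adjustment a ^+ 4 =
    ((q * Num.sqrt i)^-1 / adjustment a ^+ 2) ^+ 2); last first.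
    by field; rewrite !gt_eqF.
  have pos : 0 <= (q * Num.sqrt i)^-1 / adjustment a ^+ 2.
    by apply: divr_ge0; [rewrite invr_ge0; apply: mulr_ge0; exact: ltW|exact: sqr_ge0].
  rewrite sqrtr_sqr (ger0_norm pos).
  by field; rewrite !gt_eqF.
have LE : wald_alpha n c = n%:R * (a ^+ 2 * i).
  rewrite /wald_alpha /L_stat -/a s2E -[in RHS]siE qE.
  by field; rewrite !gt_eqF.
have GE : wald_gamma n c = n%:R * (adjustment a ^+ 6 * a ^+ 2 * i).
  rewrite /wald_gamma /G_stat /sigma2_gamma -/a gE s2E -[in RHS]siE qE.
  by field; rewrite !gt_eqF.
have DE : deviance n c = n%:R * dev.
  have cE : counts R c = n%:R *: p by rewrite scalerA mulfV ?scale1r ?gt_eqF.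
  have p1 : \sum_j p j 0 = 1 by exact: proportions_sum1.
  have hE := inner_log_exp_family X simplex_pi u p1.
  have tE := inner_log_exp_family X simplex_pi ut p1.
  rewrite (exp_family_tilt u0) -hatE in hE; rewrite -tilE in tE.
  by rewrite /deviance /D_stat cE innerZl innerBr hE tE /dev; ring.
have t0 : 0 <= tau pi n c by exact: tau_ge0.
have eps0 : 0 <= eps by exact: nrm_ge0.
have teps : tau pi n c = n%:R * eps ^+ 2 by rewrite epsE mulrC divfK// gt_eqF.
have B2 : q * (C * eps ^+ 2) <= B.
  rewrite /B -/q ler_pdivlMr//.
  have -> : q * (C * eps ^+ 2) * q = C * tau pi n c by rewrite teps qE; ring.
  by rewrite ler_wpM2l//; move: (tau pi n c) t0 => t; nra.
have B3 : n%:R * (C * eps ^+ 3) <= B.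
  rewrite /B -/q ler_pdivlMr//.
  have -> : n%:R * (C * eps ^+ 3) * q = C * (tau pi n c * (eps * q)) by rewrite teps; ring.
  rewrite ler_wpM2l//.
  have h : eps * q <= 1 + tau pi n c.
    have -> : tau pi n c = (eps * q) ^+ 2 by rewrite teps qE; ring.
    by have := sqr_ge0 (eps * q - 1); move: (eps * q) => y; nra.
  rewrite (le_trans (ler_wpM2l t0 h))// expr2 ler_wpM2r ?addr_ge0//.
  by rewrite lerDr.
move=> HA HB HC HL HG; split.
- apply: le_trans B2; rewrite alphaE zE -mulrBr normrM (gtr0_norm q0).
  by rewrite ler_wpM2l// ltW.
- apply: le_trans B2; rewrite gammaE zE -mulrN -mulrDr normrM (gtr0_norm q0).
  by rewrite ler_wpM2l// ltW.
- apply: le_trans B3; rewrite DE zE exprMn -qE -mulrBr normrM (gtr0_norm nR).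
  by rewrite ler_wpM2l// ltW.
- apply: le_trans B3; rewrite DE LE -mulrBr normrM (gtr0_norm nR).
  by rewrite ler_wpM2l// ltW.
- apply: le_trans B3; rewrite DE GE -mulrBr normrM (gtr0_norm nR).
  by rewrite ler_wpM2l// ltW.
Qed.

Let clt_pos t : pr n [set c | z n c <= t] @[n --> \oo] --> Phi t.
Proof. by apply: (clt pi_ge0 pi_sum); [exact: zeta_mean|exact: zeta_var]. Qed.

Let clt_neg t : pr n [set c | - z n c <= t] @[n --> \oo] --> Phi t.
Proof.
have -> : (fun n => pr n [set c | - z n c <= t]) =
    (fun n => pr n [set c | zscore (fun j => - zeta X pi j) n c <= t]).
  apply/funext => n; congr multinomial_pr; apply/funext => c /=; congr (is_true (_ <= t)).
  rewrite /zscore -mulrN -sumrN; congr (_ * _); apply: eq_bigr => j _.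
  by rewrite mulrN.
apply: (clt pi_ge0 pi_sum).
  by under eq_bigr do rewrite mulrN; rewrite sumrN zeta_mean// oppr0.
by under eq_bigr do rewrite sqrrN; exact: zeta_var.
Qed.

(** The two half-line events for [z] and [- z] cover everything, so the probability
    of their intersection is the sum of their probabilities minus 1. *)
Let clt_sqr t : pr n [set c | z n c ^+ 2 <= t] @[n --> \oo] -->
  fine (chi_square1 R `]-oo, t]%classic).
Proof.
rewrite chi_square1_le /=; case: ltP => t0.
  rewrite (_ : (fun n => _) = fun=> 0); first exact: cvg_cst.
  apply/funext => n; rewrite -[RHS](multinomial_mean0 pi n); apply: multinomial_mean_ext => c _.
  rewrite indicE memNset//= => h.
  by have := le_lt_trans h t0; rewrite ltNge sqr_ge0.
rewrite (_ : (fun n => _) = fun n => pr n [set c | z n c <= Num.sqrt t] +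
    pr n [set c | - z n c <= Num.sqrt t] - 1).
  rewrite (_ : 2 * _ = Phi (Num.sqrt t) + Phi (Num.sqrt t)); last by ring.
  by apply: cvgB; [apply: cvgD; [exact: clt_pos|exact: clt_neg]|exact: cvg_cst].
apply/funext => n; rewrite -[X in _ - X](multinomial_mean_cst pi_sum n 1) -mulN1r -multinomial_meanZ -!multinomial_meanD.
apply: multinomial_mean_ext => c _; rewrite !indicE.
have inE' (Q : 'cV[nat]_r -> bool) : (c \in [set c | Q c]) = Q c by apply/idP/idP; rewrite inE.
rewrite !inE'.
have -> : (z n c ^+ 2 <= t) = (z n c <= Num.sqrt t) && (- z n c <= Num.sqrt t).
  rewrite -{1}(sqr_sqrtr t0) -(real_normK (num_real (z n c))) ler_pXn2r ?nnegrE ?sqrtr_ge0//.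
  by rewrite ler_norml andbC lerNl.
case: leP => h1; case: leP => h2; rewrite ?addrK ?addr0 ?add0r ?mulN1r ?subrr//=; try ring.
by have := sqrtr_ge0 t; lra.
Qed.

Let small_remainder (W : nat -> 'cV[nat]_r -> R) (C e0 : R) : 0 <= C -> 0 < e0 ->
  (forall n c, (0 < n)%N -> sample_size c = n -> tau pi n c <= n%:R * e0 ->
    `|W n c| <= C * (1 + tau pi n c) ^+ 2 / Num.sqrt n%:R) ->
  forall e, 0 < e -> pr n [set c | e <= `|W n c| ] @[n --> \oo] --> (0 : R).
Proof. by move=> C0 e00 H; exact: (pr_remainder pi_ge0 pi_sum e00 C0 H). Qed.

Lemma alpha_stat_cdf t : pr n [set c | alpha_stat n c <= t] @[n --> \oo] --> Phi t.
Proof.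
have [C [e0 [C0 e00 H]]] := remainders.
apply: (slutsky pi_ge0 clt_pos) => [|]; last exact: continuous_Phi.
by apply: (small_remainder C0 e00) => n c n0 cn /(H n c n0 cn)[].
Qed.

Lemma gamma_stat_cdf t : pr n [set c | gamma_stat n c <= t] @[n --> \oo] --> Phi t.
Proof.
have [C [e0 [C0 e00 H]]] := remainders.
apply: (slutsky pi_ge0 clt_neg) => [|]; last exact: continuous_Phi.
apply: (small_remainder C0 e00) => n c n0 cn /(H n c n0 cn)[_ h _ _ _].
by rewrite opprK.
Qed.

Lemma deviance_cdf t : {for t, continuous (fun u => fine (chi_square1 R `]-oo, u]%classic))} ->
  pr n [set c | deviance n c <= t] @[n --> \oo] --> fine (chi_square1 R `]-oo, t]%classic).
Proof.
have [C [e0 [C0 e00 H]]] := remainders.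
apply: (slutsky pi_ge0 clt_sqr).
by apply: (small_remainder C0 e00) => n c n0 cn /(H n c n0 cn)[].
Qed.

Lemma wald_alpha_equiv e : 0 < e ->
  pr n [set c | e <= `|wald_alpha n c - deviance n c| ] @[n --> \oo] --> (0 : R).
Proof.
have [C [e0 [C0 e00 H]]] := remainders.
by move: e; apply: (small_remainder C0 e00) => n c n0 cn /(H n c n0 cn)[].
Qed.

Lemma wald_gamma_equiv e : 0 < e ->
  pr n [set c | e <= `|wald_gamma n c - deviance n c| ] @[n --> \oo] --> (0 : R).
Proof.
have [C [e0 [C0 e00 H]]] := remainders.
by move: e; apply: (small_remainder C0 e00) => n c n0 cn /(H n c n0 cn)[].
Qed.

End Assembly.

Section Transfer.
Variables (R : realType) (r : nat) (pi : 'cV[R]_r).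
Hypothesis pi_sum : \sum_i pi i 0 = 1.
Variables (d : nat -> measure_display) (T : forall n, measurableType (d n)).
Variables (P : forall n, probability (T n) R) (y : forall n, T n -> 'cV[nat]_r).
Arguments y : clear implicits.
Hypothesis hy : forall n, has_multinomial_law (P n) (y n) n pi.
Arguments hy : clear implicits.
Implicit Types f g : nat -> 'cV[nat]_r -> R.

Lemma measurable_statistic f n : measurable_fun setT (fun w => f n (y n w)).
Proof.
move=> _ B mB; rewrite setTI.
exact: (pr_event pi_sum (hy n) ((f n) @^-1` B)).1.
Qed.

Lemma cvg_event (A : nat -> set 'cV[nat]_r) (l : R) :
  multinomial_pr pi n (A n) @[n --> \oo] --> l -> (fun n => P n (y n @^-1` A n)) @ \oo --> l%:E.
Proof.
move=> Al; rewrite (_ : (fun n => _) = fun n => (multinomial_pr pi n (A n))%:E).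
  by apply/fine_cvgP; split; [exact: nearW|exact: Al].
by apply/funext => n; rewrite (pr_event pi_sum (hy n) (A n)).2.
Qed.

Lemma cvg_in_distribution_statistic f (mu : probability (measurableTypeR R) R) :
  (forall x, {for x, continuous (fun t : R => fine (mu `]-oo, t]%classic))} ->
    multinomial_pr pi n [set c | f n c <= x] @[n --> \oo] --> fine (mu `]-oo, x]%classic)) ->
  cvg_in_distribution P (fun n w => f n (y n w)) mu.
Proof.
move=> fmu; split=> [n|x cx]; first exact: measurable_statistic.
have fin t : mu `]-oo, t]%classic \is a fin_num by rewrite fin_num_measure.
rewrite -(fineK (fin x)); apply: (@cvg_event (fun n => [set c | f n c <= x])).
by apply: fmu; apply: fine_cvg; rewrite fineK.
Qed.

Lemma asymptotically_equivalent_statistic f g :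
  (forall e, 0 < e -> multinomial_pr pi n [set c | e <=
    `|f n c - g n c| ] @[n --> \oo] --> (0 : R)) ->
  asymptotically_equivalent P (fun n w => f n (y n w)) (fun n w => g n (y n w)).
Proof.
move=> fg; split=> [n|]; first exact: measurable_statistic.
by split=> [n|e e0]; [exact: measurable_statistic|exact: (@cvg_event (fun n => [set c | e <=
  `|f n c - g n c| ]) 0 (fg e e0))].
Qed.

End Transfer.

Theorem mainTheorem4 (R : realType) (r k : nat) (X : 'M[R]_(r, k))
    (hX : design_matrix X)
    (pi0 : 'cV[R]_r) (hpi0 : multiplicative_model X pi0)
    (d : nat -> measure_display) (T : forall n, measurableType (d n))
    (P : forall n, probability (T n) R)
    (y : forall n, T n -> 'cV[nat]_r)
    (hy : forall n, has_multinomial_law (P n) (y n) n pi0)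
    (pitilde pihat : nat -> 'cV[nat]_r -> 'cV[R]_r)
    (hpitilde : mle_estimator (loglinear_model X) pitilde)
    (hpihat : mle_estimator (multiplicative_model X) pihat)
    (alphahat : nat -> 'cV[nat]_r -> R)
    (halphahat : multiplier_estimator X pihat alphahat) :
  let pit n w := pitilde n (y n w) in
  let pih n w := pihat n (y n w) in
  let alpha n w := alphahat n (y n w) in
  let gamma n w := adjustment (alpha n w) in
  let sigma_alpha n w := Num.sqrt (sigma2_alpha X n (pih n w)) in
  let sigma_gamma n w := Num.sqrt (sigma2_gamma X n (pih n w) (alpha n w)) in
  let DM n w := D_stat (y n w) (pit n w) (pih n w) in
  let L n w := L_stat X n (pih n w) (alpha n w) in
  let G n w := G_stat X n (pih n w) (alpha n w) in
  (cvg_in_distribution P (fun n w => alpha n w / sigma_alpha n w)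
     (std_normal R) /\
   cvg_in_distribution P (fun n w => (gamma n w - 1) / sigma_gamma n w)
     (std_normal R)) /\
  cvg_in_distribution P DM (chi_square1 R) /\
  (asymptotically_equivalent P L DM /\ asymptotically_equivalent P G DM).
Proof.
have [simplex_pi0 [th0 log_pi0]] := hpi0.
have pi_sum := simplex_sum1 simplex_pi0.
move=> pit pih alpha gamma sigma_alpha sigma_gamma DM L G; split; split.
- apply: (cvg_in_distribution_statistic pi_sum hy
    (f := alpha_stat X pihat alphahat)) => x _.
  exact: (alpha_stat_cdf hX simplex_pi0 log_pi0 hpitilde hpihat halphahat).
- apply: (cvg_in_distribution_statistic pi_sum hy
    (f := gamma_stat X pihat alphahat)) => x _.
  exact: (gamma_stat_cdf hX simplex_pi0 log_pi0 hpitilde hpihat halphahat).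
- apply: (cvg_in_distribution_statistic pi_sum hy
    (f := deviance pitilde pihat)) => x cx.
  exact: (deviance_cdf hX simplex_pi0 log_pi0 hpitilde hpihat halphahat).
- split.
  + apply: (asymptotically_equivalent_statistic pi_sum hy
      (f := wald_alpha X pihat alphahat) (g := deviance pitilde pihat)) => e e0.
    exact: (wald_alpha_equiv hX simplex_pi0 log_pi0 hpitilde hpihat halphahat).
  + apply: (asymptotically_equivalent_statistic pi_sum hy
      (f := wald_gamma X pihat alphahat) (g := deviance pitilde pihat)) => e e0.
    exact: (wald_gamma_equiv hX simplex_pi0 log_pi0 hpitilde hpihat halphahat).
Qed.
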